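(* Let $N\ge2$ be a fixed integer and let $R>0$. Then there is a constant $A_R>0$ depending only on $R$ such that for any potentials $\mathrm q=[q_j]_{j=1}^N$ and $\tilde{\mathrm q}=[\tilde q_j]_{j=1}^N$ on the star-graph satisfying $$\omega_j=\tilde\omega_j,\quad j=1,\dots,N,\qquad \|\mathrm q\|<R,\qquad\|\tilde{\mathrm q}\|<R,$$ the following estimate holds: $$\|\mathrm q-\tilde{\mathrm q}\|\le A_R\,\varepsilon,\qquad \varepsilon:=\big\|\rho^N\big(\Delta(\rho^2)-\tilde\Delta(\rho^2)\big)\big\|_{L_2(\mathbb R)}+\sum_{k=2}^N\big\|\rho^{N-1}\big(\Delta_k(\rho^2)-\tilde\Delta_k(\rho^2)\big)\big\|_{L_2(\mathbb R)},$$ where the $L_2(\mathbb R)$-norms are taken with respect to $\rho\in\mathbb R$.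
   Context: Star-graph with $N$ edges of length $\pi$ ($N\ge2$ fixed). A potential is a vector function $\mathrm q=[q_j]_{j=1}^N$ with complex-valued $q_j\in L_2(0,\pi)$, with norm $\|\mathrm q\|=\max_{1\le j\le N}\|q_j\|_{L_2(0,\pi)}$. Put $\omega_j=\frac12\int_0^\pi q_j(t)\,dt$. For $j=1,\dots,N$ let $S_j(x,\lambda)$, $C_j(x,\lambda)$ be the solutions of $-y''+q_j(x)y=\lambda y$ on $(0,\pi)$ with $S_j(0,\lambda)=C_j'(0,\lambda)=0$, $S_j'(0,\lambda)=C_j(0,\lambda)=1$ (prime is the derivative in $x$). The characteristic functions are the entire functions of $\lambda$ (all $S_j,S_j',C_j,C_j'$ evaluated at $(\pi,\lambda)$; product indices $l$ range over $\{1,\dots,N\}$ with the indicated exclusions, empty sums are $0$, empty products are $1$) $$\Delta(\lambda)=C_1\prod_{l=2}^NS_l+\sum_{j=2}^NS_j'\prod_{l\ne j}S_l,$$ $$\Delta_k(\lambda)=C_k\Big(C_1\prod_{l\ne1,k}S_l+\sum_{j\ne1,k}S_j'\prod_{l\ne j,k}S_l\Big)+C_k'\prod_{l\ne k}S_l,\qquad k=2,\dots,N.$$ They are the characteristic functions of the boundary value problems for the system $-y_j''+q_jy_j=\lambda y_j$ ($j=1,\dots,N$) with the matching conditions $y_1(0)=y_j(\pi)$ ($j=2,\dots,N$), $y_1'(0)=\sum_{j=2}^Ny_j'(\pi)$ and, respectively, the boundary conditions $y_1(\pi)=0$, $y_j(0)=0$ ($j=2,\dots,N$) for $\Delta$,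 and $y_1(\pi)=0$, $y_j(0)=0$ ($j\in\{2,\dots,N\}\setminus\{k\}$), $y_k'(0)=0$ for $\Delta_k$. Objects with a tilde are the same objects constructed from $\tilde{\mathrm q}$. *)

(* Defs.v *)
From HB Require Import structures.
From mathcomp Require Import all_boot all_order all_algebra.
From mathcomp Require Import complex.
From mathcomp Require Import all_classical all_reals all_analysis.

Set Implicit Arguments.
Unset Strict Implicit.
Unset Printing Implicit Defensive.

Import Order.TTheory GRing.Theory Num.Theory.
Import numFieldNormedType.Exports.

Local Open Scope classical_set_scope.
Local Open Scope ring_scope.

Section ComplexValued.
Variable R : realType.
Implicit Types (f g : R -> R[i]) (D : set R).

(* The norm `|z| of R[i] takes its values in R[i]; this is the same modulus,
   with values in R. *)
Definition cmod (z : R[i]) : R := Normc.normc z.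

Definition cmeasurable D f : Prop :=
  measurable_fun D (fun x => complex.Re (f x)) /\
  measurable_fun D (fun x => complex.Im (f x)).

Definition cintegral D f : R[i] :=
  Complex (\int[lebesgue_measure]_(x in D) complex.Re (f x))
          (\int[lebesgue_measure]_(x in D) complex.Im (f x)).

Definition L2norm D f : \bar R :=
  Lnorm lebesgue_measure 2%:E (fun x => (\1_D x * cmod (f x))%:E).

Definition inL2 D f : Prop := cmeasurable D f /\ (L2norm D f < +oo)%E.

(* f is differentiable at the real point x, with derivative v; R[i] is not a
   normed R-module in the library, hence the componentwise definition. *)
Definition has_cderive f (x : R) (v : R[i]) : Prop :=
  is_derive x (1 : R) (fun t => complex.Re (f t) : R) (complex.Re v) /\
  is_derive x (1 : R) (fun t => complex.Im (f t) : R) (complex.Im v).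

Definition absolutely_continuous (a b : R) f : Prop :=
  forall e : R, 0 < e -> exists2 d : R, 0 < d &
    forall (n : nat) (s t : 'I_n -> R),
      (forall i, [/\ a <= s i, s i <= t i & t i <= b]) ->
      trivIset [set: 'I_n] (fun i => [set` `]s i, t i[]) ->
      \sum_(i < n) (t i - s i) < d ->
      \sum_(i < n) cmod (f (t i) - f (s i)) < e.

End ComplexValued.

Section StarGraph.
Variable R : realType.

Definition edge : set R := [set` `]0, pi[].

(* y solves - y'' + q y = lambda y on (0, pi) in the sense of Caratheodory:
   y and y' are absolutely continuous on [0, pi] and the equation holds almost
   everywhere. The function dy is y' on (0, pi); by continuity, dy 0 and dy pi
   are the values of y' at the end points. *)
Definition SL_solution (q : R -> R[i]) (lambda : R[i]) (y dy : R -> R[i]) : Prop :=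
  [/\ absolutely_continuous 0 pi y,
      absolutely_continuous 0 pi dy,
      forall x, edge x -> has_cderive y x (dy x) &
      {ae (@lebesgue_measure R), forall x, edge x ->
        exists2 d2y : R[i], has_cderive dy x d2y &
          - d2y + q x * y x = lambda * y x}].

(* The solutions S, C of one edge with their x-derivatives, as functions of
   (x, lambda). For q in L2(0, pi) they exist and, for x in [0, pi], are unique. *)
Record edge_solutions (q : R -> R[i]) := EdgeSolutions {
  solS : R -> R[i] -> R[i];
  dsolS : R -> R[i] -> R[i];
  solC : R -> R[i] -> R[i];
  dsolC : R -> R[i] -> R[i];
  solS_eq : forall lambda, SL_solution q lambda (solS^~ lambda) (dsolS^~ lambda);
  solC_eq : forall lambda, SL_solution q lambda (solC^~ lambda) (dsolC^~ lambda);
  solS_init : forall lambda, solS 0 lambda = 0 /\ dsolS 0 lambda = 1;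
  solC_init : forall lambda, solC 0 lambda = 1 /\ dsolC 0 lambda = 0 }.

Variable N : nat.
Implicit Types (q : 'I_N -> R -> R[i]).

Definition is_potential q : Prop := forall j, inL2 edge (q j).

Definition potential_norm q : \bar R :=
  \big[Order.max/0%E]_(j < N) L2norm edge (q j).

Definition omega q (j : 'I_N) : R[i] := 2^-1 * cintegral edge (q j).

(* The edges are indexed by 'I_N; o stands for the distinguished edge, the one
   numbered 1 when the edges are numbered from 1 to N. *)
Section Characteristic.
Variables (o : 'I_N) (q : 'I_N -> R -> R[i]) (Y : forall j, edge_solutions (q j)).
Variable lambda : R[i].

Let S j := solS (Y j) pi lambda.
Let S' j := dsolS (Y j) pi lambda.
Let C j := solC (Y j) pi lambda.
Let C' j := dsolC (Y j) pi lambda.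

Definition Delta : R[i] :=
  C o * \prod_(l | l != o) S l
  + \sum_(j | j != o) S' j * \prod_(l | l != j) S l.

Definition DeltaK (k : 'I_N) : R[i] :=
  C k * (C o * \prod_(l | (l != o) && (l != k)) S l
         + \sum_(j | (j != o) && (j != k))
             S' j * \prod_(l | (l != j) && (l != k)) S l)
  + C' k * \prod_(l | l != k) S l.

End Characteristic.

Definition spectral_distance (o : 'I_N) (q qt : 'I_N -> R -> R[i])
    (Y : forall j, edge_solutions (q j)) (Yt : forall j, edge_solutions (qt j)) :
    \bar R :=
  (L2norm setT (fun rho : R => let z := real_complex R rho in
     z ^+ N * (Delta o Y (z ^+ 2) - Delta o Yt (z ^+ 2)))%R
   + \sum_(k < N | k != o) L2norm setT (fun rho : R => let z := real_complex R rho in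
     z ^+ N.-1 * (DeltaK o Y (z ^+ 2) k - DeltaK o Yt (z ^+ 2) k))%R)%E.

End StarGraph.

(* Main.v *)
Require Import Defs.
From mathcomp Require Import all_boot all_order all_algebra.
From mathcomp Require Import complex.
From mathcomp Require Import all_classical all_reals all_analysis.
From mathcomp Require Import measurable_realfun ring lra.

(* Write lambda = rho ^+ 2 with rho real. For k <> 1 let psi_k be the solution on edge k with
   Cauchy data (Delta, - Delta_k) at 0, and let chi be the solution on edge 1 that vanishes at pi.
   The Lagrange identity turns G_k = Delta_k Delta~ - Delta Delta~_k into
     int (q_k - q~_k) psi_k psi~_k + P_1 P~_1 int (q_1 - q~_1) chi chi~
       + sum_j P_j P~_j int (q_j - q~_j) S_j S~_j,
   where P_j is the product of the S_l(pi) with l <> j, k. Since G_k is a combination of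
   Delta - Delta~ and Delta_k - Delta~_k with coefficients bounded after scaling, the L2 norm of
   rho ^+ (2 N - 2) G_k is bounded by the spectral distance.
   As functions of rho, the solutions are superpositions of the exponentials exp(i s rho) with
   s bounded below. The exponents of rho ^+ (2 N - 2) psi_k(x) psi~_k(x) start at 2 x - 2 N pi,
   with an explicit nonzero leading coefficient, while those of all other terms of G_k start at
   2 pi - 2 N pi. So the part of q_k - q~_k on (0, a) is seen, modulo higher exponents and an
   O(1/rho) remainder, as a Fourier transform supported below the other terms; the restriction
   to low frequencies (through Poisson kernels) bounds its norm, and finitely many short steps
   in a exhaust (0, pi). This gives q_k - q~_k for k <> 1; subtracting these terms, which are
   bounded in L2 because the omegas agree, leaves the term of edge 1, treated in the same way. *)

Set Implicit Arguments.
Unset Strict Implicit.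
Unset Printing Implicit Defensive.

Import Order.TTheory GRing.Theory Num.Theory.
Import numFieldNormedType.Exports.

Local Open Scope classical_set_scope.
Local Open Scope ring_scope.

Local Notation ReC := complex.Re.
Local Notation ImC := complex.Im.

(** * Complex-valued functions of a real variable *)

Section ComplexModulus.
Variable R : realType.
Implicit Types (z w : R[i]) (x : R).

Lemma cmod_ge0 z : 0 <= cmod z.
Proof. by case: z => a b; rewrite /cmod /= sqrtr_ge0. Qed.

Lemma cmod0 : cmod (0 : R[i]) = 0.
Proof. exact: Normc.normc0. Qed.

Lemma cmod1 : cmod (1 : R[i]) = 1.
Proof. exact: Normc.normc1. Qed.

Lemma cmod_eq0 z : cmod z = 0 -> z = 0.
Proof. exact: Normc.eq0_normc. Qed.

Lemma cmodM z w : cmod (z * w) = cmod z * cmod w.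
Proof. exact: Normc.normcM. Qed.

Lemma cmodV z : cmod z^-1 = (cmod z)^-1.
Proof. exact: Normc.normcV. Qed.

Lemma cmodD z w : cmod (z + w) <= cmod z + cmod w.
Proof. exact: le_normcD. Qed.

Lemma cmodN z : cmod (- z) = cmod z.
Proof. exact: normcN. Qed.

Lemma cmodB z w : cmod (z - w) <= cmod z + cmod w.
Proof. by rewrite (le_trans (cmodD _ _))// cmodN. Qed.

Lemma cmod_distC z w : cmod (z - w) = cmod (w - z).
Proof. by rewrite -opprB cmodN. Qed.

Lemma sqr_cmod z : cmod z ^+ 2 = ReC z ^+ 2 + ImC z ^+ 2.
Proof. by case: z => a b; rewrite /cmod /= sqr_sqrtr// addr_ge0// sqr_ge0. Qed.

Lemma cmod_real x : cmod (real_complex R x) = `|x|.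
Proof. by rewrite /cmod /= expr0n/= addr0 sqrtr_sqr. Qed.

Lemma cmod_conj z : cmod (z^*)%C = cmod z.
Proof. by case: z => a b; rewrite /cmod /= sqrrN. Qed.

Lemma ler_cmod_sqr z x : 0 <= x -> (cmod z <= x) = (ReC z ^+ 2 + ImC z ^+ 2 <= x ^+ 2).
Proof. by move=> x0; rewrite -sqr_cmod ler_sqr// nnegrE ?cmod_ge0. Qed.

Lemma ler_norm_Re z : `|ReC z| <= cmod z.
Proof.
rewrite -ler_sqr ?nnegrE ?cmod_ge0//.
by rewrite sqr_cmod real_normK ?num_real// lerDl sqr_ge0.
Qed.

Lemma ler_norm_Im z : `|ImC z| <= cmod z.
Proof.
rewrite -ler_sqr ?nnegrE ?cmod_ge0//.
by rewrite sqr_cmod real_normK ?num_real// lerDr sqr_ge0.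
Qed.

Lemma ler_cmod_ReIm z : cmod z <= `|ReC z| + `|ImC z|.
Proof.
rewrite ler_cmod_sqr ?addr_ge0// sqrrD !real_normK ?num_real//.
by rewrite -addrA lerD2l lerDr mulrn_wge0// mulr_ge0.
Qed.

Lemma ReCD z w : ReC (z + w) = ReC z + ReC w. Proof. by case: z; case: w. Qed.
Lemma ImCD z w : ImC (z + w) = ImC z + ImC w. Proof. by case: z; case: w. Qed.
Lemma ReCN z : ReC (- z) = - ReC z. Proof. by case: z. Qed.
Lemma ImCN z : ImC (- z) = - ImC z. Proof. by case: z. Qed.
Lemma ReCM z w : ReC (z * w) = ReC z * ReC w - ImC z * ImC w.
Proof. by case: z; case: w. Qed.
Lemma ImCM z w : ImC (z * w) = ReC z * ImC w + ImC z * ReC w.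
Proof. by case: z; case: w. Qed.

Lemma complex_ext z w : ReC z = ReC w -> ImC z = ImC w -> z = w.
Proof. by case: z; case: w => a b c d /= -> ->. Qed.

Lemma mul_conj_cmod z : (z^*)%C * z = real_complex R (cmod z ^+ 2).
Proof.
by apply: complex_ext; rewrite ?ReCM ?ImCM /= ?sqr_cmod; case: z => a b /=; ring.
Qed.

Definition cis x : R[i] := Complex (cos x) (sin x).

Lemma cisD x y : cis (x + y) = cis x * cis y.
Proof.
by apply: complex_ext; rewrite ?ReCM ?ImCM/= ?cosD ?sinD//; ring.
Qed.

Lemma cis0 : cis 0 = 1.
Proof. by rewrite /cis cos0 sin0. Qed.

Lemma cmod_cis x : cmod (cis x) = 1.
Proof. by rewrite /cmod /= cos2Dsin2 sqrtr1. Qed.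

Lemma conj_cis x : (cis x)^*%C = cis (- x).
Proof. by rewrite /cis /= cosN sinN. Qed.

Definition half_i : R[i] := Complex 0 2^-1.

Lemma cmod_half_i : cmod half_i = 2^-1.
Proof. by rewrite /cmod /half_i /= expr0n add0r sqrtr_sqr ger0_norm ?invr_ge0. Qed.

Lemma sin_cis x : real_complex R (sin x) = half_i * cis (- x) - half_i * cis x.
Proof. by apply: complex_ext; rewrite /half_i /cis /= cosN sinN; lra. Qed.

Lemma cos_cis x : real_complex R (cos x) =
  real_complex R 2^-1 * cis (- x) + real_complex R 2^-1 * cis x.
Proof. by apply: complex_ext; rewrite /cis /= cosN sinN; lra. Qed.

End ComplexModulus.

Section ComplexMeasurable.
Variables (R : realType) (d : measure_display) (T : measurableType d).
Implicit Types (f g : T -> R[i]).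

Definition cmeas f := measurable_fun setT (fun x => ReC (f x)) /\
  measurable_fun setT (fun x => ImC (f x)).

Lemma cmeas_cst (c : R[i]) : cmeas (fun=> c).
Proof. by split; exact: measurable_cst. Qed.

Lemma cmeas_real (h : T -> R) : measurable_fun setT h -> cmeas (fun x => real_complex R (h x)).
Proof. by move=> mh; split => //=; exact: measurable_cst. Qed.

Lemma measurable_natr_bool (P : T -> bool) : measurable_fun setT P ->
  measurable_fun setT (fun x => ((P x)%:R : R)).
Proof.
move=> mP; rewrite (_ : (fun x => _) = fun x => if P x then 1 else 0); last first.
  by apply/funext => x; case: (P x).
by apply: measurable_fun_ifT.
Qed.

Lemma cmeasD f g : cmeas f -> cmeas g -> cmeas (fun x => f x + g x).
Proof.
move=> [f1 f2] [g1 g2]; split.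
- by under eq_fun do rewrite ReCD; exact: measurable_funD.
- by under eq_fun do rewrite ImCD; exact: measurable_funD.
Qed.

Lemma cmeasN f : cmeas f -> cmeas (fun x => - f x).
Proof.
move=> [f1 f2]; split.
- by under eq_fun do rewrite ReCN; exact: measurableT_comp.
- by under eq_fun do rewrite ImCN; exact: measurableT_comp.
Qed.

Lemma cmeasB f g : cmeas f -> cmeas g -> cmeas (fun x => f x - g x).
Proof. by move=> mf mg; apply: cmeasD => //; exact: cmeasN. Qed.

Lemma cmeasM f g : cmeas f -> cmeas g -> cmeas (fun x => f x * g x).
Proof.
move=> [f1 f2] [g1 g2]; split.
- by under eq_fun do rewrite ReCM; apply: measurable_funB; exact: measurable_funM.
- by under eq_fun do rewrite ImCM; apply: measurable_funD; exact: measurable_funM.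
Qed.

Lemma cmeas_conj f : cmeas f -> cmeas (fun x => (f x)^*%C).
Proof.
move=> [f1 f2]; split.
- by rewrite [X in measurable_fun _ X](_ : _ = fun x => ReC (f x))//; apply/funext => x;
    case: (f x).
- rewrite [X in measurable_fun _ X](_ : _ = fun x => - ImC (f x)); first exact: measurableT_comp.
  by apply/funext => x; case: (f x).
Qed.

Lemma cmeas_cmod f : cmeas f -> measurable_fun setT (fun x => cmod (f x)).
Proof.
move=> [f1 f2].
rewrite [X in measurable_fun _ X](_ : _ = fun x => Num.sqrt (ReC (f x) ^+ 2 + ImC (f x) ^+ 2)).
  apply: measurableT_comp; first exact: continuous_measurable_fun (@sqrt_continuous R).
  by apply: measurable_funD; exact: measurable_funX.
by apply/funext => x; rewrite -sqr_cmod sqrtr_sqr ger0_norm ?cmod_ge0.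
Qed.

Lemma cmeas_cis (h : T -> R) : measurable_fun setT h -> cmeas (fun x => cis (h x)).
Proof.
move=> mh; split => /=.
- by apply: measurableT_comp => //; exact: continuous_measurable_fun (@continuous_cos R).
- by apply: measurableT_comp => //; exact: continuous_measurable_fun (@continuous_sin R).
Qed.

Lemma eq_cmeas f g : f =1 g -> cmeas f -> cmeas g.
Proof. by move=> /funext ->. Qed.

End ComplexMeasurable.

Lemma cmeas_comp (R : realType) (d d' : measure_display) (T : measurableType d)
    (T' : measurableType d') (h : T -> T') (f : T' -> R[i]) :
  measurable_fun setT h -> cmeas f -> cmeas (fun x => f (h x)).
Proof. by move=> mh [f1 f2]; split;
  [exact: (measurableT_comp f1 mh)|exact: (measurableT_comp f2 mh)]. Qed.

Section ComplexIntegral.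
Variable R : realType.
Local Notation mu := (@lebesgue_measure R).
Implicit Types (f g : R -> R[i]) (h k : R -> R).

Definition rintegrable h := mu.-integrable setT (EFin \o h).
Definition cintegrable f := rintegrable (fun x => ReC (f x)) /\ rintegrable (fun x => ImC (f x)).
Local Notation cint f := (cintegral setT f).

Lemma measurable_rintegrable h : rintegrable h -> measurable_fun setT h.
Proof. by move=> /measurable_int/measurable_EFinP. Qed.

Lemma le_rintegrable h k : measurable_fun setT k -> rintegrable h ->
  (forall x, `|k x| <= h x) -> rintegrable k.
Proof.
move=> mk ih kh; apply: (le_integrable measurableT _ _ ih); first exact/measurable_EFinP.
by move=> x _ /=; rewrite lee_fin (le_trans (kh x))// ler_norm.
Qed.

Lemma integral_rintegrable h : rintegrable h ->
  (\int[mu]_x (h x)%:E = (\int[mu]_x h x)%:E)%E.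
Proof.
by move=> ih; rewrite /Rintegral fineK//; exact: (integrable_fin_num measurableT ih).
Qed.

Lemma ge0_rintegrable h b : measurable_fun setT h -> (forall x, 0 <= h x) ->
  (\int[mu]_x (h x)%:E <= b%:E)%E -> rintegrable h /\ \int[mu]_x h x <= b.
Proof.
move=> mh h0 int_h; have ih : rintegrable h.
  apply/integrableP; split; first exact/measurable_EFinP.
  apply: le_lt_trans (ltry b); apply: le_trans int_h; rewrite le_eqVlt; apply/orP; left; apply/eqP.
  by apply: eq_integral => x _ /=; rewrite ger0_norm.
by split => //; rewrite -lee_fin -integral_rintegrable.
Qed.

Lemma rintegrableD h k : rintegrable h -> rintegrable k -> rintegrable (fun x => h x + k x).
Proof. by move=> ih ik; exact: (integrableD measurableT ih ik). Qed.

Lemma rintegrableZ c h : rintegrable h -> rintegrable (fun x => c * h x).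
Proof. by move=> ih; exact: (integrableZl measurableT c ih). Qed.

Lemma rintegrableB h k : rintegrable h -> rintegrable k -> rintegrable (fun x => h x - k x).
Proof. by move=> ih ik; exact: (integrableB measurableT ih ik). Qed.

Lemma rintegrableM_bounded h k B : rintegrable h -> measurable_fun setT k ->
  (forall x, `|k x| <= B) -> rintegrable (fun x => h x * k x).
Proof.
move=> ih mk kB; apply: (le_rintegrable _ (rintegrableZ B (integrable_norm ih))) => [|x].
  by apply: measurable_funM => //; exact: measurable_rintegrable.
by rewrite normrM mulrC ler_wpM2r.
Qed.

Lemma norm_RintegralM_le h k B : rintegrable h -> measurable_fun setT k ->
  (forall x, `|k x| <= B) -> `|\int[mu]_x (h x * k x)| <= B * \int[mu]_x `|h x|.
Proof.
move=> ih mk kB; have ihk := rintegrableM_bounded ih mk kB.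
have nih : rintegrable (fun x => `|h x|) by exact: integrable_norm.
apply: le_trans (le_normr_Rintegral measurableT ihk) _; rewrite -RintegralZl//.
apply: le_Rintegral => //; [exact: integrable_norm|exact: rintegrableZ|].
by move=> x _; rewrite normrM mulrC ler_wpM2r.
Qed.

Lemma rintegrable0 : rintegrable (fun=> 0).
Proof. exact: integrable0. Qed.

Lemma cmeas_cintegrable f : cintegrable f -> cmeas f.
Proof. by move=> [f1 f2]; split; exact: measurable_rintegrable. Qed.

Lemma le_cintegrable f h : cmeas f -> rintegrable h ->
  (forall x, cmod (f x) <= h x) -> cintegrable f.
Proof.
move=> [f1 f2] ih fh; split; apply: (le_rintegrable _ ih) => // x.
- exact: le_trans (ler_norm_Re _) (fh x).
- exact: le_trans (ler_norm_Im _) (fh x).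
Qed.

Lemma rintegrable_norm h : rintegrable h -> rintegrable (fun x => `|h x|).
Proof. by move=> ih; exact: integrable_norm ih. Qed.

Lemma rintegrable_cmod f : cintegrable f -> rintegrable (fun x => cmod (f x)).
Proof.
move=> cf; have [f1 f2] := cf.
apply: (le_rintegrable _ (rintegrableD (rintegrable_norm f1) (rintegrable_norm f2))).
  exact/cmeas_cmod/cmeas_cintegrable.
by move=> x; rewrite ger0_norm ?cmod_ge0//; exact: ler_cmod_ReIm.
Qed.

Lemma cintegrableD f g : cintegrable f -> cintegrable g -> cintegrable (fun x => f x + g x).
Proof.
move=> [f1 f2] [g1 g2]; split.
- by under eq_fun do rewrite ReCD; exact: rintegrableD.
- by under eq_fun do rewrite ImCD; exact: rintegrableD.
Qed.

Lemma cintegrable_boundedM f g M : cmeas f -> (forall x, cmod (f x) <= M) -> cintegrable g ->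
  cintegrable (fun x => f x * g x).
Proof.
move=> mf fM ig; apply: (le_cintegrable _ (rintegrableZ M (rintegrable_cmod ig))).
  by apply: cmeasM => //; exact: cmeas_cintegrable.
by move=> x; rewrite cmodM ler_wpM2r ?cmod_ge0.
Qed.

Lemma cintegrableZ c f : cintegrable f -> cintegrable (fun x => c * f x).
Proof. by move=> cf; apply: (@cintegrable_boundedM (fun=> c) _ (cmod c)) => //;
  exact: cmeas_cst. Qed.

Lemma cintegrableN f : cintegrable f -> cintegrable (fun x => - f x).
Proof. by move=> cf; under eq_fun do rewrite -mulN1r; exact: cintegrableZ. Qed.

Lemma cintegrableB f g : cintegrable f -> cintegrable g -> cintegrable (fun x => f x - g x).
Proof. by move=> cf cg; apply: cintegrableD => //; exact: cintegrableN. Qed.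

Lemma eq_cint f g : f =1 g -> cint f = cint g.
Proof. by move=> /funext ->. Qed.

Lemma cint0 : cint (fun=> 0 : R[i]) = 0.
Proof. by rewrite /cintegral/= !Rintegral_cst// !mul0r. Qed.

Lemma cintD f g : cintegrable f -> cintegrable g ->
  cint (fun x => f x + g x) = cint f + cint g.
Proof.
move=> [f1 f2] [g1 g2]; apply: complex_ext; rewrite ?ReCD ?ImCD /=.
- by under eq_Rintegral do rewrite ReCD; rewrite RintegralD.
- by under eq_Rintegral do rewrite ImCD; rewrite RintegralD.
Qed.

Lemma cintZ c f : cintegrable f -> cint (fun x => c * f x) = c * cint f.
Proof.
move=> [f1 f2]; apply: complex_ext; rewrite ?ReCM ?ImCM /=.
- under eq_Rintegral do rewrite ReCM.
  by rewrite RintegralB//; [rewrite !RintegralZl|exact: rintegrableZ..].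
- under eq_Rintegral do rewrite ImCM.
  by rewrite RintegralD//; [rewrite !RintegralZl|exact: rintegrableZ..].
Qed.

Lemma cintZr c f : cintegrable f -> cint (fun x => f x * c) = cint f * c.
Proof. by move=> cf; under eq_cint do rewrite mulrC; rewrite cintZ// mulrC. Qed.

Lemma cintN f : cintegrable f -> cint (fun x => - f x) = - cint f.
Proof. by move=> cf; under eq_cint do rewrite -mulN1r; rewrite cintZ// mulN1r. Qed.

Lemma cintB f g : cintegrable f -> cintegrable g ->
  cint (fun x => f x - g x) = cint f - cint g.
Proof. by move=> cf cg; rewrite cintD ?cintN//; exact: cintegrableN. Qed.

Lemma cintegrable_conj f : cintegrable f -> cintegrable (fun x => (f x)^*%C).
Proof.
move=> cf; apply: (le_cintegrable _ (rintegrable_cmod cf)).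
  exact/cmeas_conj/cmeas_cintegrable.
by move=> x; rewrite cmod_conj.
Qed.

Lemma cint_conj f : cintegrable f -> cint (fun x => (f x)^*%C) = (cint f)^*%C.
Proof.
move=> [f1 f2]; apply: complex_ext => /=.
- by congr fine; apply: eq_integral => x _; case: (f x).
- rewrite -mulN1r -RintegralZl//; congr fine; apply: eq_integral => x _.
  by rewrite mulN1r; case: (f x).
Qed.

(* Rotate the integral onto the positive real axis and compare real parts. *)
Lemma cmod_cint f : cintegrable f -> cmod (cint f) <= \int[mu]_x cmod (f x).
Proof.
move=> cf; set I := cint f.
have [I0|I0] := eqVneq (cmod I) 0; first by rewrite I0 Rintegral_ge0// => x _; exact: cmod_ge0.
pose u : R[i] := (I^*)%C / real_complex R (cmod I).
have cI : cmod (real_complex R (cmod I)) = cmod I by rewrite cmod_real ger0_norm ?cmod_ge0.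
have uI : u * I = real_complex R (cmod I).
  have -> : u * I = (I^*)%C * I / real_complex R (cmod I) by rewrite /u; ring.
  rewrite mul_conj_cmod expr2 rmorphM.
  rewrite mulfK//; apply/eqP => /(congr1 (@cmod R)); rewrite cI cmod0; exact/eqP.
have cu : cmod u = 1.
  by apply: (mulIf I0); rewrite -cmodM uI cI mul1r.
have -> : cmod I = ReC (cint (fun x => u * f x)) by rewrite cintZ// -/I uI.
apply: le_Rintegral => //.
- by have [] := cintegrableZ u cf.
- exact: rintegrable_cmod.
- by move=> x _; rewrite (le_trans (ler_norm _))// (le_trans (ler_norm_Re _))// cmodM cu mul1r.
Qed.

Lemma le_cmod_cint f h : cmeas f -> rintegrable h -> (forall x, cmod (f x) <= h x) ->
  cmod (cint f) <= \int[mu]_x h x.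
Proof.
move=> mf ih fh; have cf := le_cintegrable mf ih fh.
apply: le_trans (cmod_cint cf) _; apply: le_Rintegral => //; exact: rintegrable_cmod.
Qed.

Lemma cintegrableM_bounded f g M : cintegrable f -> cmeas g ->
  (forall x, f x != 0 -> cmod (g x) <= M) -> cintegrable (fun x => f x * g x).
Proof.
move=> intf mg gM; apply: (le_cintegrable _ (rintegrableZ M (rintegrable_cmod intf))).
  by apply: cmeasM => //; exact: cmeas_cintegrable.
move=> x; rewrite cmodM mulrC; have [->|fx] := eqVneq (f x) 0; first by rewrite cmod0 !mulr0.
by rewrite ler_wpM2r ?cmod_ge0// gM.
Qed.

Lemma le_cmod_cintM f g M : cintegrable f -> cmeas g ->
  (forall x, f x != 0 -> cmod (g x) <= M) ->
  cmod (cint (fun x => f x * g x)) <= M * \int[mu]_x cmod (f x).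
Proof.
move=> intf mg gM; rewrite -RintegralZl//; last exact: rintegrable_cmod.
apply: le_cmod_cint.
- by apply: cmeasM => //; exact: cmeas_cintegrable.
- exact/rintegrableZ/rintegrable_cmod.
move=> x; rewrite cmodM mulrC; have [->|fx] := eqVneq (f x) 0; first by rewrite cmod0 !mulr0.
by rewrite ler_wpM2r ?cmod_ge0// gM.
Qed.

End ComplexIntegral.
Notation cint f := (cintegral setT f).

Section Fubini.
Variable R : realType.
Local Notation mu := (@lebesgue_measure R).

Section RealFubini.
Variables (k : R -> R -> R) (a b : R -> R).
Hypothesis mk : measurable_fun setT (fun p : R * R => k p.1 p.2).
Hypotheses (ia : rintegrable a) (ib : rintegrable b).
Hypothesis kab : forall x y, `|k x y| <= a x * b y.

Let mk1 x : measurable_fun setT (k x).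
Proof. exact: (measurableT_comp mk (pair1_measurable x)). Qed.

Let mk2 y : measurable_fun setT (k^~ y).
Proof. exact: (measurableT_comp mk (pair2_measurable y)). Qed.

Lemma rintegrable_section1 x : rintegrable (k x).
Proof. by apply: (le_rintegrable _ (rintegrableZ (a x) ib)) => //; exact: kab. Qed.

Lemma rintegrable_section2 y : rintegrable (k^~ y).
Proof.
apply: (le_rintegrable _ (rintegrableZ (b y) ia)) => // x.
by rewrite mulrC; exact: kab.
Qed.

Let mE : measurable_fun setT (fun p : R * R => (k p.1 p.2)%:E).
Proof. exact/measurable_EFinP. Qed.

Let ik : (mu \x mu)%E.-integrable setT (fun p : R * R => (k p.1 p.2)%:E).
Proof.
apply: (iffRL (@integrable12ltyP _ _ _ _ R mu mu _ mE)) => /=.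
have norm_ia := rintegrable_norm ia; have norm_ib := rintegrable_norm ib.
pose B := \int[mu]_y `|b y|.
have section_le x : (\int[mu]_y `|(k x y)%:E| <= (`|a x| * B)%:E)%E.
  rewrite EFinM /B -integral_rintegrable// -(integralZl measurableT norm_ib).
  apply: ge0_le_integral => //=.
  - by apply/measurable_EFinP; apply: measurableT_comp => //; exact: mk1.
  - apply/measurable_EFinP; apply: measurable_funM => //.
    exact: measurable_rintegrable norm_ib.
  - by move=> y _; rewrite lee_fin (le_trans (kab x y))// -normrM ler_norm.
apply: le_lt_trans (_ : (\int[mu]_x (`|a x| * B)%:E < +oo)%E).
  apply: ge0_le_integral => //=.
  - by move=> x _; exact: integral_ge0.
  - have := @measurable_fun_fubini_tonelli_F _ _ _ _ _ mu
      (abse \o (fun p : R * R => (k p.1 p.2)%:E)).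
    apply; last by move=> p; exact: abse_ge0.
    exact: measurableT_comp.
  - apply/measurable_EFinP; apply: measurable_funM => //.
    exact: measurable_rintegrable norm_ia.
  - by move=> x _; exact: section_le.
by under eq_integral do rewrite mulrC; rewrite integral_rintegrable ?ltry//; exact: rintegrableZ.
Qed.

Lemma rfubini : \int[mu]_x \int[mu]_y k x y = \int[mu]_y \int[mu]_x k x y.
Proof.
have /= fubini_k := Fubini ik; congr fine.
transitivity (\int[mu]_x \int[mu]_y (k x y)%:E)%E.
  by apply: eq_integral => x _; rewrite integral_rintegrable//; exact: rintegrable_section1.
rewrite fubini_k; apply: eq_integral => y _.
by rewrite integral_rintegrable//; exact: rintegrable_section2.
Qed.

End RealFubini.

Lemma measurable_Rintegral (d : measure_display) (T : measurableType d) (k : R -> T -> R) :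
  measurable_fun setT (fun p : R * T => k p.1 p.2) ->
  measurable_fun setT (fun z => \int[mu]_x k x z).
Proof.
move=> mk; pose f (p : R * T) := (k p.1 p.2)%:E.
have mf : measurable_fun setT f by apply/measurable_EFinP.
have mG (g : R * T -> \bar R) : measurable_fun setT g -> (forall p, (0 <= g p)%E) ->
    measurable_fun setT (fun z => (\int[mu]_x g (x, z))%E).
  by move=> mg g0; exact: (measurable_fun_fubini_tonelli_G (m1 := mu) g mg g0).
apply: (@measurableT_comp _ _ _ _ _ _ fine); first exact: fine_measurable.
rewrite (_ : (fun z => _) = fun z => (\int[mu]_x f^\+ (x, z) - \int[mu]_x f^\- (x, z))%E).
  by apply: emeasurable_funB; apply: mG => //;
    [exact: measurable_funepos|exact: measurable_funeneg].
apply/funext => z; rewrite [LHS]integralE.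
by congr (_ - _)%E; apply: eq_integral => x _; rewrite ?funeposE ?funenegE.
Qed.

Lemma cmeas_cint (d : measure_display) (T : measurableType d) (k : R -> T -> R[i]) :
  cmeas (fun p : R * T => k p.1 p.2) -> cmeas (fun z => cint (k^~ z)).
Proof.
move=> [m1 m2]; split; first exact: (@measurable_Rintegral _ _ (fun x z => ReC (k x z))).
exact: (@measurable_Rintegral _ _ (fun x z => ImC (k x z))).
Qed.

Definition cmeas2 (E : R -> R -> R[i]) := cmeas (fun p : R * R => E p.1 p.2).

Section ComplexFubini.
Variables (F : R -> R -> R[i]) (a b : R -> R).
Hypothesis mF : cmeas2 F.
Hypotheses (ia : rintegrable a) (ib : rintegrable b).
Hypothesis Fab : forall x y, cmod (F x y) <= a x * b y.

Let Re_ab x y : `|ReC (F x y)| <= a x * b y.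
Proof. exact: le_trans (ler_norm_Re _) (Fab x y). Qed.

Let Im_ab x y : `|ImC (F x y)| <= a x * b y.
Proof. exact: le_trans (ler_norm_Im _) (Fab x y). Qed.

Lemma cfubini : cint (fun x => cint (F x)) = cint (fun y => cint (F^~ y)).
Proof.
have [m1 m2] := mF; apply: complex_ext => /=;
  [exact: (rfubini m1 ia ib Re_ab)|exact: (rfubini m2 ia ib Im_ab)].
Qed.

End ComplexFubini.

Lemma cmeas2_fst (f : R -> R[i]) : cmeas f -> cmeas2 (fun x _ => f x).
Proof. by move=> mf; exact: (cmeas_comp (h := fst) measurable_fst mf). Qed.

Lemma cmeas2_snd (f : R -> R[i]) : cmeas f -> cmeas2 (fun _ y => f y).
Proof. by move=> mf; exact: (cmeas_comp (h := snd) measurable_snd mf). Qed.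

Lemma cmeas2_swap E : cmeas2 E -> cmeas2 (fun x y => E y x).
Proof.
move=> mE; apply: (cmeas_comp (h := fun p : R * R => (p.2, p.1)) _ mE).
by apply: measurable_fun_pair; [exact: measurable_snd|exact: measurable_fst].
Qed.

Lemma cmeas2_reflect (c : R) E : cmeas2 E -> cmeas2 (fun x y => E (c - x) y).
Proof.
apply: (cmeas_comp (h := fun p : R * R => (c - p.1, p.2))).
by apply: measurable_fun_pair => //; apply: measurable_funB => //; exact: measurable_cst.
Qed.

Lemma cmeas2D E F : cmeas2 E -> cmeas2 F -> cmeas2 (fun x y => E x y + F x y).
Proof. exact: cmeasD. Qed.

Lemma cmeas2M E F : cmeas2 E -> cmeas2 F -> cmeas2 (fun x y => E x y * F x y).
Proof. exact: cmeasM. Qed.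

Lemma cmeas2B E F : cmeas2 E -> cmeas2 F -> cmeas2 (fun x y => E x y - F x y).
Proof. exact: cmeasB. Qed.

Lemma cmeas_section1 E x : cmeas2 E -> cmeas (E x).
Proof.
move=> [m1 m2]; split.
- exact: (measurableT_comp m1 (pair1_measurable x)).
- exact: (measurableT_comp m2 (pair1_measurable x)).
Qed.

Lemma cmeas_section2 E y : cmeas2 E -> cmeas (E^~ y).
Proof.
move=> [m1 m2]; split.
- exact: (measurableT_comp m1 (pair2_measurable y)).
- exact: (measurableT_comp m2 (pair2_measurable y)).
Qed.

Section ParametricIntegral.
Variables (w : R -> R[i]) (E : R -> R -> R[i]) (M : R).
Hypotheses (iw : cintegrable w) (mE : cmeas2 E).
Hypothesis EM : forall x r, w x != 0 -> cmod (E x r) <= M.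

Lemma cmeas_cintM : cmeas (fun r => cint (fun x => w x * E x r)).
Proof.
apply: (@cmeas_cint _ _ (fun x r => w x * E x r)).
exact: (cmeas2M (cmeas2_fst (cmeas_cintegrable iw)) mE).
Qed.

Variable g : R -> R[i].
Hypothesis ig : cintegrable g.

Let F x r := w x * E x r * g r.

Let mF : cmeas2 F.
Proof.
apply: cmeas2M; last exact/cmeas2_snd/cmeas_cintegrable.
by apply: cmeas2M => //; exact/cmeas2_fst/cmeas_cintegrable.
Qed.

Let FM x r : cmod (F x r) <= (M * cmod (w x)) * cmod (g r).
Proof.
rewrite /F !cmodM; have [->|wx] := eqVneq (w x) 0; first by rewrite cmod0 mul0r mulr0 mul0r.
by rewrite ler_wpM2r ?cmod_ge0// mulrC ler_wpM2r ?cmod_ge0// EM.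
Qed.

Let cint_section x : cint (F x) = w x * cint (fun r => E x r * g r).
Proof.
rewrite /F; have [wx|wx] := eqVneq (w x) 0.
  by rewrite wx mul0r; under eq_cint do rewrite !mul0r; rewrite cint0.
under eq_cint do rewrite -mulrA; rewrite cintZ//.
by apply: (cintegrable_boundedM (cmeas_section1 x mE) _ ig) => r; exact: EM.
Qed.

Lemma cfubiniM : cint (fun r => cint (fun x => w x * E x r) * g r) =
  cint (fun x => w x * cint (fun r => E x r * g r)).
Proof.
have := cfubini mF (rintegrableZ M (rintegrable_cmod iw)) (rintegrable_cmod ig) FM.
under eq_cint do rewrite cint_section; move=> ->; apply: eq_cint => r; rewrite -cintZr//.
by apply: (cintegrableM_bounded iw (cmeas_section2 r mE)) => x; exact: EM.
Qed.

End ParametricIntegral.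

End Fubini.

(** * Superpositions of exponentials *)

Section Spectral.
Variable R : realType.
Local Notation mu := (@lebesgue_measure R).
Implicit Types (E F g : R -> R[i]) (a b M : R).

(* A function E of the real variable r has spectrum in [a, +oo[ and total mass at most M.
   The dual formulation makes stability under products and integrals immediate. *)
Definition spectral a M E := [/\ cmeas E, (forall r, cmod (E r) <= M) &
  forall g c, cintegrable g ->
    (forall s, a <= s -> cmod (cint (fun r => cis (s * r) * g r)) <= c) ->
    cmod (cint (fun r => E r * g r)) <= M * c].

Lemma cmeas_spectral a M E : spectral a M E -> cmeas E. Proof. by case. Qed.

Lemma spectral_bound a M E : spectral a M E -> forall r, cmod (E r) <= M. Proof. by case. Qed.

Lemma spectral_ge0 a M E : spectral a M E -> 0 <= M.
Proof. by case=> _ /(_ 0) + _; exact: le_trans (cmod_ge0 _). Qed.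

Lemma eq_spectral a M E F : E =1 F -> spectral a M E -> spectral a M F.
Proof. by move=> /funext ->. Qed.

Lemma spectral_le a M b M' E : b <= a -> M <= M' -> spectral a M E -> spectral b M' E.
Proof.
move=> ba MM' [mE bE sE]; split => // [r|g c ig g_le]; first exact: le_trans (bE r) MM'.
have c0 : 0 <= c by exact: le_trans (cmod_ge0 _) (g_le b (lexx b)).
rewrite (le_trans _ (ler_wpM2r c0 MM'))//; apply: sE => // s as_.
by apply: g_le; exact: le_trans as_.
Qed.

Lemma cmeas_cisM (s : R) : cmeas (fun r : R => cis (s * r)).
Proof. by apply: cmeas_cis; exact: mulrl_measurable. Qed.

Lemma cintegrable_cisM (s : R) g : cintegrable g -> cintegrable (fun r => cis (s * r) * g r).
Proof.
by move=> ig; apply: (cintegrable_boundedM (cmeas_cisM s) _ ig) => x; rewrite cmod_cis.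
Qed.

Lemma spectral_cis a s : a <= s -> spectral a 1 (fun r => cis (s * r)).
Proof.
move=> as_; split => [|r|g c ig g_le]; first exact: cmeas_cisM.
- by rewrite cmod_cis.
- by rewrite mul1r g_le.
Qed.

Lemma spectral0 a : spectral a 0 (fun=> 0).
Proof.
split => [|r|g c ig g_le]; first exact: cmeas_cst; first by rewrite cmod0.
by under eq_cint do rewrite mul0r; rewrite cint0 cmod0 mul0r.
Qed.

Lemma spectralM a b M M' E F : spectral a M E -> spectral b M' F ->
  spectral (a + b) (M * M') (fun r => E r * F r).
Proof.
move=> sE sF; have M0 := spectral_ge0 sE; have M'0 := spectral_ge0 sF.
move: sE sF => [mE bE sE] [mF bF sF]; split => [|r|g c ig g_le]; first exact: cmeasM.
  by rewrite cmodM ler_pM ?cmod_ge0.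
under eq_cint do rewrite -mulrA.
rewrite -mulrA; apply: sE; first exact: (@cintegrable_boundedM _ _ _ M').
move=> s as_; under eq_cint do rewrite mulrCA.
apply: sF; first exact: cintegrable_cisM.
move=> t bt; under eq_cint do rewrite mulrA -cisD -mulrDl.
by apply: g_le; rewrite addrC lerD.
Qed.

Lemma spectralD a M M' E F : spectral a M E -> spectral a M' F ->
  spectral a (M + M') (fun r => E r + F r).
Proof.
move=> [mE bE sE] [mF bF sF]; split => [|r|g c ig g_le]; first exact: cmeasD.
  by rewrite (le_trans (cmodD _ _))// lerD.
under eq_cint do rewrite mulrDl.
rewrite cintD; [|exact: (cintegrable_boundedM mE bE)|exact: (cintegrable_boundedM mF bF)].
apply: le_trans (cmodD _ _) _; rewrite mulrDl.
by apply: lerD; [exact: sE|exact: sF].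
Qed.

Lemma spectralZ a M E (c : R[i]) : spectral a M E -> spectral a (cmod c * M) (fun r => c * E r).
Proof.
move=> [mE bE sE]; split => [|r|g e ig g_le].
- by apply: cmeasM => //; exact: cmeas_cst.
- by rewrite cmodM ler_wpM2l// cmod_ge0.
under eq_cint do rewrite -mulrA.
rewrite cintZ; last exact: (cintegrable_boundedM mE bE).
rewrite cmodM -mulrA; apply: ler_wpM2l; first exact: cmod_ge0.
exact: sE.
Qed.

Lemma spectral_Zcis a s (c : R[i]) : a <= s -> spectral a (cmod c) (fun r => c * cis (s * r)).
Proof. by move=> as_; rewrite -[cmod c]mulr1; exact/spectralZ/spectral_cis. Qed.

Lemma spectral_cst (c : R[i]) : spectral 0 (cmod c) (fun=> c).
Proof.
by apply: eq_spectral (spectral_Zcis c (lexx 0)) => r; rewrite mul0r cis0 mulr1.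
Qed.

Lemma spectralN a M E : spectral a M E -> spectral a M (fun r => - E r).
Proof.
move=> /(spectralZ (-1)); rewrite cmodN cmod1 mul1r.
by apply: eq_spectral => r; rewrite mulN1r.
Qed.

Lemma spectralB a M M' E F : spectral a M E -> spectral a M' F -> spectral a (M + M')
  (fun r => E r - F r).
Proof. by move=> sE sF; apply: spectralD => //; exact: spectralN. Qed.

Lemma spectral_cintM a M (w : R -> R[i]) (E : R -> R -> R[i]) : cintegrable w -> cmeas2 E ->
  (forall x, w x != 0 -> spectral a M (E x)) ->
  spectral a (M * \int[mu]_x cmod (w x)) (fun r => cint (fun x => w x * E x r)).
Proof.
move=> iw mE sE; have EM x r : w x != 0 -> cmod (E x r) <= M.
  by move=> wx; have [_ + _] := sE x wx; exact.
split => [|r|g c ig g_le]; first exact: cmeas_cintM.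
- by apply: (le_cmod_cintM iw (cmeas_section2 r mE)) => x; exact: EM.
rewrite (cfubiniM iw mE EM ig) mulrAC; apply: (le_cmod_cintM iw) => [|x wx].
  by apply: eq_cmeas (cmeas_cintM ig (cmeas2_swap mE)) => x; apply: eq_cint => r; rewrite mulrC.
by have [_ _] := sE x wx; exact.
Qed.

Lemma spectral_sum (I : finType) (P : pred I) a (M : I -> R) (E : I -> R -> R[i]) :
  (forall j, P j -> spectral a (M j) (E j)) ->
  spectral a (\sum_(j | P j) M j) (fun r => \sum_(j | P j) E j r).
Proof.
move=> sE; rewrite -fct_sumE; apply: (big_ind2 (fun E M => spectral a M E)) => //.
- exact: spectral0.
- by move=> F M1 G M2; exact: spectralD.
Qed.

Section NullSequence.
Variable u : nat -> R.
Hypothesis u0 : u n @[n --> \oo] --> (0 : R).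

Let cvg_Mnull K : K * u n @[n --> \oo] --> (0 : R).
Proof. by rewrite -(mulr0 K); apply: cvgM => //; exact: cvg_cst. Qed.

Lemma ler_addM_null x y K : (forall n, x <= y + K * u n) -> x <= y.
Proof.
move=> xy; apply: (ler_cvg_to (cvg_cst x) (_ : y + K * u n @[n --> \oo] --> y)).
  by rewrite -[X in _ --> X]addr0; apply: cvgD; [exact: cvg_cst|exact: cvg_Mnull].
exact: nearW.
Qed.

Lemma cmeas_null_lim d (T : measurableType d) (f : nat -> T -> R[i]) (g : T -> R[i]) :
  (forall n, cmeas (f n)) ->
  (forall x, exists K, forall n, cmod (g x - f n x) <= K * u n) -> cmeas g.
Proof.
move=> mf fg; have lim (p : R[i] -> R) : (forall z w, `|p z - p w| <= cmod (z - w)) ->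
    (forall n, measurable_fun setT (fun x => p (f n x))) -> measurable_fun setT (fun x => p (g x)).
  move=> p_lip mp; apply: (measurable_fun_cvg mp) => x _; have [K fgK] := fg x.
  apply/cvgrPdist_le => e e0; have /cvgrPdist_le/(_ _ e0) := cvg_Mnull K.
  apply: filterS => n; rewrite sub0r normrN => Ke.
  exact: le_trans (p_lip _ _) (le_trans (fgK n) (le_trans (ler_norm _) Ke)).
split; apply: lim => [z w|n]; try by have [] := mf n.
- by rewrite -ReCN -ReCD; exact: ler_norm_Re.
- by rewrite -ImCN -ImCD; exact: ler_norm_Im.
Qed.

Lemma spectral_null_lim a M K (f : nat -> R -> R[i]) (g : R -> R[i]) :
  (forall n, spectral a M (f n)) -> (forall r n, cmod (g r - f n r) <= K * u n) ->
  spectral a M g.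
Proof.
move=> sf fg; have mg : cmeas g.
  by apply: (cmeas_null_lim (fun n => cmeas_spectral (sf n))) => r; exists K => n; exact: fg.
split => // [r|w c iw wc].
  apply: (@ler_addM_null _ _ K) => n; rewrite -[g r](subrKC (f n r)).
  by apply: le_trans (cmodD _ _) _; apply: lerD; [exact: spectral_bound (sf n) r|exact: fg].
apply: (@ler_addM_null _ _ (K * \int[mu]_x cmod (w x))) => n.
have ifw := cintegrable_boundedM (cmeas_spectral (sf n)) (spectral_bound (sf n)) iw.
have mgf : cmeas (fun r => g r - f n r) by apply: cmeasB => //; exact: cmeas_spectral (sf n).
have igw := cintegrable_boundedM mgf (fun r => fg r n) iw.
have -> : cint (fun r => g r * w r) =
    cint (fun r => f n r * w r) + cint (fun r => (g r - f n r) * w r).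
  by rewrite -cintD//; apply: eq_cint => r; rewrite -mulrDl subrKC.
apply: le_trans (cmodD _ _) _; apply: lerD; first by have [_ _] := sf n; exact.
under eq_cint do rewrite mulrC; rewrite mulrAC.
by apply: (le_cmod_cintM iw mgf) => r _; exact: fg.
Qed.

End NullSequence.
End Spectral.

(** * Absolutely continuous functions *)

Section ZeroAlmostEverywhere.
Variable R : realType.
Local Notation mu := (@lebesgue_measure R).
Implicit Types (F : R -> R[i]) (a b : R).

Lemma lebesgue_measure_disjoint_itvs n (s t : 'I_n -> R) : (forall i, s i <= t i) ->
  trivIset [set: 'I_n] (fun i => [set` `]s i, t i[]) ->
  mu (\big[setU/set0]_(i < n) [set` `]s i, t i[]) = (\sum_(i < n) (t i - s i))%:E.
Proof.
move=> st ts; transitivity (\sum_(i < n) mu [set` `]s i, t i[])%E.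
  by apply: measure_semi_additive_ord => //; exact: bigsetU_measurable.
rewrite -sumEFin; apply: eq_bigr => i _; rewrite lebesgue_measure_itv/= lte_fin.
case: ltP => // tsi.
by rewrite (_ : t i = s i) ?subrr//; apply/eqP; rewrite eq_le st tsi.
Qed.

Lemma ae_open_cover (P : R -> Prop) d : {ae mu, forall x, P x} -> 0 < d ->
  exists U : set R, [/\ open U, (mu U < d%:E)%E & forall x, ~ U x -> P x].
Proof.
move=> [N [mN N0 NP]] d0.
have finN : (mu N < +oo)%E by rewrite N0.
have [U [oU NU mU]] := lebesgue_regularity_outer mN finN d0.
have measU : measurable U by exact: open_measurable.
exists U; split => // [|x Ux]; last by apply: contrapT => /NP/NU.
suff -> : mu U = mu (U `\` N) by [].
rewrite -[in LHS](setDUK NU) setUC measureU0//; exact: measurableD.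
Qed.

Lemma ae_neq (a : R) : {ae mu, forall x, x != a}.
Proof.
exists [set a]; split => // [|x /= /negP]; first exact: lebesgue_measure_set1.
by rewrite negbK => /eqP.
Qed.

Lemma is_derive0_lip (f : R -> R) (x : R) : is_derive x (1 : R) f 0 ->
  forall e, 0 < e -> exists2 d, 0 < d & forall y, `|y - x| < d -> `|f y - f x| <= e * `|y - x|.
Proof.
move=> [df f0] e e0.
have : h^-1 *: (f (h *: 1 + x) - f x) @[h --> 0^'] --> 'D_1 f x by exact: df.
rewrite f0 => /cvgr0Pnorm_le/(_ _ e0)[d /= d0 hd].
exists d => // y yd; have [->|yx] := eqVneq y x; first by rewrite !subrr normr0 mulr0.
have yx0 : y - x != 0 by rewrite subr_eq0.
have := hd (y - x) => /=; rewrite sub0r normrN => /(_ yd yx0).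
rewrite /GRing.scale/= mulr1 subrK normrM normfV ler_pdivrMl ?normr_gt0//.
by rewrite mulrC.
Qed.

Lemma has_cderive0_lip F (x : R) : has_cderive F x 0 ->
  forall e, 0 < e -> exists2 d, 0 < d &
    forall y, `|y - x| < d -> cmod (F y - F x) <= e * `|y - x|.
Proof.
move=> [/is_derive0_lip Re_lip /is_derive0_lip Im_lip] e e0; have e2_gt0 : 0 < e / 2 by lra.
have [d1 d1_gt0 Re_le] := Re_lip _ e2_gt0; have [d2 d2_gt0 Im_le] := Im_lip _ e2_gt0.
exists (Num.min d1 d2); first by rewrite lt_min d1_gt0.
move=> y; rewrite lt_min => /andP[y_d1 y_d2]; apply: le_trans (ler_cmod_ReIm _) _.
rewrite ReCD ImCD ReCN ImCN; apply: le_trans (lerD (Re_le _ y_d1) (Im_le _ y_d2)) _.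
by rewrite -mulrDl -splitr.
Qed.

Section ZeroDerivative.
Variables (a b : R) (F : R -> R[i]).
Hypotheses (ab : a < b) (acF : absolutely_continuous a b F).
Hypothesis dF : {ae mu, forall x, a < x < b -> has_cderive F x 0}.

Section Chain.
Variables (e : R) (U : set R).

(* The increment of F up to x is controlled by slope e plus the increments over
   finitely many disjoint intervals inside U. *)
Definition chained x := exists n (s t : 'I_n -> R), [/\
  (forall i, [/\ a <= s i, s i <= t i & t i <= x]),
  trivIset [set: 'I_n] (fun i => [set` `]s i, t i[]),
  (forall i, [set` `]s i, t i[] `<=` U) &
  cmod (F x - F a) <= e * (x - a) + \sum_(i < n) cmod (F (t i) - F (s i))].

Lemma chained_start : chained a.
Proof.
by exists 0%N, (fun=> 0), (fun=> 0); split=> [[]//|[]//|[]//|];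
  rewrite big_ord0 !subrr cmod0 mulr0 addr0.
Qed.

Lemma chained_slope u z v : u <= z -> z <= v -> cmod (F u - F z) <= e * `|u - z| ->
  cmod (F v - F z) <= e * `|v - z| -> chained u -> chained v.
Proof.
move=> uz zv slope_u slope_v [n [s [t [st ts tU F_le]]]]; exists n, s, t; split => // [i|].
  by have [? ? tu] := st i; split => //; exact: le_trans tu (le_trans uz zv).
have -> : F v - F a = (F v - F z) - (F u - F z) + (F u - F a) by ring.
apply: le_trans (cmodD _ _) _; apply: le_trans (lerD (cmodB _ _) F_le) _.
rewrite addrA lerD2r; apply: le_trans (lerD (lerD slope_v slope_u) (lexx _)) _.
by rewrite (ger0_norm (_ : 0 <= v - z)) ?subr_ge0// ler0_norm ?subr_le0//; lra.
Qed.

Lemma chained_cover u v : 0 <= e -> a <= u -> u <= v -> [set` `]u, v[] `<=` U -> chained u ->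
  chained v.
Proof.
move=> e0 au uv uvU [n [s [t [st ts tU hF]]]].
pose s' (i : 'I_n.+1) := if unlift ord_max i is Some j then s j else u.
pose t' (i : 'I_n.+1) := if unlift ord_max i is Some j then t j else v.
exists n.+1, s', t'; split => [i||i|].
- rewrite /s' /t'; case: unliftP => [j _|_] //.
  by have [? ? tu] := st j; split => //; exact: le_trans uv.
- have disj j y : [set` `]s j, t j[] y -> [set` `]u, v[] y -> False.
    rewrite /= !in_itv/= => /andP[_ yt] /andP[uy _].
    by have [_ _ tu] := st j; have := lt_trans uy yt; rewrite ltNge tu.
  move=> i j _ _ [y]; rewrite /s' /t'.
  case: unliftP => [i' ->|->]; case: unliftP => [j' ->|->] [yi yj] //.
  + by rewrite (ts i' j' I I)//; exists y.
  + by case: (disj _ _ yi yj).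
  + by case: (disj _ _ yj yi).
- by rewrite /s' /t'; case: unliftP => [j _|_] //; exact: tU.
- rewrite big_ord_recr/=; have -> : s' ord_max = u by rewrite /s' unlift_none.
  have -> : t' ord_max = v by rewrite /t' unlift_none.
  under eq_bigr => i _.
    rewrite /s' /t' (_ : widen_ord _ i = lift ord_max i); last first.
      by apply/val_inj; rewrite /= /bump leqNgt ltn_ord.
    rewrite liftK; over.
  have -> : F v - F a = (F u - F a) + (F v - F u) by ring.
  apply: le_trans (cmodD _ _) _; rewrite [leRHS]addrA lerD2r.
  by rewrite (le_trans hF)// lerD2r ler_wpM2l// lerD2r.
Qed.

Hypothesis oU : open U.
Hypothesis e0 : 0 < e.
Hypothesis aU : U a.
Hypothesis bU : U b.
Hypothesis goodU : forall x, a < x < b -> ~ U x -> has_cderive F x 0.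

Lemma chained_local z : a <= z <= b -> exists2 d, 0 < d &
  forall u v, a <= u -> u <= z -> z <= v -> v <= b -> z - d < u -> v < z + d ->
    chained u -> chained v.
Proof.
move=> /andP[az zb]; have [Uz|Uz] := pselect (U z).
  have /nbhs_ballP[d /= d0 dU] : nbhs z U by exact: open_nbhs_nbhs.
  exists d => // u v au uz zv vb zu vz; apply: chained_cover => //; first exact: ltW.
    exact: le_trans zv.
  move=> y /=; rewrite in_itv/= => /andP[uy yv]; apply: dU.
  by rewrite /ball/= ltr_norml; apply/andP; split; lra.
have za : z != a by apply/eqP => zE; apply: Uz; rewrite zE.
have zb' : z != b by apply/eqP => zE; apply: Uz; rewrite zE.
have zab : a < z < b by rewrite !lt_def az zb za eq_sym zb'.
have [d d0 hd] := has_cderive0_lip (goodU zab Uz) e0.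
exists d => // u v au uz zv vb zu vz; apply: (chained_slope uz zv); apply: hd.
- by rewrite ltr_norml; apply/andP; split; lra.
- by rewrite ltr_norml; apply/andP; split; lra.
Qed.

Lemma chained_end : chained b.
Proof.
pose S := [set x | a <= x <= b /\ chained x].
have Sa : S a by split; [rewrite lexx ltW|exact: chained_start].
have Sb x : S x -> x <= b by move=> [/andP[]].
have supS : has_sup S by split; [exists a|exists b].
pose c := sup S.
have ac : a <= c by apply: sup_upper_bound.
have cb : c <= b by apply: ge_sup; [exists a|].
have [d d0 hd] := chained_local (z := c) ltac:(by rewrite ac cb).
have [u [/andP[au ub] Qu] cu] := sup_adherent d0 supS.
have uc : u <= c by apply: sup_upper_bound => //; split => //; rewrite au ub.
have step v : c <= v -> v <= b -> v < c + d -> chained v.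
  by move=> cv vb vd; exact: (hd u v).
have [cbE|cb'] := eqVneq c b; first by apply: step => //; lra.
have {}cb' : c < b by rewrite lt_neqAle cb' cb.
pose v := Num.min b (c + d / 2).
have cv : c < v by rewrite lt_min cb'/= ltrDl; lra.
have vb : v <= b by rewrite ge_min lexx.
have vd : v < c + d by rewrite gt_min; apply/orP; right; lra.
have : v <= c.
  apply: sup_upper_bound => //; split; first by rewrite vb andbT (le_trans ac)// ltW.
  by apply: step => //; exact: ltW.
by rewrite leNgt cv.
Qed.

End Chain.

Lemma ac_ae_derive0 : F b = F a.
Proof.
suff increment_le e : 0 < e -> cmod (F b - F a) <= e * (b - a + 1).
  have : cmod (F b - F a) <= 0.
    apply/ler_addgt0Pl => e e0; rewrite addr0.
    have ba1 : 0 < b - a + 1 by rewrite ltr_wpDl// subr_ge0 ltW.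
    have := increment_le (e / (b - a + 1)); rewrite divfK ?gt_eqF//; apply.
    by rewrite divr_gt0.
  move=> increment0; apply/eqP; rewrite -subr_eq0; apply/eqP; apply: cmod_eq0.
  by apply/eqP; rewrite eq_le increment0 cmod_ge0.
move=> e0; have [d d0 small] := acF e0.
have ab_good : {ae mu, forall x, (x != a /\ x != b) /\ (a < x < b -> has_cderive F x 0)}.
  have ae_ab := @filterS2 _ _ (ae_filter_ringOfSetsType mu) _ _ _
    (fun x => @conj (x != a) (x != b)) (ae_neq a) (ae_neq b).
  exact: (@filterS2 _ _ (ae_filter_ringOfSetsType mu) _ _ _ (fun x => @conj _ _) ae_ab dF).
have [U [oU mU goodU]] := ae_open_cover ab_good d0.
have inU x : x \in [:: a; b] -> U x.
  rewrite !inE => xab; apply: contrapT => /goodU[[/negbTE xa /negbTE xb] _].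
  by rewrite xa xb in xab.
have good x : a < x < b -> ~ U x -> has_cderive F x 0 by move=> xab /goodU[_]; exact.
have [||n [s [t [st ts tU F_le]]]] := chained_end oU e0 _ _ good.
- by apply: inU; rewrite inE eqxx.
- by apply: inU; rewrite !inE eqxx orbT.
apply: le_trans F_le _; rewrite [leRHS]mulrDr mulr1 lerD2l; apply/ltW/small => //.
rewrite -lte_fin -lebesgue_measure_disjoint_itvs//; last by move=> i; have [] := st i.
apply: le_lt_trans mU; apply: le_measure; rewrite ?inE//.
- exact: bigsetU_measurable.
- exact: open_measurable.
- by rewrite -bigcup_seq => x [i _ /tU].
Qed.

End ZeroDerivative.
End ZeroAlmostEverywhere.

Section ComplexDerivative.
Variable R : realType.
Implicit Types (F G : R -> R[i]) (x : R) (u v : R[i]).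

Lemma eq_is_derive (f g : R -> R) (x d d' : R) : f =1 g -> d = d' ->
  is_derive x (1 : R) f d -> is_derive x (1 : R) g d'.
Proof. by move=> /funext -> ->. Qed.

Lemma has_cderiveD F G x u v : has_cderive F x u -> has_cderive G x v ->
  has_cderive (fun t => F t + G t) x (u + v).
Proof.
move=> [f1 f2] [g1 g2]; split.
- by apply: eq_is_derive (is_deriveD f1 g1) => [t|]; rewrite ReCD.
- by apply: eq_is_derive (is_deriveD f2 g2) => [t|]; rewrite ImCD.
Qed.

Lemma has_cderiveM F G x u v : has_cderive F x u -> has_cderive G x v ->
  has_cderive (fun t => F t * G t) x (F x * v + u * G x).
Proof.
move=> [f1 f2] [g1 g2]; split.
- apply: eq_is_derive (is_deriveB (is_deriveM f1 g1) (is_deriveM f2 g2)) => [t|].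
    by rewrite ReCM.
  by rewrite ReCD !ReCM /GRing.scale/=; ring.
- apply: eq_is_derive (is_deriveD (is_deriveM f1 g2) (is_deriveM f2 g1)) => [t|].
    by rewrite ImCM.
  by rewrite ImCD !ImCM /GRing.scale/=; ring.
Qed.

Lemma has_cderive_cst (c : R[i]) x : has_cderive (fun=> c) x 0.
Proof. by split; exact: is_derive_cst. Qed.

Lemma has_cderive_real (h : R -> R) x d : is_derive x (1 : R) h d ->
  has_cderive (fun t => real_complex R (h t)) x (real_complex R d).
Proof. by move=> dh; split => //=; exact: is_derive_cst. Qed.

Lemma has_cderiveZ c F x u : has_cderive F x u -> has_cderive (fun t => c * F t) x (c * u).
Proof.
move=> dF; have := has_cderiveM (has_cderive_cst c x) dF.
by rewrite mul0r addr0.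
Qed.

Lemma has_cderiveB F G x u v : has_cderive F x u -> has_cderive G x v ->
  has_cderive (fun t => F t - G t) x (u - v).
Proof.
move=> dF dG; have := has_cderiveD dF (has_cderiveZ (-1) dG).
by rewrite mulN1r; under eq_fun do rewrite mulN1r.
Qed.

End ComplexDerivative.

Section AbsolutelyContinuousCalculus.
Variable R : realType.
Local Notation mu := (@lebesgue_measure R).
Implicit Types (F G : R -> R[i]) (a b : R).
Local Notation AC := absolutely_continuous.

Lemma ac_subitv a b a' b' F : a <= a' -> b' <= b -> AC a b F -> AC a' b' F.
Proof.
move=> le_aa le_bb acF e e0; have [d d0 F_small] := acF e e0; exists d => // n s t st.
apply: F_small => i; have [? ? ?] := st i; split => //;
  [exact: le_trans le_aa _|exact: le_trans le_bb].
Qed.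

Lemma acD a b F G : AC a b F -> AC a b G -> AC a b (fun x => F x + G x).
Proof.
move=> acF acG e e0; have e2_gt0 : 0 < e / 2 by lra.
have [d1 d1_gt0 F_small] := acF _ e2_gt0; have [d2 d2_gt0 G_small] := acG _ e2_gt0.
exists (Num.min d1 d2); first by rewrite lt_min d1_gt0.
move=> n s t st ts; rewrite lt_min => /andP[sum_d1 sum_d2].
rewrite [ltRHS]splitr.
apply: le_lt_trans (ltrD (F_small n s t st ts sum_d1) (G_small n s t st ts sum_d2)).
rewrite -big_split/=; apply: ler_sum => i _.
by rewrite (_ : _ - _ = (F (t i) - F (s i)) + (G (t i) - G (s i))) ?cmodD//; ring.
Qed.

Lemma ac_uniform a b F : AC a b F -> forall e, 0 < e -> exists2 d, 0 < d &
  forall x y, a <= x -> x <= y -> y <= b -> y - x < d -> cmod (F y - F x) < e.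
Proof.
move=> acF e e0; have [d d0 F_small] := acF e e0; exists d => // x y ax xy yb yx.
have := F_small 1%N (fun=> x) (fun=> y); rewrite !big_ord1; apply => //.
by move=> i j _ _ _; rewrite !ord1.
Qed.

Lemma ac_bounded a b F : AC a b F ->
  exists2 B, 0 <= B & forall x, a <= x -> x <= b -> cmod (F x) <= B.
Proof.
move=> /ac_uniform/(_ 1 ltr01)[d d0 F_close].
have step n x : a <= x -> x <= b -> x <= a + n%:R * (d / 2) -> cmod (F x - F a) <= n%:R.
  elim: n x => [x ax xb|n IH x ax xb].
    rewrite mul0r addr0 => xa; have -> : x = a by apply/eqP; rewrite eq_le xa ax.
    by rewrite subrr cmod0.
  move=> x_le; have [x_le_z|x_le_z] := leP x (a + n%:R * (d / 2)).
    by rewrite (le_trans (IH x ax xb x_le_z))// ler_nat.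
  have a_le_z : a <= a + n%:R * (d / 2) by rewrite lerDl mulr_ge0//; lra.
  set z := a + n%:R * (d / 2) in x_le_z a_le_z.
  have -> : F x - F a = (F x - F z) + (F z - F a) by ring.
  rewrite (le_trans (cmodD _ _))// -natr1 [leRHS]addrC lerD//.
    apply/ltW/F_close => //; first exact: ltW.
    by rewrite -natr1 mulrDl mul1r in x_le; rewrite /z; lra.
  by apply: IH => //; rewrite (le_trans (ltW x_le_z)).
pose n := (Num.bound ((b - a) / (d / 2))).
exists (n%:R + cmod (F a)); first by rewrite addr_ge0 ?cmod_ge0.
move=> x ax xb; have -> : F x = (F x - F a) + F a by ring.
rewrite (le_trans (cmodD _ _))// lerD2r; apply: step => //.
have ba0 : 0 <= (b - a) / (d / 2) by rewrite divr_ge0//; lra.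
have := archi_boundP ba0; rewrite -/n ltr_pdivrMr; last by lra.
by move=> h; lra.
Qed.

Lemma acM a b F G : AC a b F -> AC a b G -> AC a b (fun x => F x * G x).
Proof.
move=> acF acG e e0.
have [B B0 F_le] := ac_bounded acF; have [B' B'0 G_le] := ac_bounded acG.
pose M := B + B' + 1; have M0 : 0 < M by rewrite /M; lra.
have e2_gt0 : 0 < e / 2 / M by rewrite !divr_gt0.
have [d1 d1_gt0 F_small] := acF _ e2_gt0; have [d2 d2_gt0 G_small] := acG _ e2_gt0.
exists (Num.min d1 d2); first by rewrite lt_min d1_gt0.
move=> n s t st ts; rewrite lt_min => /andP[sum_d1 sum_d2].
have := ltrD (F_small n s t st ts sum_d1) (G_small n s t st ts sum_d2).
rewrite -mulrDl -splitr ltr_pdivlMr//; apply: le_lt_trans.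
rewrite -big_split/= mulr_suml; apply: ler_sum => i _.
have [asi sti tib] := st i.
have -> : F (t i) * G (t i) - F (s i) * G (s i) =
  (F (t i) - F (s i)) * G (t i) + F (s i) * (G (t i) - G (s i)) by ring.
rewrite (le_trans (cmodD _ _))// !cmodM mulrDl lerD//.
  by rewrite ler_wpM2l ?cmod_ge0// (le_trans (G_le _ (le_trans asi sti) tib))// /M; lra.
by rewrite mulrC ler_wpM2l ?cmod_ge0// (le_trans (F_le _ asi (le_trans sti tib)))// /M; lra.
Qed.

Lemma ac_lip a b F K : (forall x y, a <= x -> x <= y -> y <= b ->
    cmod (F y - F x) <= K * (y - x)) ->
  AC a b F.
Proof.
move=> F_lip e e0; pose K' := `|K| + 1; have K0 : 0 < K' by rewrite /K' ltr_wpDl.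
exists (e / K'); first by rewrite divr_gt0.
move=> n s t st _; rewrite ltr_pdivlMr// mulr_suml; apply: le_lt_trans.
apply: ler_sum => i _; have [asi sti tib] := st i.
apply: le_trans (F_lip _ _ asi sti tib) _; rewrite mulrC ler_wpM2l ?subr_ge0//.
by rewrite /K' (le_trans (ler_norm _))// lerDl.
Qed.

Lemma ac_cst a b (c : R[i]) : AC a b (fun=> c).
Proof. by apply: (@ac_lip _ _ _ 0) => x y _ _ _; rewrite subrr cmod0 mul0r. Qed.

Lemma acB a b F G : AC a b F -> AC a b G -> AC a b (fun x => F x - G x).
Proof.
move=> acF acG; have := acD acF (acM (ac_cst a b (-1)) acG).
by under eq_fun do rewrite mulN1r.
Qed.

Lemma Rintegral_itvNyB (h : R -> R) a b : rintegrable h -> a <= b ->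
  \int[mu]_(x in `]-oo, b]) h x - \int[mu]_(x in `]-oo, a]) h x = \int[mu]_(x in `]a, b[) h x.
Proof.
move=> ih ab; rewrite Rintegral_itvB ?bnd_simp//; last exact: (integrableS measurableT).
by rewrite -Rintegral_itv_bndo_bndc//; exact: (integrableS measurableT).
Qed.

Lemma ac_indefinite_real (h : R -> R) : rintegrable h ->
  forall e, 0 < e -> exists2 d, 0 < d & forall (n : nat) (s t : 'I_n -> R),
    (forall i, s i <= t i) ->
    trivIset [set: 'I_n] (fun i => [set` `]s i, t i[]) ->
    \sum_(i < n) (t i - s i) < d ->
    \sum_(i < n) `|\int[mu]_(x in `]-oo, t i]) h x - \int[mu]_(x in `]-oo, s i]) h x| < e.
Proof.
move=> ih e e0; have [d [d0 h_small]] := integral_normr_continuous ih e0.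
exists d => // n s t st ts sd.
pose U := \big[setU/set0]_(i < n) [set` `]s i, t i[].
have mU : measurable U by apply: bigsetU_measurable.
have muU : (mu U < d%:E)%E by rewrite lebesgue_measure_disjoint_itvs.
apply: le_lt_trans (h_small U mU muU).
have inh := rintegrable_norm ih.
have -> : \int[mu]_(x in U) `|h x| = \sum_(i < n) \int[mu]_(x in `]s i, t i[) `|h x|.
  transitivity (fine (\sum_(i < n) \int[mu]_(x in `]s i, t i[) (`|h x|)%:E)%E).
    congr fine; have := @integral_bigsetU_EFin _ _ R mu _ (fun i : 'I_n => [set` `]s i, t i[])
      (fun x => `|h x|)
      (index_enum 'I_n); apply => //.
    - exact: index_enum_uniq.
    - exact: sub_trivIset ts.
    - by apply: (measurable_funS measurableT) => //; exact: (measurable_int mu).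
  rewrite -sum_fine// => i _; apply: integrable_fin_num => //.
  exact: (integrableS measurableT).
apply: ler_sum => i _; rewrite Rintegral_itvNyB//.
by apply: le_normr_Rintegral => //; exact: (integrableS measurableT).
Qed.

Lemma ac_indefinite a b (f : R -> R[i]) : cintegrable f ->
  AC a b (fun x => cintegral `]-oo, x] f).
Proof.
move=> [iRe iIm] e e0; have e2_gt0 : 0 < e / 2 by lra.
have [d1 d1_gt0 Re_small] := ac_indefinite_real iRe e2_gt0;
  have [d2 d2_gt0 Im_small] := ac_indefinite_real iIm e2_gt0.
exists (Num.min d1 d2); first by rewrite lt_min d1_gt0.
move=> n s t st ts; rewrite lt_min => /andP[sum_d1 sum_d2].
have st' i : s i <= t i by have [] := st i.
rewrite [ltRHS]splitr.
apply: le_lt_trans (ltrD (Re_small n s t st' ts sum_d1) (Im_small n s t st' ts sum_d2)).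
rewrite -big_split; apply: ler_sum => i _.
exact: ler_cmod_ReIm.
Qed.

Lemma is_derive_indefinite (h : R -> R) : rintegrable h ->
  {ae mu, forall x, is_derive x (1 : R) (fun x => \int[mu]_(t in `]-oo, x]) h t) (h x)}.
Proof.
move=> ih; have := @FTC1Ny R h _ _; case=> [y||N [mN N0 NP]].
- exact: (integrableS measurableT).
- by apply: open_integrable_locally => //; exact: openT.
exists N; split => // x /= nd; apply: NP => /= -[dx fx]; apply: nd.
by rewrite -fx derive1E; exact: derivableP.
Qed.

Lemma has_cderive_indefinite (f : R -> R[i]) : cintegrable f ->
  {ae mu, forall x, has_cderive (fun x => cintegral `]-oo, x] f) x (f x)}.
Proof.
move=> [/is_derive_indefinite Re_deriv /is_derive_indefinite Im_deriv].
apply: (@filterS2 _ _ (ae_filter_ringOfSetsType mu) _ _ _ _ Re_deriv Im_deriv) => x d1 d2.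
by split.
Qed.

Theorem ac_ftc a b F (f : R -> R[i]) : a < b -> AC a b F -> cintegrable f ->
  {ae mu, forall x, a < x < b -> has_cderive F x (f x)} ->
  F b - F a = cintegral `]a, b[ f.
Proof.
move=> ab acF cf dF; pose P x := cintegral `]-oo, x] f.
have acG : AC a b (fun x => F x - P x) by apply: acB => //; exact: ac_indefinite.
have dG : {ae mu, forall x, a < x < b -> has_cderive (fun x => F x - P x) x 0}.
  have dP := has_cderive_indefinite cf.
  apply: (@filterS2 _ _ (ae_filter_ringOfSetsType mu) _ _ _ _ dF dP) => x d1 d2 xab.
  by rewrite -(subrr (f x)); apply: has_cderiveB => //; exact: d1.
have := ac_ae_derive0 ab acG dG => diff_eq.
have -> : F b - F a = P b - P a.
  by apply/eqP; rewrite -subr_eq0; move/eqP: diff_eq; rewrite -subr_eq0; apply: etrans;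
    congr (_ == _); ring.
have [iRe iIm] := cf; have le_ab := ltW ab.
by apply: complex_ext; rewrite ?ReCD ?ImCD ?ReCN ?ImCN /= Rintegral_itvNyB.
Qed.

End AbsolutelyContinuousCalculus.

(** * Poisson kernels *)

Section CalculusOnTheLine.
Variable R : realType.
Local Notation mu := (@lebesgue_measure R).
Implicit Types (f g F : R -> R) (a b l : R).

Lemma is_derive_continuous F x (d : R) : is_derive x (1 : R) F d -> {for x, continuous F}.
Proof.
by move=> [dF _]; apply: differentiable_continuous; exact/derivable1_diffP.
Qed.

Lemma is_derive_mull a x : is_derive x (1 : R) (fun t => a * t) a.
Proof.
apply: eq_is_derive (is_deriveZ a (is_derive_id x (1 : R))) => //.
by rewrite /GRing.scale/= mulr1.
Qed.

Lemma is_derive_comp_mull f a x (d : R) : is_derive (a * x) (1 : R) f d ->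
  is_derive x (1 : R) (fun t => f (a * t)) (a * d).
Proof.
by move=> df; apply: eq_is_derive (is_derive1_comp df (is_derive_mull a x)) => //; rewrite mulrC.
Qed.

Lemma is_derive_sin_mull a x : is_derive x (1 : R) (fun t => sin (a * t)) (a * cos (a * x)).
Proof. exact: is_derive_comp_mull. Qed.

Lemma is_derive_cos_mull a x : is_derive x (1 : R) (fun t => cos (a * t)) (- a * sin (a * x)).
Proof.
by apply: eq_is_derive (is_derive_comp_mull (is_derive_cos _)) => //; rewrite mulrN mulNr.
Qed.

Lemma continuous_cos_mull a : continuous (fun x => cos (a * x)).
Proof. by move=> x; exact: is_derive_continuous (is_derive_cos_mull a x). Qed.

Lemma continuous_sin_mull a : continuous (fun x => sin (a * x)).
Proof. by move=> x; exact: is_derive_continuous (is_derive_sin_mull a x). Qed.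

Lemma Rintegral_ftc f F a b : a <= b -> (forall x, is_derive x (1 : R) F (f x)) ->
  continuous f -> \int[mu]_(x in `]a, b[) f x = F b - F a.
Proof.
rewrite le_eqVlt => /predU1P[<- _ _|ab dF cf].
  by rewrite set_itv_ge ?Rintegral_set0 ?subrr// bnd_simp ltxx.
have cF x : {for x, continuous F} by exact: is_derive_continuous (dF x).
have iab : mu.-integrable `[a, b] (EFin \o f).
  have cf' : {within `[a, b], continuous f} by exact: continuous_subspaceT.
  by apply: continuous_compact_integrable => //; exact: segment_compact.
rewrite Rintegral_itv_bndo_bndc; last by apply: integrableS iab => //; apply: subset_itv;
  rewrite bnd_simp.
rewrite Rintegral_itv_obnd_cbnd; last by apply: integrableS iab => //; apply: subset_itv;
  rewrite bnd_simp.
rewrite /Rintegral (@continuous_FTC2 _ f F a b) //.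
- exact: continuous_subspaceT.
- split.
  + by move=> x _; have [] := dF x.
  + exact/cvg_at_right_filter/cF.
  + exact/cvg_at_left_filter/cF.
- by move=> x _; rewrite derive1E; have [_ ->] := dF x.
Qed.

Lemma ge0_integralT_fold f : (forall x, 0 <= f x) -> continuous f ->
  (\int[mu]_x (f x)%:E = \int[mu]_(x in `[0%R, +oo[) (f x + f (- x))%:E)%E.
Proof.
move=> f0 cf; have mf : measurable_fun setT f by exact: continuous_measurable_fun.
have cfN : continuous (fun x => f (- x)).
  by move=> x; apply: continuous_comp; [exact: opp_continuous|exact: cf].
rewrite -(setUv `[0, +oo[%classic) ge0_integral_setU//=; last 4 first.
- exact: measurableC.
- by apply/measurable_EFinP; rewrite setUv.
- by move=> x _; rewrite lee_fin.
- exact/disj_setPCl.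
rewrite setCitvr integral_itv_bndo_bndc; last exact/measurable_EFinP/measurable_funTS.
rewrite -{2}oppr0 ge0_integration_by_substitutionNy//; last exact: continuous_subspaceT.
under [RHS]eq_integral do rewrite EFinD.
rewrite ge0_integralD//.
- by move=> x _; rewrite lee_fin.
- exact/measurable_EFinP/measurable_funTS.
- by move=> x _; rewrite lee_fin.
- by apply/measurable_EFinP; apply: measurable_funTS; exact: continuous_measurable_fun.
Qed.

Lemma ge0_integralT_ftc f g F l : (forall x, 0 <= f x) -> continuous f ->
  (forall x, 0 <= x -> f x + f (- x) = g x) -> continuous g ->
  (forall x, is_derive x (1 : R) F (g x)) -> F x @[x --> +oo] --> l ->
  (\int[mu]_x (f x)%:E = (l - F 0)%:E)%E.
Proof.
move=> f0 cf fg cg dF Fl; rewrite ge0_integralT_fold//.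
under eq_integral => x.
  rewrite inE/= in_itv/= andbT => /fg ->; over.
rewrite (@ge0_continuous_FTC2y _ g F 0 l)//.
- by move=> x x0; rewrite -fg// addr_ge0.
- exact: continuous_subspaceT.
- exact/cvg_at_right_filter/(is_derive_continuous (dF 0)).
- by move=> x _; rewrite derive1E; have [_ ->] := dF x.
Qed.

End CalculusOnTheLine.

Section PoissonKernel.
Variable R : realType.
Local Notation mu := (@lebesgue_measure R).

Definition poisson (h s : R) : R := 2 * h / (h ^+ 2 + s ^+ 2).

Variable h : R.
Hypothesis h0 : 0 < h.

Let den_gt0 s : 0 < h ^+ 2 + s ^+ 2.
Proof. by rewrite ltr_pwDl ?sqr_ge0// exprn_gt0. Qed.

Lemma poisson_ge0 s : 0 <= poisson h s.
Proof. by rewrite /poisson divr_ge0 ?(ltW (den_gt0 s))// mulr_ge0// ltW. Qed.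

Lemma poisson_le s : poisson h s <= 2 / h.
Proof.
rewrite /poisson ler_pdivrMr// mulrAC ler_pdivlMr// -mulrA ler_wpM2l//.
by rewrite -expr2 lerDl sqr_ge0.
Qed.

Lemma poisson_far d s : 0 < d -> d <= `|s| -> poisson h s <= 2 * h / d ^+ 2.
Proof.
move=> d0 ds; rewrite /poisson ler_wpM2l ?mulr_ge0 ?(ltW h0)//.
rewrite lef_pV2 ?posrE ?exprn_gt0// ler_wpDl ?sqr_ge0//.
by rewrite -(real_normK (num_real s)) ler_sqr ?nnegrE// ltW.
Qed.

Lemma poisson_far_le1 d s : 0 < d -> d <= `|s| ->
  poisson h s <= h * (1 + (d ^+ 2)^-1) * poisson 1 s.
Proof.
move=> d0 ds; have d2 : 0 < d ^+ 2 by rewrite exprn_gt0.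
have s2 : d ^+ 2 <= s ^+ 2.
  by rewrite -(real_normK (num_real s)) ler_sqr ?nnegrE// ltW.
have {}s0 : 0 < s ^+ 2 by exact: lt_le_trans s2.
have den1 : 0 < 1 + s ^+ 2 by rewrite ltr_wpDl.
rewrite /poisson expr1n mulr1 [2 * h]mulrC -!mulrA; apply: ler_wpM2l; first exact: ltW.
rewrite [leRHS]mulrCA; apply: ler_wpM2l => //.
rewrite ler_pdivlMr// ler_pdivrMl//; apply: le_trans (_ : s ^+ 2 * (1 + (d ^+ 2)^-1) <= _).
  by rewrite mulrDr mulr1 addrC lerD2l ler_pdivlMr// mul1r.
by rewrite ler_wpM2r ?addr_ge0 ?invr_ge0 ?(ltW d2)// lerDr sqr_ge0.
Qed.

Lemma poissonN s : poisson h (- s) = poisson h s.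
Proof. by rewrite /poisson sqrrN. Qed.

Lemma poissonC (x y : R) : poisson h (x - y) = poisson h (y - x).
Proof. by rewrite -poissonN opprB. Qed.

Lemma continuous_poisson : continuous (poisson h).
Proof.
move=> s; apply: cvgM; first exact: cvg_cst.
apply: cvgV; first by rewrite gt_eqF.
by apply: cvgD; [exact: cvg_cst|exact: exprn_continuous].
Qed.

Definition damping (r : R) := expR (- h * `|r|).

Lemma damping_ge0 r : 0 <= damping r. Proof. exact: expR_ge0. Qed.

Lemma damping_le1 r : damping r <= 1.
Proof. by rewrite /damping -expR0 ler_expR mulNr oppr_le0 mulr_ge0// ltW. Qed.

Lemma continuous_damping : continuous damping.
Proof.
move=> r; apply: continuous_comp; last exact: continuous_expR.
by apply: cvgM; [exact: cvg_cst|exact: norm_continuous].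
Qed.

Lemma cvg_expRN_bounded (g : R -> R) (M : R) : (forall x, `|g x| <= M) ->
  expR (- h * x) * g x @[x --> +oo] --> (0 : R).
Proof.
move=> gM; apply/cvgr0Pnorm_le => e e0.
have M0 : 0 <= M by exact: le_trans (gM 0).
have ce : expR (- h * x) @[x --> +oo] --> (0 : R).
  rewrite (_ : (fun x => expR (- h * x)) = (fun z => expR (- z)) \o (fun z => h * z)); last first.
    by apply: eq_fun => x; rewrite mulNr.
  apply: (@cvg_comp _ _ _ _ _ _ (pinfty_nbhs R)); last exact: cvgr_expR.
  exact: gt0_cvgMry.
have e1 : 0 < e / (M + 1) by rewrite divr_gt0// ltr_wpDl.
move/cvgr0Pnorm_le : ce => /(_ _ e1); apply: filterS => x small_x.
rewrite normrM; apply: le_trans (_ : e / (M + 1) * (M + 1) <= e).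
  by apply: ler_pM => //; rewrite (le_trans (gM x))// lerDl.
by rewrite divfK// gt_eqF// ltr_wpDl.
Qed.

Let primitive s x := - h^-1 + (s * sin (s * x) - h * cos (s * x)) / (h ^+ 2 + s ^+ 2).

Lemma is_derive_expRN_cos s x : is_derive x (1 : R)
  (fun x => expR (- h * x) * primitive s x) (expR (- h * x) * (1 + cos (s * x))).
Proof.
have den0 : h ^+ 2 + s ^+ 2 != 0 by rewrite gt_eqF.
have dexp : is_derive x (1 : R) (fun t => expR (- h * t)) (- h * expR (- h * x)).
  exact: is_derive_comp_mull.
have dp : is_derive x (1 : R) (primitive s)
    ((s * (s * cos (s * x)) + h * (s * sin (s * x))) / (h ^+ 2 + s ^+ 2)).
  have dsin := is_deriveZ s (is_derive_sin_mull s x).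
  have dcos := is_deriveZ (- h) (is_derive_cos_mull s x).
  have dtrig := is_deriveZ (h ^+ 2 + s ^+ 2)^-1 (is_deriveD dsin dcos).
  apply: eq_is_derive (is_deriveD (is_derive_cst (- h^-1) x (1 : R)) dtrig) => [t|].
    transitivity (- h^-1 + (h ^+ 2 + s ^+ 2)^-1 * (s * sin (s * t) + - h * cos (s * t))) => //.
    by rewrite /primitive; ring.
  by rewrite /GRing.scale/=; ring.
apply: eq_is_derive (is_deriveM dexp dp) => //; rewrite /GRing.scale/= /primitive.
by field; rewrite den0 gt_eqF.
Qed.

Lemma ge0_integralT_expRN_cos (f : R -> R) c s : (forall x, 0 <= f x) -> continuous f ->
  (forall x, 0 <= x -> f x + f (- x) = c * (expR (- h * x) * (1 + cos (s * x)))) ->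
  (\int[mu]_x (f x)%:E = (c * (h^-1 + h / (h ^+ 2 + s ^+ 2)))%:E)%E.
Proof.
move=> f0 cf fg; have dF x := is_deriveZ c (is_derive_expRN_cos s x).
rewrite (ge0_integralT_ftc f0 cf fg _ dF (l := 0)); last 2 first.
- move=> x; apply: cvgM; first exact: cvg_cst.
  apply: cvgM; first exact: is_derive_continuous (is_derive_comp_mull (is_derive_expR _)).
  by apply: cvgD; [exact: cvg_cst|exact: continuous_cos_mull].
- rewrite -[X in _ --> X](mulr0 c); apply: cvgM; first exact: cvg_cst.
  apply: (@cvg_expRN_bounded _ (h^-1 + (`|s| + h) / `|h ^+ 2 + s ^+ 2|)) => x.
  rewrite /primitive (le_trans (ler_normD _ _))// lerD//.
    by rewrite normrN ger0_norm// invr_ge0 ltW.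
  rewrite normrM normfV ler_wpM2r ?invr_ge0// (le_trans (ler_normB _ _))// lerD// normrM.
    by rewrite ler_piMr// ler_norml sin_geN1 sin_le1.
  by rewrite gtr0_norm// ler_piMr ?(ltW h0)// ler_norml cos_geN1 cos_le1.
congr EFin; transitivity (0 - c * (expR (- h * 0) * primitive s 0)) => //.
by rewrite /primitive !mulr0 expR0 sin0 cos0; ring.
Qed.

Lemma integral_damping : (\int[mu]_x (damping x)%:E = (2 / h)%:E)%E.
Proof.
rewrite (@ge0_integralT_expRN_cos damping 1 0 damping_ge0 continuous_damping) => [|x x0].
  by congr EFin; field; rewrite gt_eqF.
by rewrite mul0r cos0 /damping normrN ger0_norm//; ring.
Qed.

Lemma rintegrable_damping : rintegrable damping.
Proof.
have mw : measurable_fun setT damping by exact: continuous_measurable_fun continuous_damping.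
have [|//] := @ge0_rintegrable _ damping (2 / h) mw damping_ge0.
by rewrite integral_damping.
Qed.

Lemma Rintegral_damping : \int[mu]_x damping x = 2 / h.
Proof. by rewrite /Rintegral integral_damping. Qed.

Lemma rintegrable_dampingM (g : R -> R) : measurable_fun setT g -> (forall x, `|g x| <= 1) ->
  rintegrable (fun r => damping r * g r).
Proof.
move=> mg g1; apply: (le_rintegrable _ rintegrable_damping) => [|x].
  by apply: measurable_funM => //; exact: continuous_measurable_fun continuous_damping.
by rewrite normrM ger0_norm ?damping_ge0// ler_piMr ?damping_ge0.
Qed.

Lemma Rintegral_damping_fold (g : R -> R) c s : continuous g -> (forall x, `|g x| <= 1) ->
  (forall x, 2 + (g x + g (- x)) = c * (1 + cos (s * x))) ->
  \int[mu]_r (damping r * g r) = c * (h^-1 + h / (h ^+ 2 + s ^+ 2)) - 2 / h.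
Proof.
move=> cg g1 fold; have mg : measurable_fun setT g by exact: continuous_measurable_fun.
have : \int[mu]_r (damping r + damping r * g r) = c * (h^-1 + h / (h ^+ 2 + s ^+ 2)).
  rewrite /Rintegral; under eq_integral do rewrite -{1}[damping _]mulr1 -mulrDr.
  rewrite (@ge0_integralT_expRN_cos (fun x => damping x * (1 + g x)) c s)//.
  - by move=> x; rewrite mulr_ge0 ?damping_ge0//; have := ler_norm (- g x); rewrite normrN;
      have := g1 x; lra.
  - move=> x; apply: cvgM; first exact: continuous_damping.
    by apply: cvgD; [exact: cvg_cst|exact: cg].
  - by move=> x x0; rewrite [RHS]mulrCA -fold /damping normrN ger0_norm//; ring.
rewrite RintegralD//; [|exact: rintegrable_damping|exact: rintegrable_dampingM].
by rewrite Rintegral_damping => <-; rewrite addrC addKr.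
Qed.

Lemma Rintegral_damping_cos s : \int[mu]_r (damping r * cos (s * r)) = poisson h s.
Proof.
rewrite (@Rintegral_damping_fold _ 2 s (@continuous_cos_mull R s)) => [|x|x].
- by rewrite /poisson; field; rewrite !gt_eqF.
- by rewrite ler_norml cos_geN1 cos_le1.
- by rewrite mulrN cosN; ring.
Qed.

Lemma Rintegral_damping_sin s : \int[mu]_r (damping r * sin (s * r)) = 0.
Proof.
rewrite (@Rintegral_damping_fold _ 1 0 (@continuous_sin_mull R s)) => [|x|x].
- by field; rewrite gt_eqF.
- by rewrite ler_norml sin_geN1 sin_le1.
- by rewrite mulrN sinN mul0r cos0; ring.
Qed.

Lemma cint_damping_cis s :
  cint (fun r => cis (s * r) * real_complex R (damping r)) = real_complex R (poisson h s).
Proof.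
apply: complex_ext => /=.
- by rewrite -Rintegral_damping_cos; apply: eq_Rintegral => r _; rewrite mulr0 subr0 mulrC.
- transitivity (\int[mu]_r (damping r * sin (s * r))); last exact: Rintegral_damping_sin.
  by apply: eq_Rintegral => r _; rewrite mulr0 add0r mulrC.
Qed.

Lemma cintegrable_damping : cintegrable (fun r => real_complex R (damping r)).
Proof. by split => /=; [exact: rintegrable_damping|exact: rintegrable0]. Qed.

Lemma continuous_poisson_shift (s : R) : continuous (fun y : R => poisson h (s - 2 * y)).
Proof.
move=> y; apply: (@continuous_comp _ _ _ (fun y : R => s - 2 * y) (poisson h)).
  apply: cvgB; first exact: cvg_cst.
  by apply: cvgM; [exact: cvg_cst|exact: cvg_id].
exact: continuous_poisson.
Qed.

Lemma measurable_poisson_shift (s : R) : measurable_fun setT (fun y : R => poisson h (s - 2 * y)).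
Proof. by apply: continuous_measurable_fun; exact: continuous_poisson_shift. Qed.

Lemma measurable_poisson2 : measurable_fun setT (fun p : R * R => poisson h (2 * p.1 - 2 * p.2)).
Proof.
apply: (@measurableT_comp _ _ _ _ _ _ (poisson h)).
  by apply: continuous_measurable_fun; exact: continuous_poisson.
apply: measurable_funB; apply: measurable_funM; try exact: measurable_cst.
- exact: measurable_fst.
- exact: measurable_snd.
Qed.

Lemma is_derive_atan_poisson s y :
  is_derive y (1 : R) (fun y => atan ((2 * y - s) / h)) (poisson h (s - 2 * y)).
Proof.
have dlin : is_derive y (1 : R) (fun y => (2 * y - s) / h) (2 / h).
  apply: eq_is_derive (is_deriveD (is_derive_mull (2 / h) y)
    (is_derive_cst (- (s / h)) y (1 : R))) => [t|].
    by transitivity (2 / h * t + - (s / h)) => //; ring.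
  by rewrite addr0.
apply: eq_is_derive (is_derive1_comp (is_derive1_atan _) dlin) => //.
by rewrite /poisson; field; rewrite !gt_eqF.
Qed.

Lemma integral_poisson s : (\int[mu]_y (poisson h (s - 2 * y))%:E = (pi : R)%:E)%E.
Proof.
have cvg_atan_lin t : atan ((2 * y - t) / h) @[y --> +oo] --> (pi / 2 : R).
  apply: (@cvg_comp _ _ _ (fun y => (2 * y - t) / h) atan _ (pinfty_nbhs R)); last exact: cvgy_atan.
  apply/cvgryPge => A; exists ((A * h + t) / 2); split; first exact: num_real.
  by move=> y Ay; rewrite ler_pdivlMr//; lra.
pose F y := atan ((2 * y - s) / h) + atan ((2 * y - - s) / h).
have -> : (pi : R) = pi / 2 + pi / 2 - F 0.
  by rewrite /F mulr0 !sub0r opprK mulNr atanN addNr subr0 -splitr.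
apply: (@ge0_integralT_ftc _ _ (fun y => poisson h (s - 2 * y) + poisson h (- s - 2 * y))).
- by move=> y; exact: poisson_ge0.
- exact: continuous_poisson_shift.
- by move=> y _; rewrite -[in X in _ + X]poissonN; congr (_ + poisson h _); ring.
- by move=> y; apply: cvgD; exact: continuous_poisson_shift.
- by move=> y; apply: is_deriveD; exact: is_derive_atan_poisson.
- by apply: cvgD; exact: cvg_atan_lin.
Qed.

Lemma rintegrable_poisson s : rintegrable (fun y => poisson h (s - 2 * y)).
Proof.
have [|||//] := @ge0_rintegrable _ (fun y => poisson h (s - 2 * y)) pi.
- exact: measurable_poisson_shift.
- by move=> y; exact: poisson_ge0.
- by rewrite integral_poisson.
Qed.

Lemma Rintegral_poisson s : \int[mu]_y poisson h (s - 2 * y) = pi.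
Proof. by rewrite /Rintegral integral_poisson. Qed.

End PoissonKernel.

(** * Square-integrable functions *)

Section SquareIntegrable.
Variable R : realType.
Local Notation mu := (@lebesgue_measure R).
Implicit Types (f g : R -> R[i]) (h : R -> R) (a b c M : R).

Definition sqint f := cmeas f /\ rintegrable (fun x => cmod (f x) ^+ 2).
Definition sqnorm f : R := \int[mu]_x cmod (f x) ^+ 2.
Definition sqint_le f c := sqint f /\ sqnorm f <= c.

Lemma sqnorm_ge0 f : 0 <= sqnorm f.
Proof. by apply: Rintegral_ge0 => x _; exact: sqr_ge0. Qed.

Lemma sqint_le_sqnorm f : sqint f -> sqint_le f (sqnorm f).
Proof. by []. Qed.

Lemma sqint_le_ge0 f c : sqint_le f c -> 0 <= c.
Proof. by case=> _; exact: le_trans (sqnorm_ge0 f). Qed.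

Lemma le_sqint_le f c c' : c <= c' -> sqint_le f c -> sqint_le f c'.
Proof. by move=> cc' [sf fc]; split => //; exact: le_trans cc'. Qed.

Lemma eq_sqint_le f g c : f =1 g -> sqint_le f c -> sqint_le g c.
Proof. by move=> /funext ->. Qed.

Lemma measurable_sqr_cmod f : cmeas f -> measurable_fun setT (fun x => cmod (f x) ^+ 2).
Proof. by move=> mf; apply: measurable_funX; exact: cmeas_cmod. Qed.

Lemma integral_sqint_le f c : cmeas f -> (\int[mu]_x (cmod (f x) ^+ 2)%:E <= c%:E)%E ->
  sqint_le f c.
Proof.
move=> mf fc.
by have [|i2 le_c] := ge0_rintegrable (measurable_sqr_cmod mf) _ fc;
  first by move=> x; exact: sqr_ge0.
Qed.

Lemma dominated_sqint_le f h : cmeas f -> rintegrable h -> (forall x, cmod (f x) ^+ 2 <= h x) ->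
  sqint_le f (\int[mu]_x h x).
Proof.
move=> mf ih fh; have i2 : rintegrable (fun x => cmod (f x) ^+ 2).
  apply: (le_rintegrable _ ih); first exact: measurable_sqr_cmod.
  by move=> x; rewrite ger0_norm ?sqr_ge0.
by split => //; apply: le_Rintegral.
Qed.

Lemma le_cmod_sqint_le f g c : cmeas f -> (forall x, cmod (f x) <= cmod (g x)) ->
  sqint_le g c -> sqint_le f c.
Proof.
move=> mf fg [[_ i2] gc]; apply: le_sqint_le gc (dominated_sqint_le mf i2 _) => x.
by rewrite ler_sqr ?nnegrE ?cmod_ge0.
Qed.

Lemma sqint_le0 : sqint_le (fun=> 0) 0.
Proof.
apply: integral_sqint_le; first exact: cmeas_cst.
by under eq_integral do rewrite cmod0 expr0n; rewrite integral0.
Qed.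

Lemma sqint_leD f g a b : sqint_le f a -> sqint_le g b ->
  sqint_le (fun x => f x + g x) (2 * a + 2 * b).
Proof.
move=> [[mf if2] fa] [[mg ig2] gb].
have isum := rintegrableD (rintegrableZ 2 if2) (rintegrableZ 2 ig2).
have := @dominated_sqint_le (fun x => f x + g x) _ (cmeasD mf mg) isum.
rewrite RintegralD ?RintegralZl//; try exact: rintegrableZ.
move=> dom; apply: (le_sqint_le _ (dom _)) => [|x]; first by apply: lerD; apply: ler_wpM2l.
apply: le_trans (_ : (cmod (f x) + cmod (g x)) ^+ 2 <= _).
  by rewrite ler_sqr ?nnegrE ?addr_ge0 ?cmod_ge0 ?cmodD.
by have := sqr_ge0 (cmod (f x) - cmod (g x)); nra.
Qed.

Lemma sqint_le_boundedM f g M c : cmeas f -> (forall x, cmod (f x) <= M) -> sqint_le g c ->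
  sqint_le (fun x => f x * g x) (M ^+ 2 * c).
Proof.
move=> mf fM [[mg ig2] gc].
have := @dominated_sqint_le (fun x => f x * g x) _ (cmeasM mf mg) (rintegrableZ (M ^+ 2) ig2).
rewrite RintegralZl// => dom; apply: (le_sqint_le _ (dom _)) => [|x].
  by rewrite ler_wpM2l ?sqr_ge0.
rewrite cmodM exprMn ler_wpM2r ?sqr_ge0// ler_sqr ?nnegrE ?cmod_ge0//.
exact: le_trans (cmod_ge0 _) (fM x).
Qed.

Lemma sqint_leN f c : sqint_le f c -> sqint_le (fun x => - f x) c.
Proof.
move=> fc; have [[mf _] _] := fc.
by apply: le_cmod_sqint_le fc => [|x]; [exact: cmeasN|rewrite cmodN].
Qed.

Lemma sqint_leB f g a b : sqint_le f a -> sqint_le g b ->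
  sqint_le (fun x => f x - g x) (2 * a + 2 * b).
Proof. by move=> sf /sqint_leN; exact: sqint_leD. Qed.

Lemma sqint_le_conj f c : sqint_le f c -> sqint_le (fun x => (f x)^*%C) c.
Proof.
move=> fc; have [[mf _] _] := fc.
by apply: le_cmod_sqint_le fc => [|x]; [exact: cmeas_conj|rewrite cmod_conj].
Qed.

Lemma sqint_le_sum (I : finType) (P : pred I) (c : I -> R) (E : I -> R -> R[i]) :
  (forall j, P j -> sqint_le (E j) (c j)) ->
  sqint_le (fun r => \sum_(j | P j) E j r) (2 ^+ #|P| * \sum_(j | P j) c j).
Proof.
move=> sE; rewrite cardE -fct_sumE -2!big_enum/=.
have : all P (enum P) by apply/allP => j; rewrite mem_enum.
elim: (enum P) => [_|j s IH /= /andP[/sE Ej /IH Es]]; rewrite ?big_nil ?big_cons.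
  by rewrite mulr0; exact: sqint_le0.
have c0 := sqint_le_ge0 Ej; apply: le_sqint_le (sqint_leD Ej Es).
rewrite mulrA -exprS mulrDr lerD2r ler_wpM2r// exprS ler_peMr// exprn_ege1//.
by rewrite ler1n.
Qed.

Lemma sqint_cmod_cintM f g a b : sqint_le f a -> sqint_le g b ->
  cmod (cint (fun x => f x * g x)) <= 2^-1 * (a + b).
Proof.
move=> [[mf if2] fa] [[mg ig2] gb].
apply: le_trans (_ : 2^-1 * (sqnorm f + sqnorm g) <= _); last by rewrite ler_wpM2l ?invr_ge0// lerD.
rewrite /sqnorm -(RintegralD measurableT if2 ig2).
rewrite -(RintegralZl _ measurableT (rintegrableD if2 ig2)).
apply: le_cmod_cint; first exact: cmeasM.
- by apply: rintegrableZ; exact: rintegrableD.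
by move=> x; rewrite cmodM; have := sqr_ge0 (cmod (f x) - cmod (g x)); nra.
Qed.

Lemma Rintegral_indicM (D : set R) h :
  \int[mu]_x (\1_D x * h x) = \int[mu]_(x in D) h x.
Proof.
rewrite [RHS]Rintegral_mkcond; apply: eq_Rintegral => x _; rewrite patchE indicE.
by case: (x \in D); rewrite ?mul1r ?mul0r.
Qed.

Lemma Rintegral_indic (D : set R) : measurable D -> \int[mu]_x \1_D x = fine (mu D).
Proof.
move=> mD; under eq_Rintegral do rewrite -[\1_ _ _]mulr1.
by rewrite Rintegral_indicM Rintegral_cst// mul1r.
Qed.

Lemma rintegrable_indic (D : set R) : measurable D -> (mu D < +oo)%E ->
  rintegrable (fun x => \1_D x).
Proof.
move=> mD finD; have fineD : mu D \is a fin_num by rewrite ge0_fin_numE.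
have [||//|//] := @ge0_rintegrable _ (fun x => \1_D x) (fine (mu D)).
- exact: measurable_indic.
- by move=> x; rewrite indicE.
- by rewrite integral_indic// setIT fineK.
Qed.

Lemma lebesgue_measure_itvco a b : a <= b -> mu `[a, b[ = (b - a)%:E.
Proof.
move=> ab; rewrite lebesgue_measure_itv/= lte_fin; case: ltP => // ba.
by rewrite (_ : a = b) ?subrr//; apply/eqP; rewrite eq_le ab ba.
Qed.

Section SupportedInItv.
Variables (a b : R) (u : R -> R[i]).
Hypotheses (ab : a <= b) (su : sqint u) (u0 : forall x, ~~ (a <= x < b) -> u x = 0).

Let i1 : rintegrable (\1_`[a, b[ : R -> R).
Proof. by apply: rintegrable_indic => //; rewrite lebesgue_measure_itvco// ltry. Qed.

Let AMGM t x : 2 * t * cmod (u x) <= cmod (u x) ^+ 2 + t ^+ 2 * \1_`[a, b[ x.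
Proof.
rewrite indicE mem_setE in_itv/=; have [_|/u0 ->] := boolP (a <= x < b).
  by have := sqr_ge0 (cmod (u x) - t); rewrite /=; nra.
by rewrite cmod0 expr0n !mulr0 addr0.
Qed.

Lemma cintegrable_itv : cintegrable u.
Proof.
have [mu_ i2] := su; apply: (le_cintegrable mu_ (rintegrableD i2 (rintegrableZ (2^-1 ^+ 2) i1))).
by move=> x; have := AMGM 2^-1 x; rewrite divff// mul1r.
Qed.

Lemma double_Rintegral_cmod_le t : 2 * t * \int[mu]_x cmod (u x) <= sqnorm u + t ^+ 2 * (b - a).
Proof.
have [_ i2] := su; have ic := rintegrable_cmod cintegrable_itv.
rewrite -[b - a]/(fine (b - a)%:E) -lebesgue_measure_itvco// -Rintegral_indic//.
rewrite -!RintegralZl// -RintegralD//; last exact: rintegrableZ.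
apply: le_Rintegral => //; first exact: rintegrableZ.
by apply: rintegrableD => //; exact: rintegrableZ.
Qed.

Lemma sqr_Rintegral_cmod_le : (\int[mu]_x cmod (u x)) ^+ 2 <= (b - a) * sqnorm u.
Proof.
have := double_Rintegral_cmod_le; set I := \int[mu]_x _ => quad.
have [ab'|ab'] := eqVneq (b - a) 0.
  have [->|I0] := eqVneq I 0; first by rewrite expr0n ab' mul0r.
  have := quad ((sqnorm u + 1) / (2 * I)); rewrite ab' mulr0 addr0.
  have -> : 2 * ((sqnorm u + 1) / (2 * I)) * I = sqnorm u + 1 by field.
  by rewrite leNgt ltrDl ltr01.
have l0 : 0 < b - a by rewrite lt_neqAle eq_sym ab' subr_ge0.
have := quad (I / (b - a)).
have -> : 2 * (I / (b - a)) * I = 2 * (I ^+ 2 / (b - a)) by ring.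
have -> : (I / (b - a)) ^+ 2 * (b - a) = I ^+ 2 / (b - a) by field.
by rewrite mulrDl mul1r lerD2r ler_pdivrMr// mulrC.
Qed.

End SupportedInItv.

Definition supported (V : zmodType) L (v : R -> V) := forall x, ~~ (0 < x < L) -> v x = 0.

Lemma supported_neq0 (V : zmodType) L (v : R -> V) x : supported L v -> v x != 0 -> 0 < x < L.
Proof. by move=> v0; apply: contraNT => /v0 ->. Qed.

Lemma supportedB (V : zmodType) L (v w : R -> V) : supported L v -> supported L w ->
  supported L (fun x => v x - w x).
Proof. by move=> v0 w0 x xL; rewrite v0// w0// subrr. Qed.

Let supported_itvco L f : supported L f -> forall x, ~~ (0 <= x < L) -> f x = 0.
Proof. by move=> f0 x xL; apply: f0; apply: contra xL => /andP[/ltW -> ->]. Qed.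

Lemma supported_cintegrable L f : 0 <= L -> sqint f -> supported L f -> cintegrable f.
Proof. by move=> L0 sf /supported_itvco; exact: cintegrable_itv. Qed.

Lemma sqr_Rintegral_cmod_supported L f : 0 <= L -> sqint f -> supported L f ->
  (\int[mu]_x cmod (f x)) ^+ 2 <= L * sqnorm f.
Proof.
by move=> L0 sf /supported_itvco f0; have := sqr_Rintegral_cmod_le L0 sf f0; rewrite subr0.
Qed.

Lemma Rintegral_cmod_supported L f c : 0 <= L -> sqint_le f c -> supported L f ->
  \int[mu]_x cmod (f x) <= L + c.
Proof.
move=> L0 [sf fc] /supported_itvco f0; have := double_Rintegral_cmod_le L0 sf f0 2^-1.
by rewrite subr0; set I := \int[mu]_x _; nra.
Qed.

Lemma ge0_integral_le_cvg (h_ : nat -> R -> R) h c :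
  (forall n, measurable_fun setT (h_ n)) -> (forall n x, 0 <= h_ n x) ->
  (forall x, {homo h_ ^~ x : m n / (m <= n)%N >-> m <= n}) ->
  (forall x, h_ n x @[n --> \oo] --> h x) ->
  (forall n, (\int[mu]_x (h_ n x)%:E <= c%:E)%E) ->
  (\int[mu]_x (h x)%:E <= c%:E)%E.
Proof.
move=> mh h0 h_homo h_cvg h_le.
have mhE n : measurable_fun setT (fun x => (h_ n x)%:E) by exact/measurable_EFinP.
have h0E n x : [set: R] x -> (0 <= (h_ n x)%:E)%E by rewrite lee_fin.
have homoE x : [set: R] x -> {homo (fun n => (h_ n x)%:E) : m n / (m <= n)%N >-> (m <= n)%E}.
  by move=> _ m n mn; rewrite lee_fin h_homo.
have int_cvg := @cvg_monotone_convergence _ _ R mu _ measurableT _ mhE h0E homoE.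
rewrite (_ : (\int[mu]_x (h x)%:E)%E = (\int[mu]_x limn (fun n => (h_ n x)%:E))%E).
  by apply: (cvge_le _ int_cvg); exact: nearW.
apply: eq_integral => x _; apply/esym/cvg_lim => //.
by apply: cvg_EFin (h_cvg x); exact: nearW.
Qed.

End SquareIntegrable.

(** * Poisson averages *)

Section PoissonAverage.
Variable R : realType.
Local Notation mu := (@lebesgue_measure R).
Implicit Types (g u : R -> R).

(* The factors 2 are those of the exponents of [fourier] below. *)
Definition poisson_avg (h : R) g x := \int[mu]_y (g y * poisson h (2 * x - 2 * y)).

Section FixedWidth.
Variable h : R.
Hypothesis h0 : 0 < h.

Let pk_ge0 x y : 0 <= poisson h (2 * x - 2 * y). Proof. exact: poisson_ge0. Qed.

Lemma rintegrable_poissonM u s : rintegrable u ->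
  rintegrable (fun y => u y * poisson h (s - 2 * y)).
Proof.
move=> iu; apply: (le_rintegrable _ (rintegrableZ (2 / h) (rintegrable_norm iu))).
  apply: measurable_funM; first exact: measurable_rintegrable.
  exact: measurable_poisson_shift.
move=> y; rewrite normrM mulrC (ger0_norm (poisson_ge0 h0 _)).
by apply: ler_wpM2r => //; exact: poisson_le.
Qed.

Lemma rintegrable_bounded_poissonM g B s : measurable_fun setT g -> (forall y, `|g y| <= B) ->
  rintegrable (fun y => g y * poisson h (s - 2 * y)).
Proof.
move=> mg gB; apply: (le_rintegrable _ (rintegrableZ B (rintegrable_poisson h0 s))) => [|y].
  by apply: measurable_funM => //; exact: measurable_poisson_shift.
by rewrite normrM (ger0_norm (poisson_ge0 h0 _)) ler_wpM2r ?poisson_ge0.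
Qed.

Lemma measurable_poisson_avg g : measurable_fun setT g -> measurable_fun setT (poisson_avg h g).
Proof.
move=> mg; have mk : measurable_fun setT (fun p : R * R => g p.1 * poisson h (2 * p.2 - 2 * p.1)).
  apply: measurable_funM; first by apply: (measurableT_comp mg); exact: measurable_fst.
  by under eq_fun do rewrite poissonC; exact: measurable_poisson2.
exact: (@measurable_Rintegral R _ R (fun y x => g y * poisson h (2 * x - 2 * y)) mk).
Qed.

Lemma norm_poisson_avg_le g B x : measurable_fun setT g -> (forall y, `|g y| <= B) ->
  `|poisson_avg h g x| <= B * pi.
Proof.
move=> mg gB; have ig := rintegrable_bounded_poissonM (2 * x) mg gB.
apply: le_trans (le_normr_Rintegral measurableT ig) _.
rewrite -(Rintegral_poisson h0 (2 * x)) -RintegralZl//; last exact: rintegrable_poisson.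
apply: le_Rintegral => //; [exact: rintegrable_norm|exact/rintegrableZ/rintegrable_poisson|].
by move=> y _; rewrite normrM (ger0_norm (pk_ge0 _ _)) ler_wpM2r.
Qed.

Section Schur.
Variable u : R -> R.
Hypotheses (u0 : forall x, 0 <= u x) (iu : rintegrable u) (iu2 : rintegrable (fun x => u x ^+ 2)).

Let mu_u : measurable_fun setT u. Proof. exact: measurable_rintegrable. Qed.

Let k (p : R * R) := (2^-1 * (u p.1 ^+ 2 * poisson h (2 * p.1 - 2 * p.2)))%:E.
Let k' (p : R * R) := k (p.2, p.1).

Let mk : measurable_fun setT k.
Proof.
apply/measurable_EFinP; apply: measurable_funM; first exact: measurable_cst.
apply: measurable_funM; last exact: measurable_poisson2.
by apply: measurable_funX; apply: (measurableT_comp mu_u); exact: measurable_fst.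
Qed.

Let mk' : measurable_fun setT k'.
Proof.
apply: (measurableT_comp mk).
by apply: measurable_fun_pair; [exact: measurable_snd|exact: measurable_fst].
Qed.

Let k_ge0 p : (0 <= k p)%E.
Proof. by rewrite lee_fin mulr_ge0 ?invr_ge0// mulr_ge0 ?sqr_ge0. Qed.

Let k'_ge0 p : (0 <= k' p)%E.
Proof. exact: k_ge0. Qed.

Let mk1 x : measurable_fun setT (fun y => k (x, y)).
Proof. exact: (measurableT_comp mk (pair1_measurable x)). Qed.

Let mk'1 x : measurable_fun setT (fun y => k' (x, y)).
Proof. exact: (measurableT_comp mk' (pair1_measurable x)). Qed.

Let mass : (\int[mu]_x \int[mu]_y k (x, y) = (2^-1 * (pi * \int[mu]_x (u x ^+ 2)))%:E)%E.
Proof.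
have i2 := rintegrableZ 2^-1 (rintegrableZ pi iu2).
rewrite -!RintegralZl//; last exact: rintegrableZ.
rewrite -integral_rintegrable//.
have ip x := rintegrable_poisson h0 (2 * x).
apply: eq_integral => x _.
have isec := rintegrableZ (u x ^+ 2) (ip x).
rewrite (integral_rintegrable (rintegrableZ 2^-1 isec)) (RintegralZl _ measurableT isec).
by rewrite (RintegralZl _ measurableT (ip x)) Rintegral_poisson// [pi * _]mulrC.
Qed.

Let mass_split : (\int[mu]_x \int[mu]_y (k (x, y) + k' (x, y)) =
  (pi * \int[mu]_x (u x ^+ 2))%:E)%E.
Proof.
have split x : (\int[mu]_y (k (x, y) + k' (x, y)) = \int[mu]_y k (x, y) + \int[mu]_y k' (x, y))%E.
  by rewrite ge0_integralD//; [exact: mk1|exact: mk'1].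
under eq_integral do rewrite split.
rewrite ge0_integralD//; last 4 first.
- by move=> x _; apply: integral_ge0 => y _; exact: k_ge0.
- exact: (measurable_fun_fubini_tonelli_F (m2 := mu) k mk k_ge0).
- by move=> x _; apply: integral_ge0 => y _; exact: k'_ge0.
- exact: (measurable_fun_fubini_tonelli_F (m2 := mu) k' mk' k'_ge0).
have -> : (\int[mu]_x \int[mu]_y k' (x, y) = \int[mu]_x \int[mu]_y k (x, y))%E.
  exact: (fubini_tonelli (m1 := mu) (m2 := mu) k' mk' k'_ge0).
by rewrite mass -EFinD; congr EFin; lra.
Qed.

(* Schur's test: AM-GM splits the form into u(x)^2 P and u(y)^2 P, and both marginals of P have
   mass pi. *)
Lemma poisson_schur : rintegrable (fun x => u x * poisson_avg h u x) /\
  \int[mu]_x (u x * poisson_avg h u x) <= pi * \int[mu]_x (u x ^+ 2).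
Proof.
have avg0 x : 0 <= poisson_avg h u x by apply: Rintegral_ge0 => y _; rewrite mulr_ge0.
have mform : measurable_fun setT (fun x => u x * poisson_avg h u x).
  by apply: measurable_funM => //; exact: measurable_poisson_avg.
apply: ge0_rintegrable => // [x|]; first by rewrite mulr_ge0.
rewrite -mass_split; apply: ge0_le_integral => //.
- by move=> x _; rewrite lee_fin mulr_ge0.
- exact/measurable_EFinP.
- apply: (measurable_fun_fubini_tonelli_F (m2 := mu) (fun p => k p + k' p)%E).
    exact: emeasurable_funD.
  by move=> p; rewrite adde_ge0.
move=> x _; have iuP := rintegrable_poissonM (2 * x) iu.
rewrite /poisson_avg -RintegralZl// -integral_rintegrable; last exact: rintegrableZ.
apply: ge0_le_integral => //.
- by move=> y _; rewrite lee_fin; apply: mulr_ge0 => //; exact: mulr_ge0.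
- by apply/measurable_EFinP; apply: measurable_funM => //; exact: measurable_rintegrable iuP.
- by apply: emeasurable_funD; [exact: mk1|exact: mk'1].
move=> y _; rewrite /k' /k/= -EFinD lee_fin [poisson h (2 * y - _)]poissonC.
have := mulr_ge0 (pk_ge0 x y) (sqr_ge0 (u x - u y)); move: (poisson _ _) (u x) (u y) => p v w.
nra.
Qed.

End Schur.
Lemma poisson_avg_dist_le g B k d x : measurable_fun setT g -> (forall y, `|g y| <= B) ->
  0 < d -> (forall y, `|x - y| < d -> `|g x - g y| <= k) ->
  `|pi * g x - poisson_avg h g x| <= pi * k + 2 * B * pi * (1 + ((2 * d) ^+ 2)^-1) * h.
Proof.
move=> mg gB d0 gk; have k0 : 0 <= k by rewrite (le_trans _ (gk x _))// subrr normr0.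
have ip := rintegrable_poisson h0 (2 * x); have ip1 := rintegrable_poisson ltr01 (2 * x).
pose K := 2 * B * (h * (1 + ((2 * d) ^+ 2)^-1)).
have B0 : 0 <= B by exact: le_trans (gB x).
have igx : rintegrable (fun y => (g x - g y) * poisson h (2 * x - 2 * y)).
  apply: (@rintegrable_bounded_poissonM _ (2 * B)) => [|y]; first exact: measurable_funB.
  by rewrite (le_trans (ler_normB _ _))// mulr2n mulrDl mul1r lerD.
have -> : pi * g x - poisson_avg h g x = \int[mu]_y ((g x - g y) * poisson h (2 * x - 2 * y)).
  rewrite -(Rintegral_poisson h0 (2 * x)) mulrC /poisson_avg -RintegralZl//.
  rewrite -RintegralB//; [by apply: eq_Rintegral => y _; rewrite mulrBl|exact: rintegrableZ|].
  exact: rintegrable_bounded_poissonM mg gB.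
have idom : rintegrable (fun y => k * poisson h (2 * x - 2 * y) + K * poisson 1 (2 * x - 2 * y)).
  by apply: rintegrableD; exact: rintegrableZ.
have -> : pi * k + 2 * B * pi * (1 + ((2 * d) ^+ 2)^-1) * h =
    \int[mu]_y (k * poisson h (2 * x - 2 * y) + K * poisson 1 (2 * x - 2 * y)).
  rewrite (RintegralD measurableT (rintegrableZ k ip) (rintegrableZ K ip1)).
  rewrite (RintegralZl _ measurableT ip) (RintegralZl _ measurableT ip1).
  by rewrite (Rintegral_poisson h0) (Rintegral_poisson ltr01) /K; ring.
apply: le_trans (le_normr_Rintegral measurableT igx) _.
apply: le_Rintegral => //; first exact: rintegrable_norm.
move=> y _; rewrite normrM (ger0_norm (pk_ge0 x y)).
have p1_ge0 : 0 <= poisson 1 (2 * x - 2 * y) by exact: poisson_ge0.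
have K0 : 0 <= K by rewrite !mulr_ge0 ?addr_ge0 ?invr_ge0 ?sqr_ge0// ltW.
have [xyd|xyd] := ltP `|x - y| d.
  by apply: ler_wpDr; [exact: mulr_ge0|apply: ler_wpM2r => //; exact: gk].
apply: ler_wpDl; first exact: mulr_ge0.
have far : 2 * d <= `|2 * x - 2 * y|.
  by rewrite -mulrBr normrM ger0_norm// ler_wpM2l.
have d20 : 0 < 2 * d by rewrite mulr_gt0.
rewrite /K -mulrA; apply: ler_pM => //; last exact: poisson_far_le1.
by rewrite (le_trans (ler_normB _ _))// mulr2n mulrDl mul1r lerD.
Qed.

End FixedWidth.

Lemma poisson_avg_cvg g B x : measurable_fun setT g -> (forall y, `|g y| <= B) ->
  {for x, continuous g} -> poisson_avg (harmonic n) g x @[n --> \oo] --> pi * g x.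
Proof.
move=> mg gB cg; have p0 := pi_gt0 R; apply/cvgrPdist_le => e e0.
have e1 : 0 < e / (2 * pi) by rewrite divr_gt0// mulr_gt0.
move/cvgr_dist_le : cg => /(_ _ e1)/nbhs_ballP[d /= d0 gd].
pose K := 2 * B * pi * (1 + ((2 * d) ^+ 2)^-1).
have : K * harmonic n @[n --> \oo] --> (0 : R).
  by rewrite -(mulr0 K); apply: cvgM; [exact: cvg_cst|exact: cvg_harmonic].
move/cvgr0Pnorm_le => /(_ _ (divr_gt0 e0 (ltr0Sn _ 1))); apply: filterS => n Kn.
apply: le_trans (poisson_avg_dist_le (harmonic_gt0 n) mg gB d0 gd) _.
rewrite [leRHS]splitr; apply: lerD; last exact: le_trans (ler_norm _) Kn.
by rewrite mulrC -ler_pdivlMr// invfM mulrA.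
Qed.

Lemma poisson_avg_swap h u g : 0 < h -> rintegrable u -> rintegrable g ->
  \int[mu]_x (u x * poisson_avg h g x) = \int[mu]_x (g x * poisson_avg h u x).
Proof.
move=> h0 iu ig; pose k x y := u x * (g y * poisson h (2 * x - 2 * y)).
have mk : measurable_fun setT (fun p : R * R => k p.1 p.2).
  apply: measurable_funM.
    by apply: (measurableT_comp (measurable_rintegrable iu)); exact: measurable_fst.
  apply: measurable_funM; last exact: measurable_poisson2.
  by apply: (measurableT_comp (measurable_rintegrable ig)); exact: measurable_snd.
have k_le x y : `|k x y| <= `|u x| * (2 / h * `|g y|).
  rewrite /k normrM; apply: ler_wpM2l => //.
  rewrite normrM mulrC (ger0_norm (poisson_ge0 h0 _)).
  by apply: ler_wpM2r => //; exact: poisson_le.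
have := rfubini mk (rintegrable_norm iu) (rintegrableZ (2 / h) (rintegrable_norm ig)) k_le.
have kE1 x : \int[mu]_y k x y = u x * poisson_avg h g x.
  by rewrite RintegralZl//; exact: rintegrable_poissonM.
have kE2 y : \int[mu]_x k x y = g y * poisson_avg h u y.
  rewrite /poisson_avg -RintegralZl//; last exact: rintegrable_poissonM.
  by apply: eq_Rintegral => x _; rewrite /k poissonC mulrCA.
by under eq_Rintegral do rewrite kE1; under [RHS]eq_Rintegral do rewrite kE2.
Qed.

Lemma poisson_avg_pairing_cvg u g B : rintegrable u -> measurable_fun setT g ->
  (forall y, `|g y| <= B) -> (forall y, u y != 0 -> {for y, continuous g}) ->
  \int[mu]_y (u y * poisson_avg (harmonic n) g y) @[n --> \oo] --> pi * \int[mu]_y (u y * g y).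
Proof.
move=> iu mg gB cg; have meas_u := measurable_rintegrable iu.
have avgB n y := norm_poisson_avg_le (harmonic_gt0 n) y mg gB.
have [] := @dominated_convergence _ _ R mu setT measurableT
  (fun n y => (u y * poisson_avg (harmonic n) g y)%:E) (fun y => (u y * (pi * g y))%:E)
  (fun y => (B * pi * `|u y|)%:E).
- move=> n; apply/measurable_EFinP; apply: measurable_funM; first exact: meas_u.
  exact: (measurable_poisson_avg (harmonic_gt0 n) mg).
- apply/measurable_EFinP; apply: measurable_funM; first exact: meas_u.
  by apply: measurable_funM; [exact: measurable_cst|exact: mg].
- apply: aeW => y _; apply: cvg_EFin; first exact: nearW.
  have [->|/cg cgy] := eqVneq (u y) 0.
    by under eq_cvg do rewrite /= mul0r; rewrite mul0r; exact: cvg_cst.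
  by apply: cvgM; [exact: cvg_cst|exact: poisson_avg_cvg gB cgy].
- exact: rintegrableZ (rintegrable_norm iu).
- by apply: aeW => y n _; rewrite lee_fin normrM mulrC ler_wpM2r.
have iug := rintegrableM_bounded iu mg gB.
have ilim : rintegrable (fun y => u y * (pi * g y)).
  by under eq_fun do rewrite mulrCA; exact: rintegrableZ.
move=> _ _; rewrite integral_rintegrable// => /fine_cvg/=.
by under eq_Rintegral do rewrite mulrCA; rewrite RintegralZl.
Qed.

Lemma poisson_avg_pairing_dist h u v g B : 0 < h -> rintegrable u -> rintegrable v ->
  rintegrable g -> (forall y, `|g y| <= B) ->
  `|\int[mu]_x (g x * poisson_avg h v x) - \int[mu]_x (u x * poisson_avg h g x)| <=
  B * pi * \int[mu]_x `|u x - v x|.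
Proof.
move=> h0 iu iv ig gB; have mg := measurable_rintegrable ig.
have mavg := measurable_poisson_avg h0 mg.
have avgB x := norm_poisson_avg_le h0 x mg gB.
rewrite -(poisson_avg_swap h0 iv ig) distrC.
rewrite -RintegralB//; [|exact: rintegrableM_bounded avgB|exact: rintegrableM_bounded avgB].
under eq_Rintegral do rewrite -mulrBl.
exact: norm_RintegralM_le (rintegrableB iu iv) mavg avgB.
Qed.

Lemma approx_continuous L (f : R -> R) e : 0 <= L -> rintegrable f -> supported L f -> 0 < e ->
  exists phi : R -> R, [/\ continuous phi, rintegrable (fun x => f x - \1_`]0, L[ x * phi x) &
    \int[mu]_x `|f x - \1_`]0, L[ x * phi x| <= e].
Proof.
move=> L0 intf f0 e0; pose D := `]0%R, L[%classic : set R.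
have mD : measurable D by exact: measurable_itv.
have muD : (mu D < +oo)%E.
  by rewrite lebesgue_measure_itv/= lte_fin; case: ifP => // _; rewrite -EFinD ltry.
have ifD : mu.-integrable D (EFin \o f) by exact: (integrableS measurableT).
have [g_ [cg ig /fine_cvgP[_ g_cvg]]] := approximation_continuous_integrable mD muD ifD.
move/cvgr0Pnorm_le : g_cvg => /(_ _ e0)[n _ /(_ n (leqnn n))] /= g_close.
have eqf x : f x - \1_D x * g_ n x = \1_D x * (f x - g_ n x).
  rewrite indicE mem_setE in_itv/=.
  by have [_|/f0 ->] := boolP (0 < x < L); rewrite ?mul1r// !mul0r subr0.
exists (g_ n); split; first exact: cg.
- under eq_fun do rewrite eqf.
  have := (@integrable_mkcond _ _ R mu D _ mD).1 (@integrableB _ _ R mu D mD _ _ ifD (ig n)).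
  congr (is_true (mu.-integrable _ _)); apply/funext => x /=.
  by rewrite patchE indicE; case: (x \in D); rewrite ?mul1r ?mul0r.
- apply: le_trans (ler_norm _) _; apply: le_trans g_close; rewrite le_eqVlt; apply/orP; left.
  apply/eqP; congr (`|_|); rewrite -[RHS]Rintegral_indicM.
  by apply: eq_Rintegral => x _; rewrite eqf normrM ger0_norm ?indicE.
Qed.

Lemma continuous_itv_indic_bounded L (phi : R -> R) : continuous phi ->
  exists B, forall x, `|\1_`]0, L[ x * phi x| <= B.
Proof.
move=> cphi; have : compact [set phi x | x in `[0, L]%classic].
  apply: continuous_compact; first exact: continuous_subspaceT.
  exact: segment_compact.
move=> /compact_bounded[B [_ phi_le]]; exists (`|B| + 1) => x; rewrite indicE mem_setE in_itv/=.
have [/andP[x0 xL]|_] := boolP (0 < x < L); last by rewrite mul0r normr0 addr_ge0.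
rewrite mul1r; apply: phi_le; first by rewrite (le_lt_trans (ler_norm _))// ltrDl.
by exists x => //=; rewrite in_itv/= !ltW.
Qed.

Lemma continuous_indicM L (phi : R -> R) (x : R) : continuous phi -> 0 < x < L ->
  {for x, continuous (fun y : R => \1_`]0, L[ y * phi y)}.
Proof.
move=> cphi xL; have xin : x \in `]0, L[ by rewrite in_itv.
have phix : \1_`]0, L[ x * phi x = phi x by rewrite indicE mem_setE xin mul1r.
rewrite /prop_for /continuous_at phix; apply: cvg_trans (cphi x).
apply: near_eq_cvg; near=> y; rewrite indicE mem_setE.
suff -> : y \in `]0, L[ by rewrite mul1r.
by near: y; exact: near_in_itvoo.
Unshelve. all: by end_near. Qed.

Lemma poisson_avg_supported_cvg L (f g : R -> R) B : 0 < L -> rintegrable f -> supported L f ->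
  rintegrable g -> supported L g -> (forall y, `|g y| <= B) ->
  \int[mu]_x (f x * poisson_avg (harmonic n) g x) @[n --> \oo] --> pi * \int[mu]_x (f x * g x).
Proof.
move=> L0 intf f0 intg g0 gB; have p0 := pi_gt0 R; have mg := measurable_rintegrable intg.
have B0 : 0 <= B by exact: le_trans (gB 0).
apply/cvgrPdist_le => e e0; pose K := 3 * (B * pi + 1).
have K0 : 0 < K by rewrite mulr_gt0// ltr_wpDl// mulr_ge0// ltW.
have [phi [cphi ifphi le_fphi]] := approx_continuous (ltW L0) intf f0 (divr_gt0 e0 K0).
pose psi x := \1_`]0, L[ x * phi x; have [C psiC] := continuous_itv_indic_bounded L cphi.
have mpsi : measurable_fun setT psi.
  by apply: measurable_funM; [exact: measurable_indic|exact: continuous_measurable_fun].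
have ipsi : rintegrable psi.
  by have := rintegrableB intf ifphi; under eq_fun do rewrite subKr.
have cpsi y : g y != 0 -> {for y, continuous psi}.
  by move=> /(supported_neq0 g0) yL; exact: continuous_indicM.
have := poisson_avg_pairing_cvg intg mpsi psiC cpsi.
have e3 : 0 < e / 3 by rewrite divr_gt0.
move=> /cvgrPdist_le/(_ _ e3); apply: filterS => n psi_n.
have BK (I : R) : I <= e / K -> B * pi * I <= e / 3.
  have Bpi0 : 0 <= B * pi by rewrite mulr_ge0// ltW.
  move=> IeK; apply: le_trans (ler_wpM2l Bpi0 IeK) _; rewrite mulrA ler_pdivrMr// /K.
  by move: (B * pi) => t; lra.
have avg_fpsi : `|\int[mu]_x (g x * poisson_avg (harmonic n) psi x) -
    \int[mu]_x (f x * poisson_avg (harmonic n) g x)| <= e / 3.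
  exact: le_trans (poisson_avg_pairing_dist (harmonic_gt0 n) intf ipsi intg gB) (BK _ le_fphi).
have lim_fpsi : `|pi * \int[mu]_x (f x * g x) - pi * \int[mu]_x (g x * psi x)| <= e / 3.
  under [X in _ - _ * X]eq_Rintegral do rewrite mulrC.
  rewrite -mulrBr normrM (gtr0_norm p0).
  rewrite -RintegralB//; [|exact: rintegrableM_bounded gB|exact: rintegrableM_bounded gB].
  under eq_Rintegral do rewrite -mulrBl.
  have := ler_wpM2l (ltW p0) (norm_RintegralM_le ifphi mg gB); rewrite mulrA [pi * B]mulrC.
  by move/le_trans; apply; exact: BK.
rewrite -(subrKA (pi * \int[mu]_x (g x * psi x))).
rewrite -[X in _ + X](subrKA (\int[mu]_x (g x * poisson_avg (harmonic n) psi x))).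
have -> : e = e / 3 + (e / 3 + e / 3) by field.
apply: le_trans (ler_normD _ _) (lerD lim_fpsi _).
exact: le_trans (ler_normD _ _) (lerD psi_n avg_fpsi).
Qed.

End PoissonAverage.

(** * Fourier estimates *)

Section FourierTransform.
Variable R : realType.
Local Notation mu := (@lebesgue_measure R).
Implicit Types (f g : R -> R[i]) (c : R).

Definition fourier f (r : R) : R[i] := cint (fun x => f x * cis (2 * x * r)).

Lemma cmeas2_cis (u : R -> R) : measurable_fun setT u -> cmeas2 (fun x r : R => cis (u x * r)).
Proof.
move=> mu_; apply: cmeas_cis; apply: measurable_funM; last exact: measurable_snd.
by apply: (measurableT_comp mu_); exact: measurable_fst.
Qed.

Lemma cmeas2_cisM c : cmeas2 (fun x r : R => cis (c * x * r)).
Proof. by apply: (@cmeas2_cis (fun x => c * x)); exact: mulrl_measurable. Qed.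

Lemma cintegrable_cis_kernel c f r : cintegrable f -> cintegrable (fun x => f x * cis (c * x * r)).
Proof.
move=> intf; apply: (@cintegrableM_bounded _ _ _ 1 intf) => [|x _]; last by rewrite cmod_cis.
exact: (cmeas_section2 r (cmeas2_cisM c)).
Qed.

Lemma cmeas_fourier f : cintegrable f -> cmeas (fourier f).
Proof. by move=> intf; exact: cmeas_cintM intf (cmeas2_cisM 2). Qed.

Lemma cmod_fourier_le f r : cintegrable f -> cmod (fourier f r) <= \int[mu]_x cmod (f x).
Proof.
move=> intf; rewrite -[leRHS]mul1r; apply: le_cmod_cintM => // [|x _]; last by rewrite cmod_cis.
exact: (cmeas_section2 r (cmeas2_cisM 2)).
Qed.

Lemma conj_fourier f r : cintegrable f ->
  (fourier f r)^*%C = cint (fun y => (f y)^*%C * cis (- 2 * y * r)).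
Proof.
move=> intf; rewrite /fourier -cint_conj; last exact: cintegrable_cis_kernel.
by apply: eq_cint => y; rewrite rmorphM !mulNr -conj_cis.
Qed.

Section Damped.
Variables (h : R) (g : R -> R[i]).
Hypotheses (h0 : 0 < h) (intg : cintegrable g).

Definition damped (r : R) : R[i] := real_complex R (damping h r) * (fourier g r)^*%C.

Definition damped_kernel (s : R) : R[i] :=
  cint (fun y => (g y)^*%C * real_complex R (poisson h (s - 2 * y))).

Lemma cintegrable_damped : cintegrable damped.
Proof.
have := cintegrableM_bounded (cintegrable_damping h0) (cmeas_conj (cmeas_fourier intg)).
by apply=> r _; rewrite cmod_conj; exact: cmod_fourier_le.
Qed.

Lemma sqint_le_damped c : sqint_le (fourier g) c -> sqint_le damped c.
Proof.
apply: le_cmod_sqint_le => [|r]; first exact: cmeas_cintegrable cintegrable_damped.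
by rewrite cmodM cmod_conj cmod_real ger0_norm ?damping_ge0// ler_piMl ?cmod_ge0 ?damping_le1.
Qed.

Lemma cint_cis_damped s : cint (fun r => cis (s * r) * damped r) = damped_kernel s.
Proof.
have EM y r : (g y)^*%C != 0 -> cmod (cis (- 2 * y * r)) <= 1 by rewrite cmod_cis.
have intc : cintegrable (fun r => cis (s * r) * real_complex R (damping h r)).
  by apply: cintegrable_cisM; exact: cintegrable_damping.
transitivity (cint (fun r => cint (fun y => (g y)^*%C * cis (- 2 * y * r)) *
    (cis (s * r) * real_complex R (damping h r)))).
  by apply: eq_cint => r; rewrite /damped conj_fourier//; ring.
rewrite (cfubiniM (cintegrable_conj intg) (cmeas2_cisM _) EM intc).
apply: eq_cint => y; congr (_ * _); rewrite -cint_damping_cis//; apply: eq_cint => r.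
by rewrite mulrA -cisD; congr (cis _ * _); ring.
Qed.

Lemma cint_fourier_damped f : cintegrable f ->
  cint (fun r => fourier f r * damped r) = cint (fun x => f x * damped_kernel (2 * x)).
Proof.
move=> intf; have EM x r : f x != 0 -> cmod (cis (2 * x * r)) <= 1 by rewrite cmod_cis.
rewrite (cfubiniM intf (cmeas2_cisM 2) EM cintegrable_damped).
by apply: eq_cint => x; rewrite cint_cis_damped.
Qed.

Lemma cmeas_damped_kernel : cmeas (fun x : R => damped_kernel (2 * x)).
Proof.
apply: (cmeas_cintM (cintegrable_conj intg)
  (E := fun y x => real_complex R (poisson h (2 * x - 2 * y)))).
by apply: cmeas2_swap; apply: cmeas_real; exact: measurable_poisson2.
Qed.

Lemma cmod_damped_kernel_le s :
  cmod (damped_kernel s) <= \int[mu]_y (cmod (g y) * poisson h (s - 2 * y)).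
Proof.
apply: le_cmod_cint.
- apply: cmeasM; first exact/cmeas_conj/cmeas_cintegrable.
  by apply: cmeas_real; exact: measurable_poisson_shift.
- by apply: rintegrable_poissonM => //; exact: rintegrable_cmod.
- by move=> y; rewrite cmodM cmod_conj cmod_real ger0_norm// poisson_ge0.
Qed.

Lemma Re_damped_kernel x : ReC (damped_kernel (2 * x)) = poisson_avg h (fun y => ReC (g y)) x.
Proof. by apply: eq_Rintegral => y _; rewrite ReCM; case: (g y) => u v /=; ring. Qed.

Lemma Im_damped_kernel x : ImC (damped_kernel (2 * x)) = - poisson_avg h (fun y => ImC (g y)) x.
Proof.
have [_ iIm] := intg; rewrite /poisson_avg -mulN1r -RintegralZl//; last exact: rintegrable_poissonM.
by apply: eq_Rintegral => y _; rewrite ImCM; case: (g y) => u v /=; ring.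
Qed.

Lemma damped_fourier_le c : sqint_le g c ->
  rintegrable (fun r => damping h r * cmod (fourier g r) ^+ 2) /\
  \int[mu]_r (damping h r * cmod (fourier g r) ^+ 2) <= pi * c.
Proof.
move=> [[_ ig2] gc]; have iw : rintegrable (fun r => damping h r * cmod (fourier g r) ^+ 2).
  apply: (rintegrableM_bounded (B := (\int[mu]_x cmod (g x)) ^+ 2)
    (rintegrable_damping h0)) => [|r].
    by apply: measurable_sqr_cmod; exact: cmeas_fourier.
  rewrite ger0_norm ?sqr_ge0// ler_sqr ?nnegrE ?cmod_ge0//; first exact: cmod_fourier_le.
  by apply: Rintegral_ge0 => x _; exact: cmod_ge0.
split => //; set W := \int[mu]_r _.
have W0 : 0 <= W by apply: Rintegral_ge0 => r _; rewrite mulr_ge0 ?damping_ge0 ?sqr_ge0.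
have WE : real_complex R W = cint (fun r => fourier g r * damped r).
  have damped_sqr r : fourier g r * damped r = real_complex R
    (damping h r * cmod (fourier g r) ^+ 2).
    by rewrite /damped mulrCA [fourier g r * _]mulrC mul_conj_cmod -rmorphM.
  under eq_cint do rewrite damped_sqr.
  by apply: complex_ext => //=; rewrite Rintegral_cst// mul0r.
rewrite -[W]ger0_norm// -cmod_real WE cint_fourier_damped//.
have [|||i_form form_le] := @poisson_schur _ h h0 (fun x => cmod (g x)).
- by move=> x; exact: cmod_ge0.
- exact: rintegrable_cmod.
- exact: ig2.
apply: le_trans (_ : pi * sqnorm g <= _); last by rewrite ler_wpM2l ?pi_ge0.
apply: le_trans form_le; apply: le_cmod_cint => // [|x].
  by apply: cmeasM; [exact: cmeas_cintegrable|exact: cmeas_damped_kernel].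
by rewrite cmodM ler_wpM2l ?cmod_ge0// cmod_damped_kernel_le.
Qed.

End Damped.

Lemma fourier_upper g c : cintegrable g -> sqint_le g c -> sqint_le (fourier g) (pi * c).
Proof.
move=> intg gc; apply: integral_sqint_le; first exact: cmeas_fourier.
have damped_le n := damped_fourier_le (harmonic_gt0 n) intg gc.
apply: (@ge0_integral_le_cvg _ (fun n r => damping (harmonic n) r * cmod (fourier g r) ^+ 2)).
- by move=> n; exact: measurable_rintegrable (damped_le n).1.
- by move=> n r; rewrite mulr_ge0 ?damping_ge0 ?sqr_ge0.
- move=> r m n mn; apply: ler_wpM2r; first exact: sqr_ge0.
  rewrite /damping ler_expR !mulNr lerN2; apply: ler_wpM2r => //.
  by rewrite lef_pV2 ?posrE// ler_nat.
- move=> r; rewrite -[X in _ --> X]mul1r; apply: cvgM; last exact: cvg_cst.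
  rewrite /damping -expR0; apply: continuous_cvg; first exact: continuous_expR.
  rewrite -(mul0r `|r|); apply: cvgM; last exact: cvg_cst.
  rewrite -oppr0; apply: cvgN; exact: cvg_harmonic.
- by move=> n; have [i1 le1] := damped_le n; rewrite integral_rintegrable.
Qed.

Lemma fourierN_upper f c : cintegrable f -> sqint_le f c ->
  sqint_le (fun r => cint (fun x => f x * cis (- 2 * x * r))) (pi * c).
Proof.
move=> intf /sqint_le_conj/(fourier_upper (cintegrable_conj intf))/sqint_le_conj.
apply: eq_sqint_le => r; rewrite conj_fourier; last exact: cintegrable_conj.
by apply: eq_cint => x; rewrite conjcK.
Qed.

Lemma Re_cint_damped_cvg L f g B : 0 < L -> cintegrable f -> supported L f ->
  cintegrable g -> supported L g -> (forall x, cmod (g x) <= B) ->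
  ReC (cint (fun x => f x * damped_kernel (harmonic n) g (2 * x))) @[n --> \oo] -->
  pi * ReC (cint (fun x => f x * (g x)^*%C)).
Proof.
move=> L0 [iRf iIf] f0 intg g0 gB; have [iRg iIg] := intg.
have suppRe (u : R -> R[i]) : supported L u -> supported L (fun x => ReC (u x)).
  by move=> u0 x /u0 ->.
have suppIm (u : R -> R[i]) : supported L u -> supported L (fun x => ImC (u x)).
  by move=> u0 x /u0 ->.
have RegB x : `|ReC (g x)| <= B by exact: le_trans (ler_norm_Re _) (gB x).
have ImgB x : `|ImC (g x)| <= B by exact: le_trans (ler_norm_Im _) (gB x).
have mRg := measurable_rintegrable iRg; have mIg := measurable_rintegrable iIg.
have cvgRe := poisson_avg_supported_cvg L0 iRf (suppRe _ f0) iRg (suppRe _ g0) RegB.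
have cvgIm := poisson_avg_supported_cvg L0 iIf (suppIm _ f0) iIg (suppIm _ g0) ImgB.
have -> : ReC (cint (fun x => f x * (g x)^*%C)) =
    \int[mu]_x (ReC (f x) * ReC (g x)) + \int[mu]_x (ImC (f x) * ImC (g x)).
  rewrite -RintegralD//; [|exact: rintegrableM_bounded RegB|exact: rintegrableM_bounded ImgB].
  by apply: eq_Rintegral => x _; case: (f x); case: (g x) => * /=; ring.
rewrite mulrDr; apply: cvg_trans (cvgD cvgRe cvgIm); apply: near_eq_cvg; apply: nearW => n.
have h0 : 0 < harmonic n :> R := harmonic_gt0 n.
have iRe := rintegrableM_bounded iRf (measurable_poisson_avg h0 mRg)
  (fun x => norm_poisson_avg_le h0 x mRg RegB).
have iIm := rintegrableM_bounded iIf (measurable_poisson_avg h0 mIg)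
  (fun x => norm_poisson_avg_le h0 x mIg ImgB).
rewrite -[LHS](RintegralD measurableT iRe iIm); apply: eq_Rintegral => x _.
by rewrite ReCM Re_damped_kernel Im_damped_kernel// mulrN opprK.
Qed.

Section FourierLower.
Variables (L M c : R) (f E : R -> R[i]).
Hypotheses (L0 : 0 < L) (sf : sqint f) (f0 : supported L f).
Hypotheses (sE : spectral (2 * L) M E) (fEc : sqint_le (fun r => fourier f r + E r) c).

Let intf : cintegrable f. Proof. exact: supported_cintegrable (ltW L0) sf f0. Qed.

(* The damped transform of a function supported left of L has mass O(h) on the exponents
   >= 2 L of E. *)
Lemma spectral_damped_le h l g : 0 < h -> l < L -> cintegrable g -> supported l g ->
  cmod (cint (fun r => E r * damped h g r)) <=
  M * (2 / (2 * (L - l)) ^+ 2 * \int[mu]_y cmod (g y)) * h.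
Proof.
move=> h0 lL intg g0; have [_ _ E_le] := sE.
rewrite -mulrA; apply: E_le => [|s sL]; first exact: cintegrable_damped.
rewrite cint_cis_damped//; apply: le_trans (cmod_damped_kernel_le h0 intg s) _.
have intn := rintegrable_cmod intg.
rewrite mulrAC -RintegralZl//; apply: le_Rintegral => //.
- exact: rintegrable_poissonM.
- exact: rintegrableZ.
move=> y _; have [/andP[_ yl]|/g0 ->] := boolP (0 < y < l); last by rewrite cmod0 mul0r mulr0.
rewrite mulrC; apply: ler_wpM2r; first exact: cmod_ge0.
rewrite [2 / _ * _]mulrAC; apply: poisson_far; rewrite ?mulr_gt0 ?subr_gt0//.
by apply: le_trans (ler_norm _); lra.
Qed.

Lemma Re_cint_damped_le h l g k : 0 < h -> l < L -> cintegrable g -> supported l g ->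
  sqint_le g k -> ReC (cint (fun x => f x * damped_kernel h g (2 * x))) <=
  2^-1 * (c + pi * k) + M * (2 / (2 * (L - l)) ^+ 2 * \int[mu]_y cmod (g y)) * h.
Proof.
move=> h0 lL intg g0 gk; have E_le := spectral_damped_le h0 lL intg g0.
have intd := cintegrable_damped h0 intg.
have intE := cintegrable_boundedM (cmeas_spectral sE) (spectral_bound sE) intd.
have intF := cintegrable_boundedM (cmeas_fourier intf) (fun r => cmod_fourier_le r intf) intd.
have fE_le := sqint_cmod_cintM fEc (sqint_le_damped h0 intg (fourier_upper intg gk)).
rewrite -(cint_fourier_damped h0 intg intf).
apply: le_trans (le_trans (ler_norm _) (ler_norm_Re _)) _.
have -> : cint (fun r => fourier f r * damped h g r) =
    cint (fun r => (fourier f r + E r) * damped h g r) - cint (fun r => E r * damped h g r).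
  by under [X in _ = X - _]eq_cint do rewrite mulrDl; rewrite cintD// addrK.
exact: le_trans (cmodB _ _) (lerD fE_le E_le).
Qed.

Lemma fourier_lower_truncated l B g : l < L -> cmeas g -> (forall x, g x = f x \/ g x = 0) ->
  (forall x, cmod (g x) <= B) -> supported l g -> pi * sqnorm g <= c.
Proof.
move=> lL mg gf gB g0.
have sg : sqint_le g (sqnorm g).
  have [|//] := @le_cmod_sqint_le _ g f (sqnorm f) mg _ (sqint_le_sqnorm sf).
  by move=> x; case: (gf x) => ->; rewrite ?cmod0 ?cmod_ge0.
have g0L : supported L g by move=> x /f0 fx; case: (gf x) => ->.
have intg := supported_cintegrable (ltW L0) sg.1 g0L.
have fgE : ReC (cint (fun x => f x * (g x)^*%C)) = sqnorm g.
  apply: eq_Rintegral => x _; case: (gf x) => gx; last by rewrite gx rmorph0 mulr0 cmod0 expr0n.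
  by rewrite -gx mulrC mul_conj_cmod.
have := Re_cint_damped_cvg L0 intf f0 intg g0L gB; rewrite fgE => form_cvg.
have Re_le n := Re_cint_damped_le (harmonic_gt0 n) lL intg g0 sg.
suff : pi * sqnorm g <= 2^-1 * (c + pi * sqnorm g) by move: (pi * _) => t; lra.
rewrite -[leRHS]addr0.
apply: (ler_cvg_to form_cvg (cvgD (cvg_cst _) _) (nearW _ Re_le)).
by rewrite -[X in _ --> X](mulr0 (M * (2 / (2 * (L - l)) ^+ 2 * \int[mu]_y cmod (g y))));
  apply: cvgM; [exact: cvg_cst|exact: cvg_harmonic].
Qed.

Let keep n x := (cmod (f x) <= n%:R) && (x < L - harmonic n).
Let trunc n x := real_complex R (keep n x)%:R * f x.

Let truncE n x : trunc n x = if keep n x then f x else 0.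
Proof. by rewrite /trunc; case: (keep n x); rewrite ?mul1r ?mul0r. Qed.

Let cmeas_trunc n : cmeas (trunc n).
Proof.
have [mf _] := sf; apply: cmeasM => //; apply: cmeas_real.
apply: measurable_natr_bool; apply: measurable_and.
  by apply: measurable_fun_ler; [exact: cmeas_cmod|exact: measurable_cst].
by apply: measurable_fun_ltr; [exact: measurable_id|exact: measurable_cst].
Qed.

Let keep_homo x m n : (m <= n)%N -> keep m x -> keep n x.
Proof.
move=> mn /andP[fm xm]; apply/andP; split; first by rewrite (le_trans fm)// ler_nat.
by apply: lt_le_trans xm _; rewrite lerD2l lerN2 /harmonic lef_pV2 ?posrE// ler_nat.
Qed.

Let keep_near x : 0 < x < L -> \forall n \near \oo, keep n x.
Proof.
move=> /andP[_ xL]; have xL0 : 0 < L - x by rewrite subr_gt0.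
have harm : \forall n \near \oo, `|@harmonic R n| < L - x.
  by have /cvgr0Pnorm_lt/(_ _ xL0) := @cvg_harmonic R.
near=> n; apply/andP; split; first by near: n; exact: nbhs_infty_ger.
by rewrite ltrBrDr -ltrBrDl (le_lt_trans (ler_norm _))//; near: n.
Unshelve. all: by end_near. Qed.

Theorem fourier_lower : pi * sqnorm f <= c.
Proof.
have p0 := pi_gt0 R; have [mf _] := sf.
have trunc_le n : pi * sqnorm (trunc n) <= c.
  apply: (@fourier_lower_truncated (L - harmonic n) n%:R) => //.
  - by rewrite ltrBlDr ltrDl harmonic_gt0.
  - by move=> x; rewrite truncE; case: ifP; [left|right].
  - by move=> x; rewrite truncE; case: ifP => [/andP[]//|_]; rewrite cmod0.
  - move=> x xl; rewrite truncE; case: ifP => // /andP[_ xl'].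
    have [x0|x0] := ltP 0 x; first by rewrite x0 xl' in xl.
    by apply: f0; rewrite ltNge x0.
suff : sqnorm f <= c / pi by rewrite ler_pdivlMr// mulrC.
have [|_ //] := @integral_sqint_le _ f (c / pi) mf.
apply: (@ge0_integral_le_cvg _ (fun n x => cmod (trunc n x) ^+ 2)).
- by move=> n; exact: measurable_sqr_cmod.
- by move=> n x; exact: sqr_ge0.
- move=> x m n mn; rewrite !truncE; case: ifP => [/(keep_homo mn) -> //|_].
  by rewrite cmod0 expr0n; exact: sqr_ge0.
- move=> x; apply: cvg_near_cst; have [fx0|/(supported_neq0 f0)/keep_near] := eqVneq (f x) 0.
    by apply: nearW => n; rewrite truncE fx0; case: ifP.
  by apply: filterS => n kn; rewrite truncE kn.
- move=> n; have trunc_f x : cmod (trunc n x) <= cmod (f x).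
    by rewrite truncE; case: ifP => // _; rewrite cmod0 cmod_ge0.
  have [[_ i2] _] := le_cmod_sqint_le (cmeas_trunc n) trunc_f (sqint_le_sqnorm sf).
  by rewrite integral_rintegrable// lee_fin ler_pdivlMr// mulrC; exact: trunc_le.
Qed.

End FourierLower.
End FourierTransform.

(** * Wave fronts *)

Section Decay.
Variable R : realType.
Local Notation mu := (@lebesgue_measure R).

Lemma integral_oneDsqrV : (\int[mu]_x ((oneDsqr x)^-1)%:E = (pi : R)%:E)%E.
Proof.
rewrite (@ge0_symfun_integralT R (fun x => (oneDsqr x)^-1)).
- rewrite -set_itvcy integral0y_oneDsqr -EFinM; congr EFin; lra.
- by move=> x; rewrite invr_ge0 (le_trans ler01).
- by move=> x; exact: continuous_oneDsqrV.
- by move=> x; rewrite /= /oneDsqr sqrrN.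
Qed.

Lemma rintegrable_oneDsqrV : rintegrable (fun x : R => (oneDsqr x)^-1).
Proof.
have [|||//] := @ge0_rintegrable _ (fun x : R => (oneDsqr x)^-1) pi.
- by apply: continuous_measurable_fun => x; exact: continuous_oneDsqrV.
- by move=> x; rewrite invr_ge0 (le_trans ler01).
- by rewrite integral_oneDsqrV.
Qed.

Definition decay (r : R) : R := (Num.sqrt (oneDsqr r))^-1.

Lemma decay_ge0 r : 0 <= decay r. Proof. by rewrite invr_ge0 sqrtr_ge0. Qed.

Lemma sqr_decay r : decay r ^+ 2 = (oneDsqr r)^-1.
Proof. by rewrite /decay exprVn sqr_sqrtr// (le_trans ler01)// oneDsqr_ge1. Qed.

Lemma decay_le1 r : decay r <= 1.
Proof.
rewrite -ler_sqr ?nnegrE ?decay_ge0// expr1n sqr_decay.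
by rewrite invf_le1 ?oneDsqr_ge1// (lt_le_trans ltr01)// oneDsqr_ge1.
Qed.

Lemma le_decay (r t A B : R) : 0 <= t -> t <= A -> `|r| * t <= B -> t <= (A + B) * decay r.
Proof.
move=> t0 tA rtB.
have A0 := le_trans t0 tA; have B0 : 0 <= B by apply: le_trans rtB; rewrite mulr_ge0.
have o0 : 0 < oneDsqr r by rewrite (lt_le_trans ltr01)// oneDsqr_ge1.
rewrite -ler_sqr ?nnegrE ?mulr_ge0 ?addr_ge0 ?decay_ge0// exprMn sqr_decay ler_pdivlMr//.
have t2 : t ^+ 2 <= A ^+ 2 by rewrite ler_sqr.
have r2t2 : r ^+ 2 * t ^+ 2 <= B ^+ 2.
  by rewrite -(real_normK (num_real r)) -exprMn ler_sqr ?nnegrE ?mulr_ge0.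
by rewrite /oneDsqr; have := mulr_ge0 A0 B0; nra.
Qed.

Lemma sqint_le_decay (f : R -> R[i]) K : cmeas f -> (forall r, cmod (f r) <= K * decay r) ->
  sqint_le f (pi * K ^+ 2).
Proof.
move=> mf fK; have io := rintegrable_oneDsqrV.
have := @dominated_sqint_le _ f _ mf (rintegrableZ (K ^+ 2) io).
rewrite (RintegralZl _ measurableT io) {1}/Rintegral integral_oneDsqrV/= mulrC; apply=> r.
by rewrite -sqr_decay -exprMn ler_sqr ?nnegrE ?cmod_ge0// (le_trans (cmod_ge0 _) (fK r)).
Qed.

End Decay.

Section Wavefront.
Variable R : realType.
Implicit Types (p d : R) (c : R[i]) (M : R) (e f : R -> R[i]).

Definition leading_term p d c M e e1 := [/\ spectral p M e, spectral (p + d) M e1 &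
  forall r, cmod (e r - c * cis (p * r) - e1 r) <= M * decay r].

Lemma leading_term_le p d c M M' e e1 : M <= M' -> leading_term p d c M e e1 ->
  leading_term p d c M' e e1.
Proof.
move=> MM' [se se1 err]; split; [exact: spectral_le se|exact: spectral_le se1|move=> r].
by apply: le_trans (err r) _; rewrite ler_wpM2r ?decay_ge0.
Qed.

Lemma leading_termM p d c M e e1 p' d' c' M' f f1 d2 : 0 <= d2 -> d2 <= d -> d2 <= d' ->
  cmod c <= M -> cmod c' <= M' -> leading_term p d c M e e1 -> leading_term p' d' c' M' f f1 ->
  leading_term (p + p') d2 (c * c') (3 * (M * M')) (fun r => e r * f r)
    (fun r => c * cis (p * r) * f1 r + (c' * cis (p' * r) * e1 r + e1 r * f1 r)).
Proof.
move=> d0 dd dd' cM c'M [se se1 e_err] [sf sf1 f_err].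
have M0 := spectral_ge0 se; have M'0 := spectral_ge0 sf; have MM : 0 <= M * M' by rewrite mulr_ge0.
have lead_spectral (q : R) z N : cmod z <= N -> spectral q N (fun r => z * cis (q * r)).
  by move=> zN; exact: spectral_le (lexx q) zN (spectral_Zcis z (lexx q)).
split.
- by apply: (spectral_le (lexx _) _ (spectralM se sf)); rewrite ler_peMl// ler1n.
- have s_cf1 : spectral (p + p' + d2) (M * M') (fun r => c * cis (p * r) * f1 r).
    apply: (spectral_le _ (lexx _) (spectralM (lead_spectral p c M cM) sf1)).
    by rewrite -addrA !lerD2l.
  have s_c'e1 : spectral (p + p' + d2) (M * M') (fun r => c' * cis (p' * r) * e1 r).
    rewrite (mulrC M); apply: (spectral_le _ (lexx _) (spectralM (lead_spectral p' c' M' c'M) se1)).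
    by rewrite (addrC p) -addrA !lerD2l.
  have s_e1f1 : spectral (p + p' + d2) (M * M') (fun r => e1 r * f1 r).
    apply: (spectral_le _ (lexx _) (spectralM se1 sf1)).
    by rewrite addrACA lerD2l (le_trans dd)// lerDl (le_trans d0).
  rewrite (_ : 3 * _ = M * M' + (M * M' + M * M')); last by ring.
  exact: spectralD s_cf1 (spectralD s_c'e1 s_e1f1).
- move=> r; rewrite [X in cmod X](_ : _ = e r * (f r - c' * cis (p' * r) - f1 r) +
    (e r - c * cis (p * r) - e1 r) * (c' * cis (p' * r) + f1 r)); last by rewrite mulrDl cisD; ring.
  have -> : 3 * (M * M') * decay r = M * (M' * decay r) + M * decay r * (M' + M') by ring.
  apply: le_trans (cmodD _ _) _; rewrite !cmodM.
  apply: lerD; apply: ler_pM; rewrite ?cmod_ge0//; first exact: (spectral_bound se).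
  apply: le_trans (cmodD _ _) (lerD _ (spectral_bound sf1 r)).
  by rewrite cmodM cmod_cis mulr1.
Qed.

Lemma leading_termD p d c M e e1 c' M' f f1 : leading_term p d c M e e1 ->
  leading_term p d c' M' f f1 ->
  leading_term p d (c + c') (M + M') (fun r => e r + f r) (fun r => e1 r + f1 r).
Proof.
move=> [se se1 e_err] [sf sf1 f_err]; split; [exact: spectralD|exact: spectralD|move=> r].
rewrite [X in cmod X](_ : _ = (e r - c * cis (p * r) - e1 r) + (f r - c' * cis (p * r) - f1 r));
  last by ring.
by apply: le_trans (cmodD _ _) _; rewrite mulrDl; apply: lerD.
Qed.

Lemma leading_term_perturb p d c M M1 M2 e e1 f : spectral p M1 f ->
  (forall r, cmod (f r - e r) <= M2 * decay r) -> 0 <= M2 -> leading_term p d c M e e1 ->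
  leading_term p d c (M + M1 + M2) f e1.
Proof.
move=> sf fe M20 [se se1 err]; have M0 := spectral_ge0 se; have M10 := spectral_ge0 sf.
split.
- by apply: spectral_le sf => //; rewrite addrAC lerDr addr_ge0.
- by apply: spectral_le se1 => //; rewrite -addrA lerDl addr_ge0.
- move=> r; rewrite [X in cmod X](_ : _ = (e r - c * cis (p * r) - e1 r) + (f r - e r));
    last by ring.
  apply: le_trans (cmodD _ _) (le_trans (lerD (err r) (fe r)) _).
  by rewrite -mulrDl ler_wpM2r ?decay_ge0// addrAC lerDl.
Qed.

Lemma leading_term_cis2 p d c c1 e : 0 <= d -> cmod c + cmod c1 <= 1 ->
  (forall r, e r = c * cis (p * r) + c1 * cis ((p + d) * r)) ->
  leading_term p d c 1 e (fun r => c1 * cis ((p + d) * r)).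
Proof.
move=> d0 cc /funext ->; have c0 := cmod_ge0 c; have c10 := cmod_ge0 c1; split.
- have pd : p <= p + d by rewrite lerDl.
  exact: spectral_le (lexx _) cc (spectralD (spectral_Zcis c (lexx p)) (spectral_Zcis c1 pd)).
- by apply: spectral_le (spectral_Zcis c1 (lexx _)) => //; apply: le_trans cc; rewrite lerDr.
- by move=> r; rewrite (_ : _ - _ - _ = 0); [rewrite cmod0 mul1r decay_ge0|ring].
Qed.

End Wavefront.

Section WavefrontFamily.
Variables (R : realType) (L : R).
Implicit Types (p d u : R -> R) (c : R[i]) (M : R) (E F : R -> R -> R[i]).

Definition wavefront p d c M E := [/\ cmeas2 E, cmod c <= M & exists E1, cmeas2 E1 /\
  forall x, 0 < x < L -> leading_term (p x) (d x) c M (E x) (E1 x)].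

Lemma wavefront_ge0 p d c M E : wavefront p d c M E -> 0 <= M.
Proof. by case=> _ /(le_trans (cmod_ge0 _)). Qed.

Lemma eq_wavefront p p' d d' c c' M E F : p =1 p' -> d =1 d' -> c = c' -> E =2 F ->
  wavefront p d c M E -> wavefront p' d' c' M F.
Proof.
move=> /funext -> /funext -> -> EF; suff -> : E = F by [].
by apply/funext => x; apply/funext.
Qed.

Lemma spectral_wavefront p d c M E x : wavefront p d c M E -> 0 < x < L ->
  spectral (p x) M (E x).
Proof. by move=> [_ _ [E1 [_ lead]]] /lead[]. Qed.

Lemma wavefront_le p d c M M' E : M <= M' -> wavefront p d c M E -> wavefront p d c M' E.
Proof.
move=> MM' [mE cM [E1 [mE1 lead]]]; split => //; first exact: le_trans MM'.
by exists E1; split => // x /lead; exact: leading_term_le.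
Qed.

Let cmeas2_Zcis c u : measurable_fun setT u -> cmeas2 (fun x r : R => c * cis (u x * r)).
Proof.
by move=> mu_; apply: (@cmeas2M _ (fun _ _ => c)); [exact: cmeas_cst|exact: cmeas2_cis].
Qed.

Lemma wavefrontM p d c M E p' d' c' M' F d2 : measurable_fun setT p -> measurable_fun setT p' ->
  (forall x, 0 < x < L -> [/\ 0 <= d2 x, d2 x <= d x & d2 x <= d' x]) ->
  wavefront p d c M E -> wavefront p' d' c' M' F ->
  wavefront (fun x => p x + p' x) d2 (c * c') (3 * (M * M')) (fun x r => E x r * F x r).
Proof.
move=> mp mp' gap fE fF; have M0 := wavefront_ge0 fE; have M'0 := wavefront_ge0 fF.
move: fE fF => [mE cM [E1 [mE1 leadE]]] [mF c'M [F1 [mF1 leadF]]].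
split; first exact: cmeas2M.
  rewrite cmodM; apply: le_trans (_ : M * M' <= _); first by apply: ler_pM; rewrite ?cmod_ge0.
  by rewrite ler_peMl ?mulr_ge0// ler1n.
exists (fun x r => c * cis (p x * r) * F1 x r + (c' * cis (p' x * r) * E1 x r + E1 x r * F1 x r)).
split.
  apply: cmeas2D; first by apply: cmeas2M => //; exact: cmeas2_Zcis.
  by apply: cmeas2D; apply: cmeas2M => //; exact: cmeas2_Zcis.
move=> x xL; have [d0 dd dd'] := gap x xL.
exact: leading_termM d0 dd dd' cM c'M (leadE x xL) (leadF x xL).
Qed.

Lemma wavefrontD p d c M E c' M' F : wavefront p d c M E -> wavefront p d c' M' F ->
  wavefront p d (c + c') (M + M') (fun x r => E x r + F x r).
Proof.
move=> [mE cM [E1 [mE1 leadE]]] [mF c'M [F1 [mF1 leadF]]].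
split; first exact: cmeas2D; first by apply: le_trans (cmodD _ _) _; exact: lerD.
exists (fun x r => E1 x r + F1 x r); split; first exact: cmeas2D.
by move=> x xL; exact: leading_termD (leadE x xL) (leadF x xL).
Qed.

Lemma wavefront_perturb p d c M M1 M2 E F : cmeas2 F ->
  (forall x, 0 < x < L -> spectral (p x) M1 (F x)) ->
  (forall x r, 0 < x < L -> cmod (F x r - E x r) <= M2 * decay r) -> 0 <= M1 -> 0 <= M2 ->
  wavefront p d c M E -> wavefront p d c (M + M1 + M2) F.
Proof.
move=> mF sF FE M10 M20 [mE cM [E1 [mE1 leadE]]]; split => //.
  by apply: le_trans cM _; rewrite -addrA lerDl addr_ge0.
exists E1; split => // x xL; apply: leading_term_perturb (leadE x xL) => //; first exact: sF.
by move=> r; exact: FE.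
Qed.

Lemma wavefront_cis2 p d c c1 E : measurable_fun setT p -> measurable_fun setT d ->
  (forall x, 0 < x < L -> 0 <= d x) -> cmod c + cmod c1 <= 1 ->
  (forall x r, E x r = c * cis (p x * r) + c1 * cis ((p x + d x) * r)) -> wavefront p d c 1 E.
Proof.
move=> mp md d0 cc EE; have mpd : measurable_fun setT (fun x => p x + d x).
  exact: measurable_funD.
have mE1 : cmeas2 (fun x r => c1 * cis ((p x + d x) * r)) by exact: cmeas2_Zcis mpd.
split; last by exists (fun x r => c1 * cis ((p x + d x) * r)); split => // x /d0 dx;
  exact: leading_term_cis2.
- by apply: eq_cmeas (cmeas2D (cmeas2_Zcis c mp) mE1) => -[x r]; rewrite EE.
- by apply: le_trans cc; rewrite lerDl cmod_ge0.
Qed.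

Lemma wavefront_sin u : measurable_fun setT u -> (forall x, 0 < x < L -> 0 <= u x) ->
  wavefront (fun x => - u x) (fun x => 2 * u x) (half_i R) 1
    (fun x r => real_complex R (sin (r * u x))).
Proof.
move=> mu_ u0; apply: (@wavefront_cis2 _ _ _ (- half_i R)).
- exact: measurableT_comp.
- by apply: measurable_funM => //; exact: measurable_cst.
- by move=> x /u0 ux; rewrite mulr_ge0.
- by rewrite cmodN cmod_half_i; lra.
- by move=> x r; rewrite sin_cis [- half_i R * _]mulNr; congr (_ * cis _ - _ * cis _); ring.
Qed.

Lemma wavefront_cos u : measurable_fun setT u -> (forall x, 0 < x < L -> 0 <= u x) ->
  wavefront (fun x => - u x) (fun x => 2 * u x) (real_complex R 2^-1) 1
    (fun x r => real_complex R (cos (r * u x))).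
Proof.
move=> mu_ u0; apply: (@wavefront_cis2 _ _ _ (real_complex R 2^-1)).
- exact: measurableT_comp.
- by apply: measurable_funM => //; exact: measurable_cst.
- by move=> x /u0 ux; rewrite mulr_ge0.
- by rewrite cmod_real ger0_norm ?invr_ge0//; lra.
- by move=> x r; rewrite cos_cis; congr (_ * cis _ + _ * cis _); ring.
Qed.

Lemma spectral_wavefront_cst (p : R) d c M (e : R -> R[i]) : 0 < L ->
  wavefront (fun=> p) d c M (fun _ => e) -> spectral p M e.
Proof.
move=> L0 fe; apply: (spectral_wavefront (x := L / 2) fe); apply/andP; split; lra.
Qed.

Lemma wavefront_cst d c : wavefront (fun=> 0) d c (cmod c) (fun _ _ => c).
Proof.
split; [exact: cmeas_cst|by []|exists (fun _ _ => 0); split; first exact: cmeas_cst].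
move=> x xL; split; [exact: spectral_cst|exact: spectral_le (lexx _) (cmod_ge0 c) (spectral0 _)|].
by move=> r; rewrite mul0r cis0 mulr1 subrr subr0 cmod0 mulr_ge0 ?decay_ge0 ?cmod_ge0.
Qed.

Lemma wavefront0 p d : wavefront p d 0 0 (fun _ _ => 0).
Proof.
split; [exact: cmeas_cst|by rewrite cmod0|exists (fun _ _ => 0); split; first exact: cmeas_cst].
by move=> x xL; split; [exact: spectral0..|move=> r; rewrite !mul0r !subr0 cmod0].
Qed.

Lemma wavefront_sum (I : finType) (P : pred I) p d (c : I -> R[i]) (M : I -> R)
    (E : I -> R -> R -> R[i]) : (forall j, P j -> wavefront p d (c j) (M j) (E j)) ->
  wavefront p d (\sum_(j | P j) c j) (\sum_(j | P j) M j) (fun x r => \sum_(j | P j) E j x r).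
Proof.
move=> fE; rewrite (_ : (fun x r => _) = \sum_(j | P j) E j).
  apply: (big_rec3 (fun c M E => wavefront p d c M E)); first exact: wavefront0.
  by move=> j z N F /fE; exact: wavefrontD.
by rewrite fct_sumE; apply/funext => x; rewrite fct_sumE.
Qed.

Lemma wavefront_prod (I : finType) (P : pred I) (q g : R) c M (e : I -> R -> R[i]) : 0 <= g ->
  (forall j, wavefront (fun=> q) (fun=> g) c M (fun _ => e j)) ->
  wavefront (fun=> #|P|%:R * q) (fun=> g) (c ^+ #|P|) ((3 * M) ^+ #|P|)
    (fun _ r => \prod_(j | P j) e j r).
Proof.
move=> g0 fe; rewrite cardE.
have -> : (fun _ r => \prod_(j | P j) e j r) = fun (_ : R) r => \prod_(j <- enum P) e j r.
  by apply/funext => x; apply/funext => r; rewrite big_enum.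
elim: (enum P) => [|j s IH] /=.
  rewrite !expr0 -(cmod1 R); apply: eq_wavefront (wavefront_cst _ _) => // [x|x r].
    by rewrite mul0r.
  by rewrite big_nil.
have mcst (u : R) : measurable_fun setT (fun _ : R => u) by exact: measurable_cst.
have := @wavefrontM _ _ _ _ _ _ _ _ _ _ (fun=> g) (mcst _) (mcst _) _ (fe j) IH.
rewrite !exprS -mulrA => fes; apply: eq_wavefront (fes _) => // [x|x r].
  by rewrite -[in RHS]add1n natrD mulrDl mul1r.
by rewrite big_cons.
Qed.

End WavefrontFamily.

(** * Recovery of a function from its pairing with a wave front *)

Section Recovery.
Variable R : realType.
Local Notation mu := (@lebesgue_measure R).
Variables (L M : R) (c : R[i]).
Hypotheses (L0 : 0 < L) (c_neq0 : c != 0).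

Definition recovers K := forall (f : R -> R[i]) (B : R -> R -> R[i]) (J : R -> R[i]) (p MJ k : R),
  sqint f -> supported L f -> wavefront L (fun x => p + 2 * x) (fun x => 2 * L - 2 * x) c M B ->
  spectral (p + 2 * L) MJ J -> sqint_le (fun r => cint (fun x => f x * B x r) + J r) k ->
  sqnorm f <= K * k.

Let cmod_c_gt0 : 0 < cmod c.
Proof. by rewrite lt_neqAle cmod_ge0 andbT eq_sym; apply: contra c_neq0 => /eqP/cmod_eq0 ->. Qed.

Let cmod_c2_gt0 : 0 < cmod c ^+ 2. Proof. by rewrite exprn_gt0. Qed.

Section Pairing.
Variables (f : R -> R[i]) (B E1 : R -> R -> R[i]) (J : R -> R[i]) (p MJ k : R).
Hypotheses (sf : sqint f) (f0 : supported L f) (mB : cmeas2 B) (mE1 : cmeas2 E1).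
Hypothesis lead : forall x, 0 < x < L -> leading_term (p + 2 * x) (2 * L - 2 * x) c M (B x) (E1 x).
Hypothesis sJ : spectral (p + 2 * L) MJ J.
Let pairing_J r := cint (fun x => f x * B x r) + J r.
Hypothesis pairing_le : sqint_le pairing_J k.

Let intf : cintegrable f. Proof. exact: supported_cintegrable (ltW L0) sf f0. Qed.

Definition cut_left b (x : R) : R[i] := if x < b then f x else 0.

Lemma cut_left_neq0 b x : cut_left b x != 0 -> 0 < x < L.
Proof. by rewrite /cut_left; case: ifP => [_ /(supported_neq0 f0)//|_]; rewrite eqxx. Qed.

Lemma supported_cut_left b : supported b (cut_left b).
Proof.
move=> x xb; rewrite /cut_left; case: ifP => // xltb; apply: f0.
by apply: contra xb => /andP[-> _].
Qed.

Lemma cmod_cut_left b x : cmod (cut_left b x) <= cmod (f x).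
Proof. by rewrite /cut_left; case: ifP => // _; rewrite cmod0 cmod_ge0. Qed.

Lemma cmeas_cut_left b : cmeas (cut_left b).
Proof.
have [mf _] := sf; have mind : cmeas (fun x : R => real_complex R ((x < b)%R : bool)%:R).
  apply: cmeas_real; apply: measurable_natr_bool.
  by apply: measurable_fun_ltr; [exact: measurable_id|exact: measurable_cst].
apply: eq_cmeas (cmeasM mind mf) => x.
by rewrite /cut_left; case: (x < b); rewrite ?mul1r ?mul0r.
Qed.

Lemma sqint_cut_left b : sqint (cut_left b).
Proof. exact: (le_cmod_sqint_le (cmeas_cut_left b) (cmod_cut_left b) (sqint_le_sqnorm sf)).1. Qed.

Let int_cut b : cintegrable (cut_left b).
Proof. exact: le_cintegrable (cmeas_cut_left b) (rintegrable_cmod intf) (cmod_cut_left b). Qed.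

Section Window.
Variable b : R.
Hypotheses (b0 : 0 < b) (bL : b <= L).

Let u := cut_left b.
Let tail x := f x - u x.
Let I := \int[mu]_x cmod (u x).
Let front x r := cis ((p + 2 * x) * r).
Let err x r := B x r - c * front x r - E1 x r.

Let int_tail : cintegrable tail. Proof. exact: cintegrableB intf (int_cut b). Qed.

Let tail_ge x : tail x != 0 -> 0 < x < L /\ b <= x.
Proof.
rewrite /tail /u /cut_left; case: ltP => [_|bx]; rewrite ?subrr ?eqxx// subr0.
by move=> /(supported_neq0 f0).
Qed.

Let mfront : cmeas2 front.
Proof.
apply: cmeas2_cis; apply: measurable_funD; first exact: measurable_cst.
exact: mulrl_measurable.
Qed.

Let merr : cmeas2 err.
Proof.
apply: cmeas2B => //; apply: cmeas2B => //.
by apply: (@cmeas2M _ (fun _ _ => c)) => //; exact: cmeas_cst.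
Qed.

Lemma window_error : sqint_le (fun r => cint (fun x => u x * err x r)) (pi * (M * I) ^+ 2).
Proof.
apply: sqint_le_decay => [|r]; first exact: cmeas_cintM (int_cut b) merr.
rewrite mulrAC; apply: (le_cmod_cintM (int_cut b) (cmeas_section2 r merr)).
by move=> x /cut_left_neq0/lead[_ _]; exact.
Qed.

Let remainder r :=
  cint (fun x => tail x * B x r) + cint (fun x => u x * E1 x r) + J r.

Lemma window_remainder : spectral (p + 2 * b)
  (M * \int[mu]_x cmod (tail x) + M * I + MJ) remainder.
Proof.
have s_tail : spectral (p + 2 * b) (M * \int[mu]_x cmod (tail x))
  (fun r => cint (fun x => tail x * B x r)).
  apply: (spectral_cintM int_tail mB) => x /tail_ge[/lead[sB _ _] bx].
  by apply: spectral_le sB => //; rewrite lerD2l ler_wpM2l.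
have s_inner : spectral (p + 2 * b) (M * I) (fun r => cint (fun x => u x * E1 x r)).
  apply: (spectral_cintM (int_cut b) mE1) => x /cut_left_neq0/lead[_ sE _].
  by apply: spectral_le sE => //; rewrite -addrA lerD2l addrCA subrr addr0 ler_wpM2l.
have s_rest : spectral (p + 2 * b) MJ J by apply: spectral_le sJ => //; rewrite lerD2l ler_wpM2l.
exact: spectralD (spectralD s_tail s_inner) s_rest.
Qed.

Lemma window_identity r : fourier u r + c^-1 * cis (- p * r) * remainder r =
  c^-1 * cis (- p * r) * (pairing_J r - cint (fun x => u x * err x r)).
Proof.
have iM (w : R -> R[i]) F : cintegrable w -> cmeas2 F ->
    forall N, (forall x, w x != 0 -> cmod (F x r) <= N) -> cintegrable (fun x => w x * F x r).
  by move=> iw mF N; exact: cintegrableM_bounded iw (cmeas_section2 r mF).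
have BM x : 0 < x < L -> cmod (B x r) <= M by move=> /lead[/spectral_bound sB _ _]; exact: sB.
have EM x : 0 < x < L -> cmod (E1 x r) <= M by move=> /lead[_ /spectral_bound sE _]; exact: sE.
have ifB : cintegrable (fun x => f x * B x r).
  by apply: (iM _ _ intf mB M) => x /(supported_neq0 f0)/BM.
have iuB : cintegrable (fun x => u x * B x r).
  by apply: (iM _ _ (int_cut b) mB M) => x /cut_left_neq0/BM.
have iuE : cintegrable (fun x => u x * E1 x r).
  by apply: (iM _ _ (int_cut b) mE1 M) => x /cut_left_neq0/EM.
have iuF : cintegrable (fun x => u x * front x r).
  by apply: (iM _ _ (int_cut b) mfront 1) => x _; rewrite cmod_cis.
have -> : cint (fun x => u x * err x r) = cint (fun x => u x * B x r) -
    c * cint (fun x => u x * front x r) - cint (fun x => u x * E1 x r).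
  rewrite -(cintZ c iuF) -(cintB iuB (cintegrableZ c iuF)).
  rewrite -(cintB (cintegrableB iuB (cintegrableZ c iuF)) iuE).
  by apply: eq_cint => x; rewrite /err; ring.
have -> : fourier u r = cis (- p * r) * cint (fun x => u x * front x r).
  rewrite -(cintZ (cis (- p * r)) iuF); apply: eq_cint => x; rewrite mulrCA -cisD.
  by congr (_ * cis _); ring.
rewrite /remainder /pairing_J (_ : cint (fun x => tail x * B x r) =
  cint (fun x => f x * B x r) - cint (fun x => u x * B x r)); first by field.
by rewrite -(cintB ifB iuB); apply: eq_cint => x; rewrite mulrBl.
Qed.

Lemma window_estimate : pi * cmod c ^+ 2 * sqnorm u <= 2 * k + 2 * (pi * M ^+ 2 * I ^+ 2).
Proof.
pose e r := c^-1 * cis (- p * r).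
have me : cmeas e by apply: cmeasM; [exact: cmeas_cst|exact: cmeas_cisM].
have eb r : cmod (e r) <= (cmod c)^-1 by rewrite cmodM cmod_cis mulr1 cmodV.
have s_tail := spectralM (spectral_Zcis c^-1 (lexx (- p))) window_remainder;
  rewrite addKr in s_tail.
have sum_le := sqint_le_boundedM me eb (sqint_leB pairing_le window_error).
have := fourier_lower b0 (sqint_cut_left b) (@supported_cut_left b) s_tail.
move=> /(_ _ (eq_sqint_le (fun r => esym (window_identity r)) sum_le)).
by rewrite exprVn ler_pdivlMl// mulrCA mulrA exprMn [pi * (M ^+ 2 * _)]mulrA.
Qed.

End Window.

Lemma absorb_window (P C m Sb Sa K I2 l0 l1 : R) : 0 < P -> 0 < C -> 0 <= m -> 0 <= Sb ->
  P * C * Sb <= 2 * K + 2 * (P * m * I2) -> I2 <= 2 * (l0 * Sa) + 2 * (l1 * Sb) ->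
  8 * m * l1 <= C -> Sb <= 4 / (P * C) * K + 8 * m * l0 / C * Sa.
Proof.
move=> P0 C0 m0 Sb0 window I2_le small; have PC0 : 0 < P * C by rewrite mulr_gt0.
have Pm0 : 0 <= P * m by rewrite mulr_ge0// ltW.
have window' := le_trans window (lerD (lexx _) (ler_wpM2l (ler0n _ 2) (ler_wpM2l Pm0 I2_le))).
have small' : 8 * m * l1 * (P * Sb) <= C * (P * Sb) by rewrite ler_wpM2r// mulr_ge0// ltW.
have -> : 4 / (P * C) * K + 8 * m * l0 / C * Sa = (4 * K + 8 * (P * m) * l0 * Sa) / (P * C).
  by field; rewrite !gt_eqF.
by rewrite ler_pdivlMr//; nra.
Qed.

Lemma window_step a b : 0 <= a -> a < b -> b <= L -> 8 * M ^+ 2 * (b - a) <= cmod c ^+ 2 ->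
  sqnorm (cut_left b) <= 4 / (pi * cmod c ^+ 2) * k +
    8 * M ^+ 2 * L / cmod c ^+ 2 * sqnorm (cut_left a).
Proof.
move=> a0 ab bL small; have b0 := le_lt_trans a0 ab; have ab' := ltW ab.
pose v x := cut_left b x - cut_left a x.
have vE x : v x = if a <= x < b then f x else 0.
  rewrite /v /cut_left; have [xa|xa] := ltP x a; first by rewrite (lt_trans xa ab) subrr.
  by rewrite subr0.
have iv : cintegrable v by exact: cintegrableB (int_cut b) (int_cut a).
have [sv v_le] : sqint_le v (sqnorm (cut_left b)).
  apply: le_cmod_sqint_le (sqint_le_sqnorm (sqint_cut_left b)); first exact: cmeas_cintegrable.
  by move=> x; rewrite vE /cut_left; case: ifP => [/andP[_ ->]//|_]; rewrite cmod0 cmod_ge0.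
have v0 x : ~~ (a <= x < b) -> v x = 0 by move=> /negbTE xab; rewrite vE xab.
have a_le := sqr_Rintegral_cmod_supported a0 (sqint_cut_left a) (@supported_cut_left a).
have v_int_le := le_trans (sqr_Rintegral_cmod_le ab' sv v0) (ler_wpM2l (_ : 0 <= b - a) v_le).
apply: (absorb_window (pi_gt0 R) cmod_c2_gt0 (sqr_ge0 M) (sqnorm_ge0 _)
  (window_estimate b0 bL) _ small).
have split : \int[mu]_x cmod (cut_left b x) <=
    \int[mu]_x cmod (cut_left a x) + \int[mu]_x cmod (v x).
  have ia := rintegrable_cmod (int_cut a); have ivn := rintegrable_cmod iv.
  rewrite -(RintegralD measurableT ia ivn); apply: le_Rintegral => //.
  - exact: rintegrable_cmod (int_cut b).
  - exact: rintegrableD.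
  by move=> x _; rewrite -[cut_left b x](subrKC (cut_left a x)) cmodD.
have int_ge0 (w : R -> R[i]) : 0 <= \int[mu]_x cmod (w x).
  by apply: Rintegral_ge0 => x _; exact: cmod_ge0.
have {}a_le : (\int[mu]_x cmod (cut_left a x)) ^+ 2 <= L * sqnorm (cut_left a).
  by apply: le_trans a_le _; rewrite ler_wpM2r ?sqnorm_ge0// (le_trans ab').
rewrite subr_ge0 in v_int_le; have {}v_int_le := v_int_le ab'.
apply: (@le_trans _ _ ((\int[mu]_x cmod (cut_left a x) + \int[mu]_x cmod (v x)) ^+ 2)).
  by rewrite ler_sqr ?nnegrE ?addr_ge0 ?int_ge0.
apply: le_trans (lerD (ler_wpM2l (ler0n _ 2) a_le) (ler_wpM2l (ler0n _ 2) v_int_le)).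
by rewrite -subr_ge0 (_ : _ - _ = (\int[mu]_x cmod (cut_left a x) - \int[mu]_x cmod (v x)) ^+ 2)
  ?sqr_ge0//; ring.
Qed.

Definition window_const n : R :=
  iter n (fun K => 4 / (pi * cmod c ^+ 2) + 8 * M ^+ 2 * L / cmod c ^+ 2 * K) 0.

Lemma window_iter n : 8 * M ^+ 2 * (L / n.+1%:R) <= cmod c ^+ 2 ->
  sqnorm f <= window_const n.+1 * k.
Proof.
move=> small; pose b i : R := i%:R * (L / n.+1%:R).
have step0 : 0 < L / n.+1%:R by rewrite divr_gt0.
have b_ge0 i : 0 <= b i by rewrite mulr_ge0// ltW.
have b_last : b n.+1 = L by rewrite /b mulrCA divff ?mulr1// pnatr_eq0.
have b_le i : (i <= n.+1)%N -> b i <= L.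
  by move=> i_n; rewrite -b_last /b ler_wpM2r ?ler_nat// ltW.
have bS i : b i.+1 - b i = L / n.+1%:R by rewrite /b -natr1 mulrDl mul1r addrAC subrr add0r.
have cut_le i : (i <= n.+1)%N -> sqnorm (cut_left (b i)) <= window_const i * k.
  elim: i => [_|i IH i_n].
    rewrite /window_const /= mul0r (_ : cut_left (b 0) = fun=> 0) ?(sqint_le0 R).2//.
    apply/funext => x; apply: supported_cut_left; rewrite /b mul0r.
    by apply/negP => /andP[x0 x0']; have := lt_trans x0 x0'; rewrite ltxx.
  have bb : b i < b i.+1 by rewrite -subr_gt0 bS.
  have small_i : 8 * M ^+ 2 * (b i.+1 - b i) <= cmod c ^+ 2 by rewrite bS.
  apply: le_trans (window_step (b_ge0 i) bb (b_le _ i_n) small_i) _.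
  rewrite [leRHS]mulrDl lerD2l -[leRHS]mulrA; apply: ler_wpM2l; last exact/IH/ltnW.
  by rewrite divr_ge0 ?sqr_ge0// mulr_ge0 ?(ltW L0)// mulr_ge0 ?sqr_ge0.
have := cut_le n.+1 (leqnn _); rewrite b_last (_ : cut_left L = f)//.
apply/funext => x; rewrite /cut_left; case: ltP => // Lx; apply/esym/f0.
by rewrite negb_and -!leNgt Lx orbT.
Qed.

End Pairing.

(* A window of length l multiplies the constant by a bounded factor once M^2 l is small compared
   to |c|^2, so finitely many steps exhaust (0, L). *)
Theorem wavefront_recovery : exists2 K, 0 <= K & recovers K.
Proof.
pose A := 8 * M ^+ 2 * L / cmod c ^+ 2.
have A0 : 0 <= A by rewrite divr_ge0 ?sqr_ge0// mulr_ge0 ?(ltW L0)// mulr_ge0 ?sqr_ge0.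
pose n := Num.bound A.
have small : 8 * M ^+ 2 * (L / n.+1%:R) <= cmod c ^+ 2.
  rewrite mulrA ler_pdivrMr// [leRHS]mulrC -ler_pdivrMr//.
  by rewrite (le_trans (ltW (archi_boundP A0)))// ler_nat.
exists (window_const n.+1).
  rewrite /window_const; elim: n.+1 => //= i IH.
  apply: addr_ge0; last exact: mulr_ge0.
  by rewrite divr_ge0// ltW// mulr_gt0// pi_gt0.
move=> f B J p MJ k sf f0 [mB _ [E1 [mE1 lead]]] sJ le_k.
exact: window_iter sf f0 mB mE1 lead sJ le_k n small.
Qed.

End Recovery.

(** * Pairings with products of plane waves *)

Section PlaneWaves.
Variable R : realType.
Local Notation mu := (@lebesgue_measure R).
Implicit Types (A B : R -> R[i]) (y : R -> R -> R[i]) (L M : R).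

Definition plane_waves A B (x r : R) : R[i] := A r * cis (x * r) + B r * cis (- x * r).

Definition asymptotic_waves L M A B y := [/\ cmeas A, cmeas B, cmeas2 y,
  (forall r, cmod (A r) <= M /\ cmod (B r) <= M) &
  forall x r, 0 < x < L -> cmod (y x r - plane_waves A B x r) <= M * decay r].

Lemma cmeas2_plane_waves A B : cmeas A -> cmeas B -> cmeas2 (plane_waves A B).
Proof.
move=> mA mB; apply: cmeas2D; apply: cmeas2M; try exact: cmeas2_snd.
- by apply: (@cmeas2_cis _ id); exact: measurable_id.
- by apply: (@cmeas2_cis _ (fun x => - x)); exact: oppr_measurable.
Qed.

Lemma plane_waves_le L M A B y x r : asymptotic_waves L M A B y ->
  cmod (plane_waves A B x r) <= 2 * M.
Proof.
case=> _ _ _ /(_ r)[AM BM] _; apply: le_trans (cmodD _ _) _.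
by rewrite !cmodM !cmod_cis !mulr1 mulr2n mulrDl mul1r lerD.
Qed.

Lemma asymptotic_waves_le L M A B y x r : asymptotic_waves L M A B y -> 0 < x < L ->
  cmod (y x r) <= 3 * M.
Proof.
move=> wy xL; have [_ _ _ /(_ r)[AM _] /(_ x r xL) err] := wy.
have M0 := le_trans (cmod_ge0 _) AM.
rewrite -[y x r](subrK (plane_waves A B x r)) (_ : 3 * M = M + 2 * M); last by ring.
apply: le_trans (cmodD _ _) (lerD (le_trans err _) (plane_waves_le x r wy)).
by rewrite ler_piMr ?decay_le1.
Qed.

Lemma asymptotic_wavesM_error L M A B y A' B' y' x r :
  asymptotic_waves L M A B y -> asymptotic_waves L M A' B' y' -> 0 < x < L ->
  cmod (y x r * y' x r - plane_waves A B x r * plane_waves A' B' x r) <= 5 * M ^+ 2 * decay r.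
Proof.
move=> wy wy' xL; have [_ _ _ _ /(_ x r xL) err] := wy; have [_ _ _ _ /(_ x r xL) err'] := wy'.
rewrite [X in cmod X](_ : _ = (y x r - plane_waves A B x r) * y' x r +
  plane_waves A B x r * (y' x r - plane_waves A' B' x r)); last by ring.
have -> : 5 * M ^+ 2 * decay r = M * decay r * (3 * M) + 2 * M * (M * decay r) by ring.
apply: le_trans (cmodD _ _) _; rewrite !cmodM.
apply: lerD; apply: ler_pM; rewrite ?cmod_ge0//; first exact: asymptotic_waves_le wy' xL.
exact: plane_waves_le wy.
Qed.

Lemma plane_wavesM A B A' B' x r :
  plane_waves A B x r * plane_waves A' B' x r = A r * A' r * cis (2 * x * r) +
  B r * B' r * cis (- 2 * x * r) + (A r * B' r + B r * A' r).
Proof.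
have -> : cis (2 * x * r) = cis (x * r) * cis (x * r) by rewrite -cisD; congr cis; ring.
have -> : cis (- 2 * x * r) = cis (- x * r) * cis (- x * r) by rewrite -cisD; congr cis; ring.
have ee : cis (x * r) * cis (- x * r) = 1 by rewrite -cisD mulNr subrr cis0.
rewrite -[X in _ = _ + X]mulr1 -ee /plane_waves; ring.
Qed.

Definition wave_pairing_const L M : R := M ^+ 4 * (8 * pi + 50 * pi * L).

Lemma wave_pairing_const_ge0 L M : 0 <= L -> 0 <= wave_pairing_const L M.
Proof. by move=> L0; rewrite mulr_ge0 ?exprn_even_ge0// addr_ge0// !mulr_ge0 ?pi_ge0. Qed.

Section Pairing.
Variables (L M c : R) (f A B A' B' : R -> R[i]) (y y' : R -> R -> R[i]).
Hypotheses (L0 : 0 <= L) (fc : sqint_le f c) (f0 : supported L f) (mean0 : cint f = 0).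
Hypotheses (wy : asymptotic_waves L M A B y) (wy' : asymptotic_waves L M A' B' y').

Let intf : cintegrable f. Proof. exact: supported_cintegrable L0 fc.1 f0. Qed.

Let mean_abs := \int[mu]_x cmod (f x).
Let error x r := y x r * y' x r - plane_waves A B x r * plane_waves A' B' x r.

Let cmeas2_error : cmeas2 error.
Proof.
have [mA mB my _ _] := wy; have [mA' mB' my' _ _] := wy'.
by apply: cmeas2B; apply: cmeas2M => //; exact: cmeas2_plane_waves.
Qed.

Let error_le r x : f x != 0 -> cmod (error x r) <= 5 * M ^+ 2 * decay r.
Proof. by move=> /(supported_neq0 f0); exact: asymptotic_wavesM_error. Qed.

Lemma pairing_error_sqint_le :
  sqint_le (fun r => cint (fun x => f x * error x r)) (pi * (5 * M ^+ 2 * mean_abs) ^+ 2).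
Proof.
apply: sqint_le_decay => [|r]; first exact: cmeas_cintM intf cmeas2_error.
by rewrite mulrAC; apply: (le_cmod_cintM intf (cmeas_section2 r cmeas2_error)); exact: error_le.
Qed.

Lemma pairing_waves_sqint_le g h C D : cmeas C -> cmeas D ->
  (forall r, cmod (C r) <= M) -> (forall r, cmod (D r) <= M) -> sqint_le g h ->
  sqint_le (fun r => C r * D r * g r) ((M ^+ 2) ^+ 2 * h).
Proof.
move=> mC mD CM DM; apply: sqint_le_boundedM => [|r]; first exact: cmeasM.
by rewrite cmodM expr2 ler_pM ?cmod_ge0.
Qed.

Lemma pairing_waves_eq r : cint (fun x => f x * (y x r * y' x r)) =
  A r * A' r * fourier f r + B r * B' r * cint (fun x => f x * cis (- 2 * x * r)) +
  cint (fun x => f x * error x r).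
Proof.
have int_plus := cintegrableZ (A r * A' r) (cintegrable_cis_kernel 2 r intf).
have int_minus := cintegrableZ (B r * B' r) (cintegrable_cis_kernel (- 2) r intf).
have int_cross := cintegrableZ (A r * B' r + B r * A' r) intf.
have int_error := cintegrableM_bounded intf (cmeas_section2 r cmeas2_error) (error_le r).
transitivity (A r * A' r * fourier f r + B r * B' r * cint (fun x => f x * cis (- 2 * x * r)) +
  cint (fun x => f x * error x r) + (A r * B' r + B r * A' r) * cint f); last first.
  by rewrite mean0 mulr0 addr0.
rewrite -(cintZ _ (cintegrable_cis_kernel 2 r intf))
  -(cintZ _ (cintegrable_cis_kernel (- 2) r intf)).
rewrite -(cintZ _ intf) -(cintD int_plus int_minus)
  -(cintD (cintegrableD int_plus int_minus) int_error).
rewrite -(cintD (cintegrableD (cintegrableD int_plus int_minus) int_error) int_cross).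
by apply: eq_cint => x; rewrite /error plane_wavesM; ring.
Qed.

(* The product of the plane waves is oscillating up to a factor constant in x, which the vanishing
   mean of f annihilates. *)
Theorem wave_pairing_upper : sqint_le (fun r => cint (fun x => f x * (y x r * y' x r)))
  (wave_pairing_const L M * c).
Proof.
have [mA mB _ AB _] := wy; have [mA' mB' _ AB' _] := wy'.
have plus_le := pairing_waves_sqint_le mA mA' (fun r => (AB r).1) (fun r => (AB' r).1)
  (fourier_upper intf fc).
have minus_le := pairing_waves_sqint_le mB mB' (fun r => (AB r).2) (fun r => (AB' r).2)
  (fourierN_upper intf fc).
have all_le := sqint_leD (sqint_leD plus_le minus_le) pairing_error_sqint_le.
apply: eq_sqint_le (fun r => esym (pairing_waves_eq r)) (le_sqint_le _ all_le).
have mean_abs_le : mean_abs ^+ 2 <= L * c.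
  exact: le_trans (sqr_Rintegral_cmod_supported L0 fc.1 f0) (ler_wpM2l L0 fc.2).
have := ler_wpM2l (mulr_ge0 (ltW (pi_gt0 R)) (sqr_ge0 (M ^+ 2))) mean_abs_le.
rewrite [X in X <= _ -> _](_ : _ = pi * (M ^+ 2 * mean_abs) ^+ 2); last by ring.
rewrite /wave_pairing_const -!mulrA exprMn; move: (pi : R) => P; nra.
Qed.

End Pairing.
End PlaneWaves.

(** * Sturm-Liouville solutions *)

Section SineQuotient.
Variable R : realType.
Local Notation mu := (@lebesgue_measure R).
Local Notation rc := (real_complex R).
Implicit Types u r x : R.

(* The solution of [- y'' = r ^+ 2 * y], [y 0 = 0], [y' 0 = 1]. *)
Definition sindiv u r : R := if r == 0 then u else sin (r * u) / r.

Lemma mulr_sindiv u r : r * sindiv u r = sin (r * u).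
Proof.
rewrite /sindiv; case: eqP => [->|/eqP r0]; first by rewrite !mul0r sin0.
by rewrite mulrC mulfVK.
Qed.

Lemma sindiv0 r : sindiv 0 r = 0.
Proof. by rewrite /sindiv mulr0 sin0 mul0r; case: ifP. Qed.

Lemma sindivN u r : sindiv (- u) r = - sindiv u r.
Proof. by rewrite /sindiv mulrN sinN mulNr; case: ifP. Qed.

Lemma is_derive_sindiv r x : is_derive x (1 : R) (sindiv^~ r) (cos (r * x)).
Proof.
have [->|r0] := eqVneq r 0.
  rewrite mul0r cos0; apply: eq_is_derive (is_derive_id x (1 : R)) => // t.
  by rewrite /sindiv eqxx.
apply: eq_is_derive (is_deriveZ r^-1 (is_derive_sin_mull r x)) => [t|].
  by rewrite /sindiv (negbTE r0) mulrC.
by rewrite /GRing.scale/= mulrA mulVf// mul1r.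
Qed.

Lemma is_derive_cos_sindiv r x : is_derive x (1 : R) (fun x => cos (r * x)) (- r ^+ 2 * sindiv x r).
Proof.
apply: eq_is_derive (is_derive_cos_mull r x) => //.
by rewrite expr2 -mulNr -mulrA mulr_sindiv.
Qed.

Lemma sindiv_integral u r : sindiv u r = \int[mu]_x (\1_`]0, 1[ x * (u * cos (r * u * x))).
Proof.
have deriv x : is_derive x (1 : R) (fun x => sindiv (u * x) r) (u * cos (r * u * x)).
  by rewrite -mulrA; exact: is_derive_comp_mull (is_derive_sindiv r (u * x)).
rewrite Rintegral_indicM (Rintegral_ftc ler01 deriv) ?mulr1 ?mulr0 ?sindiv0 ?subr0//.
by move=> x; apply: continuousM; [exact: cst_continuous|exact: continuous_cos_mull].
Qed.

Lemma norm_cos_le1 x : `|cos x| <= 1.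
Proof. by rewrite ler_norml cos_geN1 cos_le1. Qed.

Lemma norm_sin_le1 x : `|sin x| <= 1.
Proof. by rewrite ler_norml sin_geN1 sin_le1. Qed.

Lemma measurable_cos_comp d (T : measurableType d) (f : T -> R) :
  measurable_fun setT f -> measurable_fun setT (fun z => cos (f z)).
Proof. exact: (measurableT_comp (continuous_measurable_fun (@continuous_cos R))). Qed.

Lemma measurable_sindiv d (T : measurableType d) (f g : T -> R) :
  measurable_fun setT f -> measurable_fun setT g ->
  measurable_fun setT (fun z => sindiv (f z) (g z)).
Proof.
move=> mf mg.
have -> : (fun z => sindiv (f z) (g z)) =
    fun z => \int[mu]_x (\1_`]0, 1[ x * (f z * cos (g z * f z * x))).
  by apply/funext => z; exact: sindiv_integral.
apply: (@measurable_Rintegral R _ T (fun x z => \1_`]0, 1[ x * (f z * cos (g z * f z * x)))).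
have mf2 : measurable_fun setT (fun p : R * T => f p.2) by apply: measurableT_comp.
have mg2 : measurable_fun setT (fun p : R * T => g p.2) by apply: measurableT_comp.
apply: measurable_funM.
  by apply: (measurableT_comp (measurable_indic (measurable_itv _))); exact: measurable_fst.
apply: measurable_funM => //; apply: measurable_cos_comp.
by apply: measurable_funM; [exact: measurable_funM|exact: measurable_fst].
Qed.

Lemma cmeas2_sin : cmeas2 (fun x r => rc (sin (r * x))).
Proof.
apply: cmeas_real; apply: (measurableT_comp (continuous_measurable_fun (@continuous_sin R))).
by apply: measurable_funM; [exact: measurable_snd|exact: measurable_fst].
Qed.

Lemma cmeas2_cos : cmeas2 (fun x r => rc (cos (r * x))).
Proof.
apply: cmeas_real; apply: measurable_cos_comp.
by apply: measurable_funM; [exact: measurable_snd|exact: measurable_fst].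
Qed.

Lemma cmeas2_sindiv : cmeas2 (fun x r => rc (sindiv x r)).
Proof. by apply: cmeas_real; apply: measurable_sindiv;
  [exact: measurable_fst|exact: measurable_snd]. Qed.

Lemma spectral_cos u : spectral (- `|u|) 1 (fun r => rc (cos (r * u))).
Proof.
have u_ge : - `|u| <= u by rewrite lerNl (le_trans (ler_norm _))// normrN.
have u_le : - `|u| <= - u by rewrite lerN2 ler_norm.
have := spectralD (spectral_Zcis (rc 2^-1) u_le) (spectral_Zcis (rc 2^-1) u_ge).
rewrite cmod_real [`|2^-1|]ger0_norm ?invr_ge0// (_ : 2^-1 + 2^-1 = 1 :> R); last by field.
by apply: eq_spectral => r; rewrite cos_cis mulNr (mulrC u).
Qed.

Lemma spectral_sin u : spectral (- `|u|) 1 (fun r => rc (sin (r * u))).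
Proof.
have u_ge : - `|u| <= u by rewrite lerNl (le_trans (ler_norm _))// normrN.
have u_le : - `|u| <= - u by rewrite lerN2 ler_norm.
have := spectralB (spectral_Zcis (half_i R) u_le) (spectral_Zcis (half_i R) u_ge).
rewrite cmod_half_i (_ : 2^-1 + 2^-1 = 1 :> R); last by field.
by apply: eq_spectral => r; rewrite sin_cis mulNr (mulrC u).
Qed.

Lemma spectral_sindiv u : spectral (- `|u|) `|u| (fun r => rc (sindiv u r)).
Proof.
pose w (x : R) : R[i] := rc (\1_`]0, 1[ x).
have mu01 : mu `]0, 1[ = 1%:E by rewrite lebesgue_measure_itv/= lte_fin ltr01 sube0.
have iw : cintegrable w.
  split; last exact: rintegrable0.
  by apply: rintegrable_indic => //; apply: (le_lt_trans _ (ltry (1 : R))); rewrite mu01.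
have mE : cmeas2 (fun x r => rc (u * cos (r * u * x))).
  apply: cmeas_real; apply: measurable_funM; first exact: measurable_cst.
  apply: measurable_cos_comp; apply: measurable_funM; last exact: measurable_fst.
  by apply: measurable_funM; [exact: measurable_snd|exact: measurable_cst].
have sE x : w x != 0 -> spectral (- `|u|) `|u| (fun r => rc (u * cos (r * u * x))).
  rewrite /w indicE mem_setE in_itv; case: (boolP (0 < x < 1)) => [/andP[x0 x1] _|_];
    last by rewrite eqxx.
  have := spectralZ (rc u) (spectral_cos (u * x)); rewrite cmod_real mulr1 => s.
  apply: eq_spectral (spectral_le _ (lexx _) s) => [r|]; first by rewrite mulrA rmorphM.
  by rewrite lerN2 normrM ler_piMr// ger0_norm; lra.
have := spectral_cintM iw mE sE.
have -> : \int[mu]_x cmod (w x) = 1.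
  rewrite -[RHS](_ : fine (mu `]0, 1[) = 1); last by rewrite mu01.
  by rewrite -Rintegral_indic//; apply: eq_Rintegral => x _; rewrite cmod_real ger0_norm.
rewrite mulr1; apply: eq_spectral => r; rewrite sindiv_integral; apply: complex_ext => /=.
  by apply: eq_Rintegral => x _; rewrite mul0r subr0.
by rewrite (_ : (fun x : R => _) = fun=> 0) ?Rintegral_cst ?mul0r//; apply/funext => x;
  rewrite mulr0 mul0r addr0.
Qed.

End SineQuotient.

Section EdgeMask.
Variables (R : realType) (L : R).

Lemma itvoo_cc (x : R) : 0 < x < L -> 0 <= x <= L.
Proof. by case/andP => /ltW -> /ltW ->. Qed.

Definition edge_mask (x : R) : R[i] := real_complex R ((0 <= x <= L)%R : bool)%:R.

Lemma edge_mask1 x : 0 <= x <= L -> edge_mask x = 1. Proof. by rewrite /edge_mask => ->. Qed.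

Lemma edge_mask0 x : ~~ (0 <= x <= L) -> edge_mask x = 0.
Proof. by rewrite /edge_mask => /negbTE ->. Qed.

Lemma cmeas_edge_mask : cmeas edge_mask.
Proof.
apply: cmeas_real; apply: measurable_natr_bool.
by apply: measurable_and; apply: measurable_fun_ler.
Qed.

End EdgeMask.

Section Volterra.
Variable R : realType.
Local Notation mu := (@lebesgue_measure R).
Local Notation rc := (real_complex R).
Variables (L kappa : R) (d : R -> R) (Q : R -> R[i]).
Hypotheses (L0 : 0 <= L) (kappa0 : 0 <= kappa).
Hypotheses (md : measurable_fun setT d) (d_itv : forall x, 0 <= x <= L -> 0 <= d x <= L).
Hypotheses (iQ : cintegrable Q) (Q0 : supported L Q).

Definition volterra (z : R -> R -> R[i]) (x r : R) : R[i] :=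
  cint (fun t => Q t * (rc (((d t < d x)%R : bool)%:R * sindiv (d x - d t) r) * z t r)).

Definition volterra_weight (x : R) : R := expR (kappa * d x).

Definition volterra_kernel (x t : R) : R[i] :=
  rc (((d t < d x)%R : bool)%:R * volterra_weight t) * Q t.

Definition weighted_sindiv (x t r : R) : R[i] := rc ((volterra_weight t)^-1 * sindiv (d x - d t) r).

Hypothesis volterra_kernel_contraction : forall x, 0 <= x <= L ->
  (1 + L) * \int[mu]_t cmod (volterra_kernel x t) <= 2^-1 * volterra_weight x.

Local Notation weight := volterra_weight.

Let weight_gt0 x : 0 < weight x. Proof. exact: expR_gt0. Qed.

Let weight_ge1 x : 0 <= x <= L -> 1 <= weight x.
Proof. by move=> /d_itv/andP[dx0 _]; rewrite -expR0 ler_expR mulr_ge0. Qed.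

Let weight_le x : 0 <= x <= L -> weight x <= expR (kappa * L).
Proof. by move=> /d_itv/andP[_ dxL]; rewrite ler_expR ler_wpM2l. Qed.

Let measurable_weight : measurable_fun setT weight.
Proof.
apply: (measurableT_comp (@measurable_expR R)).
by apply: measurable_funM => //; exact: measurable_cst.
Qed.

Lemma volterraE z x r :
  volterra z x r = cint (fun t => volterra_kernel x t * (weighted_sindiv x t r * z t r)).
Proof.
apply: eq_cint => t; rewrite /volterra_kernel /weighted_sindiv mulrA [_ * Q t]mulrC -!mulrA.
congr (_ * _); rewrite !mulrA -!rmorphM; congr (rc _ * _).
by rewrite mulrA -[X in _ = X * _]mulrA divff ?mulr1// gt_eqF.
Qed.

Lemma volterra_kernel_neq0 x t : 0 <= x <= L -> volterra_kernel x t != 0 ->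
  0 < t < L /\ 0 < d x - d t <= L.
Proof.
move=> xL; rewrite /volterra_kernel; have [tL|/Q0 ->] := boolP (0 < t < L);
  last by rewrite mulr0 eqxx.
case: ltP => [dtx _|_]; last by rewrite mul0r rmorph0 mul0r eqxx.
have /andP[dt0 _] := d_itv (itvoo_cc tL); have /andP[_ dxL] := d_itv xL.
by rewrite subr_gt0 dtx lerBlDr (le_trans dxL)// lerDl.
Qed.

Lemma cmeas2_volterra_kernel : cmeas2 volterra_kernel.
Proof.
have md1 : measurable_fun setT (fun p : R * R => d p.1) by exact: measurableT_comp.
have md2 : measurable_fun setT (fun p : R * R => d p.2) by exact: measurableT_comp.
apply: cmeasM; last exact: (cmeas2_snd (cmeas_cintegrable iQ)).
apply: cmeas_real; apply: measurable_funM; last exact: measurableT_comp measurable_weight _.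
by apply: measurable_natr_bool; exact: measurable_fun_ltr.
Qed.

Lemma cintegrable_volterra_kernel x : cintegrable (volterra_kernel x).
Proof.
apply: (le_cintegrable _ (rintegrableZ (expR (kappa * L)) (rintegrable_cmod iQ))).
  exact: (cmeas_section1 x cmeas2_volterra_kernel).
move=> t; rewrite cmodM cmod_real; have [tL|/Q0 ->] := boolP (0 < t < L); last first.
  by rewrite cmod0 !mulr0.
apply: ler_wpM2r; first exact: cmod_ge0.
rewrite normrM (gtr0_norm (weight_gt0 t)); apply: le_trans (weight_le (itvoo_cc tL)).
by apply: ler_piMl; [exact: ltW|case: (_ < _)%R; rewrite ?normr1 ?normr0].
Qed.

Lemma spectral_weighted_sindiv x t : 0 < d x - d t <= L ->
  spectral (- (d x - d t)) ((weight t)^-1 * L) (weighted_sindiv x t).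
Proof.
move=> /andP[dxt dxtL]; have := spectralZ (rc (weight t)^-1) (spectral_sindiv (d x - d t)).
have winv0 : 0 <= (weight t)^-1 by rewrite invr_ge0 ltW.
rewrite (gtr0_norm dxt) cmod_real ger0_norm// => s.
apply: eq_spectral (spectral_le (lexx _) (ler_wpM2l winv0 dxtL) s) => r.
by rewrite /weighted_sindiv rmorphM.
Qed.

Lemma cmeas_weighted_sindiv :
  cmeas (fun p : R * (R * R) => weighted_sindiv p.2.1 p.1 p.2.2).
Proof.
have md1 : measurable_fun setT (fun p : R * (R * R) => d p.1) by exact: measurableT_comp.
have mfst : measurable_fun setT (fun p : R * (R * R) => p.2.1) by exact: measurableT_comp.
have msnd : measurable_fun setT (fun p : R * (R * R) => p.2.2) by exact: measurableT_comp.
have mdfst : measurable_fun setT (fun p : R * (R * R) => d p.2.1).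
  exact: (measurableT_comp md mfst).
apply: cmeas_real; apply: measurable_funM; last by apply: measurable_sindiv => //;
  exact: measurable_funB.
under eq_fun do rewrite /weight -expRN.
apply: (measurableT_comp (@measurable_expR R)); apply: measurableT_comp => //.
by apply: measurable_funM => //; exact: measurable_cst.
Qed.

Lemma cmeas2_weighted_sindiv x : cmeas2 (weighted_sindiv x).
Proof.
apply: (cmeas_comp (h := fun p : R * R => (p.1, (x, p.2))) _ cmeas_weighted_sindiv).
by apply: measurable_fun_pair => //; exact: measurable_fun_pair.
Qed.

Lemma cmeas2_volterra z : cmeas2 z -> cmeas2 (volterra z).
Proof.
move=> mz; have m_int : cmeas (fun p : R * R =>
    cint (fun t => volterra_kernel p.1 t * (weighted_sindiv p.1 t p.2 * z t p.2))).
  apply: (@cmeas_cint R _ (R * R)%type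
    (fun t p => volterra_kernel p.1 t * (weighted_sindiv p.1 t p.2 * z t p.2))).
  apply: cmeasM.
    apply: (cmeas_comp (h := fun p : R * (R * R) => (p.2.1, p.1)) _ cmeas2_volterra_kernel).
    by apply: measurable_fun_pair => //; exact: measurableT_comp.
  apply: cmeasM; first exact: cmeas_weighted_sindiv.
  apply: (cmeas_comp (h := fun p : R * (R * R) => (p.1, p.2.2)) _ mz).
  by apply: measurable_fun_pair => //; exact: measurableT_comp.
by apply: eq_cmeas m_int => p; rewrite volterraE.
Qed.

Lemma spectral_volterra a K z : 0 <= K -> cmeas2 z ->
  (forall t, 0 < t < L -> spectral (a - d t) (K * weight t) (z t)) ->
  forall x, 0 <= x <= L -> spectral (a - d x) (K * (2^-1 * weight x)) (volterra z x).
Proof.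
move=> K0 mz sz x xL.
have sE t : volterra_kernel x t != 0 ->
    spectral (a - d x) (K * (1 + L)) (fun r => weighted_sindiv x t r * z t r).
  move=> /(volterra_kernel_neq0 xL)[tL dxt].
  apply: (spectral_le _ _ (spectralM (spectral_weighted_sindiv dxt) (sz t tL))).
    by rewrite (_ : - (d x - d t) + (a - d t) = a - d x)//; ring.
  have -> : (weight t)^-1 * L * (K * weight t) = K * L by field; rewrite gt_eqF.
  by rewrite ler_wpM2l// lerDr.
have mE := cmeas2M (cmeas2_weighted_sindiv x) mz.
apply: eq_spectral (spectral_le (lexx _) _
  (spectral_cintM (cintegrable_volterra_kernel x) mE sE)) => [r|].
  by rewrite volterraE.
by rewrite -mulrA; apply: ler_wpM2l => //; exact: volterra_kernel_contraction.
Qed.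

Section Bounded.
Variables (K r : R) (z : R -> R -> R[i]).
Hypotheses (K0 : 0 <= K) (mz : cmeas (z^~ r)).
Hypothesis z_le : forall t, 0 < t < L -> cmod (z t r) <= K * weight t.

Let cmeas_factor x : cmeas (fun t => weighted_sindiv x t r * z t r).
Proof. exact: cmeasM (cmeas_section2 r (cmeas2_weighted_sindiv x)) mz. Qed.

Let weighted_sindivM_le x t : 0 <= x <= L -> volterra_kernel x t != 0 ->
  cmod (weighted_sindiv x t r * z t r) <= K * (1 + L).
Proof.
move=> xL /(volterra_kernel_neq0 xL)[tL dxt].
have sn_le := spectral_bound (spectral_weighted_sindiv dxt) r.
rewrite cmodM; apply: le_trans (ler_pM (cmod_ge0 _) (cmod_ge0 _) sn_le (z_le tL)) _.
have -> : (weight t)^-1 * L * (K * weight t) = K * L by field; rewrite gt_eqF.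
by rewrite ler_wpM2l// lerDr.
Qed.

Lemma cintegrable_volterra x : 0 <= x <= L ->
  cintegrable (fun t => volterra_kernel x t * (weighted_sindiv x t r * z t r)).
Proof.
move=> xL; apply: (cintegrableM_bounded (cintegrable_volterra_kernel x) (cmeas_factor x)).
by move=> t; exact: weighted_sindivM_le.
Qed.

Lemma le_volterra x : 0 <= x <= L -> cmod (volterra z x r) <= K * (2^-1 * weight x).
Proof.
move=> xL; rewrite volterraE.
apply: le_trans (le_cmod_cintM (cintegrable_volterra_kernel x) (cmeas_factor x) _) _.
  by move=> t; exact: weighted_sindivM_le.
by rewrite -mulrA; apply: ler_wpM2l => //; exact: volterra_kernel_contraction.
Qed.

Lemma le_mulr_volterra x : 0 <= x <= L -> `|r| * cmod (volterra z x r) <= K * (2^-1 * weight x).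
Proof.
move=> xL; have -> : `|r| * cmod (volterra z x r) = cmod (rc r * volterra z x r).
  by rewrite cmodM cmod_real.
rewrite volterraE -cintZ; last exact: cintegrable_volterra.
under eq_cint do rewrite mulrCA.
apply: le_trans (le_cmod_cintM (M := K) (cintegrable_volterra_kernel x) _ _) _.
- exact: cmeasM (cmeas_cst _ _) (cmeas_factor x).
- move=> t /(volterra_kernel_neq0 xL)[tL _];
  rewrite mulrA /weighted_sindiv -rmorphM cmodM cmod_real.
  rewrite mulrCA normrM mulr_sindiv normfV (gtr0_norm (weight_gt0 t)).
  rewrite -mulrA ler_pdivrMl//; rewrite -[leRHS]mul1r [weight t * K]mulrC.
  by apply: ler_pM; rewrite ?cmod_ge0 ?norm_sin_le1 ?z_le.
- apply: ler_wpM2l => //; apply: le_trans (volterra_kernel_contraction xL).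
  by rewrite ler_peMl ?lerDl// Rintegral_ge0// => t _; exact: cmod_ge0.
Qed.

Lemma decay_volterra x : 0 <= x <= L -> cmod (volterra z x r) <= K * expR (kappa * L) * decay r.
Proof.
move=> xL; have -> : K * expR (kappa * L) =
    K * (2^-1 * expR (kappa * L)) + K * (2^-1 * expR (kappa * L)).
  by field.
have weight_half : K * (2^-1 * weight x) <= K * (2^-1 * expR (kappa * L)).
  by apply: ler_wpM2l => //; apply: ler_wpM2l; rewrite ?invr_ge0 ?weight_le.
apply: le_decay; first exact: cmod_ge0.
- exact: le_trans (le_volterra xL) weight_half.
- exact: le_trans (le_mulr_volterra xL) weight_half.
Qed.

End Bounded.

Lemma volterraB z z' x r K K' : 0 <= K -> 0 <= K' -> cmeas (z^~ r) -> cmeas (z'^~ r) ->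
  0 <= x <= L ->
  (forall t, 0 < t < L -> cmod (z t r) <= K * weight t) ->
  (forall t, 0 < t < L -> cmod (z' t r) <= K' * weight t) ->
  volterra z x r - volterra z' x r = volterra (fun t r => z t r - z' t r) x r.
Proof.
move=> K0 K'0 mz mz' xL z_le z'_le; rewrite !volterraE -cintB; last 2 first.
- exact: cintegrable_volterra z_le _ xL.
- exact: cintegrable_volterra z'_le _ xL.
by apply: eq_cint => t; rewrite -!mulrBr.
Qed.

Section Equation.
Variables (a M : R) (y0 y : R -> R -> R[i]).
Hypotheses (my0 : cmeas2 y0) (sy0 : forall x, 0 <= x <= L -> spectral (a - d x) M (y0 x)).
Hypothesis yE : forall x r, 0 <= x <= L -> y x r = y0 x r + volterra y x r.
Hypothesis y_out : forall x r, ~~ (0 <= x <= L) -> y x r = 0.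
Hypothesis my : forall r, cmeas (y^~ r).
Hypothesis y_bounded : forall r, exists B, forall x, cmod (y x r) <= B.

Definition picard := fix picard n (x r : R) : R[i] :=
  if n is n'.+1 then edge_mask L x * (y0 x r + volterra (picard n') x r) else 0.

Let M0 : 0 <= 2 * M.
Proof. by rewrite mulr_ge0//; apply: spectral_ge0 (sy0 (x := 0) _); rewrite lexx. Qed.

Let half_powers_null : (2^-1 : R) ^+ n @[n --> \oo] --> 0.
Proof. by apply: cvg_expr; rewrite ger0_norm ?invr_ge0// invf_lt1// ltr1n. Qed.

Lemma cmeas2_picard n : cmeas2 (picard n).
Proof.
elim: n => [|n IH] /=; first exact: cmeas_cst.
apply: cmeas2M; last by apply: cmeas2D => //; exact: cmeas2_volterra.
exact: cmeas2_fst (cmeas_edge_mask L).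
Qed.

Lemma spectral_picard n x : 0 <= x <= L -> spectral (a - d x) (2 * M * weight x) (picard n x).
Proof.
elim: n x => [|n IH] x xL /=.
  by apply: (spectral_le (lexx _) _ (spectral0 (a - d x))); rewrite mulr_ge0// ltW.
have sV := spectral_volterra M0 (cmeas2_picard n) (fun t tL => IH t (itvoo_cc tL)) xL.
apply: eq_spectral (spectral_le (lexx _) _ (spectralD (sy0 xL) sV)) => [r|].
  by rewrite edge_mask1// mul1r.
rewrite (_ : 2 * M * weight x = M * weight x + 2 * M * (2^-1 * weight x)); last by field.
by rewrite lerD2r ler_peMr ?weight_ge1// (spectral_ge0 (sy0 xL)).
Qed.

Lemma picard_dist B r : 0 <= B -> (forall x, 0 <= x <= L -> cmod (y x r) <= B * weight x) ->
  forall n x, 0 <= x <= L -> cmod (y x r - picard n x r) <= B * 2^-1 ^+ n * weight x.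
Proof.
move=> B0 y_le; elim=> [|n IH] x xL /=; first by rewrite subr0 expr0 mulr1 y_le.
have mp := cmeas_section2 r (cmeas2_picard n).
have picard_le t : 0 < t < L -> cmod (picard n t r) <= 2 * M * weight t.
  by move=> /itvoo_cc tL; exact: spectral_bound (spectral_picard n tL) r.
rewrite edge_mask1// mul1r yE// opprD addrACA subrr add0r.
rewrite (volterraB B0 M0 (my r) mp xL (fun t tL => y_le t (itvoo_cc tL)) picard_le).
rewrite exprSr mulrA -[leRHS]mulrA;
apply: (@le_volterra _ _ (fun t r => y t r - picard n t r)) => //.
- by rewrite mulr_ge0// exprn_ge0// invr_ge0.
- exact: cmeasB.
- by move=> t /itvoo_cc; exact: IH.
Qed.

Lemma volterra_sol_le x r : 0 <= x <= L -> cmod (y x r) <= 2 * M * weight x.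
Proof.
move=> xL; have [B y_le] := y_bounded r; have B0 : 0 <= B := le_trans (cmod_ge0 _) (y_le x).
have weighted_le z : 0 <= z <= L -> cmod (y z r) <= B * weight z.
  by move=> zL; apply: le_trans (y_le z) _; rewrite ler_peMr// weight_ge1.
apply: (ler_addM_null half_powers_null (K := B * weight x)) => n.
rewrite -[y x r](subrKC (picard n x r)); apply: le_trans (cmodD _ _) _; apply: lerD.
- exact: spectral_bound (spectral_picard n xL) r.
- by rewrite mulrAC; exact: picard_dist.
Qed.

Lemma picard_geometric x r n : cmod (y x r - picard n x r) <= 2 * M * weight x * 2^-1 ^+ n.
Proof.
have [xL|xL] := boolP (0 <= x <= L).
  by rewrite mulrAC; apply: picard_dist => // z; exact: volterra_sol_le.
rewrite (y_out _ xL) sub0r cmodN; have -> : picard n x r = 0.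
  by case: n => //= n; rewrite edge_mask0// mul0r.
by rewrite cmod0 mulr_ge0 ?exprn_ge0 ?invr_ge0// mulr_ge0// ltW.
Qed.

Lemma cmeas2_volterra_sol : cmeas2 y.
Proof.
apply: (cmeas_null_lim half_powers_null (f := fun n (p : R * R) => picard n p.1 p.2)) => [n|p].
  exact: cmeas2_picard.
by exists (2 * M * weight p.1) => n; exact: picard_geometric.
Qed.

Lemma spectral_volterra_sol x : 0 <= x <= L -> spectral (a - d x) (2 * M * expR (kappa * L)) (y x).
Proof.
move=> xL; have lim := spectral_null_lim half_powers_null (fun n => spectral_picard n xL)
  (fun r n => picard_geometric x r n).
by apply: spectral_le lim => //; rewrite ler_wpM2l ?weight_le.
Qed.

Lemma decay_volterra_sol x r : 0 <= x <= L ->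
  cmod (y x r - y0 x r) <= 2 * M * expR (kappa * L) * decay r.
Proof.
move=> xL; rewrite yE// addrAC subrr add0r; apply: decay_volterra => // t /itvoo_cc tL.
exact: volterra_sol_le.
Qed.

End Equation.
End Volterra.

Section VolterraWeight.
Variable R : realType.
Local Notation mu := (@lebesgue_measure R).

Lemma expR_le_poisson (k u : R) : 0 < k -> 0 <= u ->
  expR (- (k * u)) ^+ 2 <= k^-1 * poisson (2 / k) (2 * u).
Proof.
move=> k0 u0; have ku0 : 0 <= k * u by rewrite mulr_ge0// ltW.
rewrite expr2 -expRD -opprD expRN.
have ku2 : 0 < 1 + (k * u) ^+ 2 by rewrite ltr_wpDr ?sqr_ge0.
have -> : k^-1 * poisson (2 / k) (2 * u) = (1 + (k * u) ^+ 2)^-1.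
  have denom0 : 0 < 4 + (2 * u * k) ^+ 2 by rewrite ltr_wpDr ?sqr_ge0.
  by rewrite /poisson; field; rewrite !gt_eqF.
rewrite lef_pV2 ?posrE ?expR_gt0//; apply: le_trans (expR_ge1Dxn 1 (addr_ge0 ku0 ku0)).
rewrite (_ : (2`!%:R : R) = 2)//; have := sqr_ge0 (k * u); lra.
Qed.

Lemma poisson_dist (h x t : R) : poisson h (2 * x - 2 * t) = poisson h (2 * `|x - t|).
Proof. by rewrite /poisson -mulrBr [in RHS]exprMn real_normK ?num_real// -exprMn. Qed.

Lemma volterra_kernel_young (d : R -> R) (Q : R -> R[i]) (k th x t : R) : 0 < k -> 0 < th ->
  `|d x - d t| = `|x - t| ->
  cmod (volterra_kernel k d Q x t) <= volterra_weight k d x * 2^-1 *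
    (th * cmod (Q t) ^+ 2 + th^-1 * k^-1 * poisson (2 / k) (2 * x - 2 * t)).
Proof.
move=> k0 th0 isometry; set e := expR (- (k * `|x - t|)).
have young : e * cmod (Q t) <= 2^-1 * (th * cmod (Q t) ^+ 2 + th^-1 * e ^+ 2).
  have square0 := mulr_ge0 (ltW th0) (sqr_ge0 (cmod (Q t) - th^-1 * e)).
  have square_eq : th * (cmod (Q t) - th^-1 * e) ^+ 2 =
      th * cmod (Q t) ^+ 2 - 2 * (e * cmod (Q t)) + th^-1 * e ^+ 2 by field; rewrite gt_eqF.
  by rewrite square_eq in square0; lra.
have bound : e * cmod (Q t) <=
    2^-1 * (th * cmod (Q t) ^+ 2 + th^-1 * k^-1 * poisson (2 / k) (2 * x - 2 * t)).
  apply: le_trans young _; rewrite ler_wpM2l ?invr_ge0// lerD2l -mulrA.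
  by apply: ler_wpM2l; [rewrite invr_ge0 ltW|rewrite poisson_dist expR_le_poisson].
have weight0 : 0 <= volterra_weight k d x by exact: expR_ge0.
rewrite -mulrA; apply: le_trans (ler_wpM2l weight0 bound).
rewrite /volterra_kernel cmodM cmod_real normrM (ger0_norm (expR_ge0 _)).
case: ltP => [dtx|_]; last by rewrite normr0 !mul0r !mulr_ge0 ?cmod_ge0 ?expR_ge0.
rewrite normr1 mul1r mulrA -expRD -isometry gtr0_norm ?subr_gt0//.
by rewrite (_ : k * d x + - (k * (d x - d t)) = k * d t)//; ring.
Qed.

Definition volterra_rate (L b : R) : R := 4 * pi * (1 + L) ^+ 2 * b.

Lemma volterra_rate_gt0 L b : 0 <= L -> 0 < b -> 0 < volterra_rate L b.
Proof. by move=> L0 b0; rewrite !mulr_gt0 ?exprn_gt0 ?pi_gt0// ltr_wpDr. Qed.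

(* The exponential weight turns the Volterra operator into a contraction of factor 1/2. *)
Lemma volterra_kernel_contraction (L b : R) (d : R -> R) (Q : R -> R[i]) : 0 <= L -> 0 < b ->
  measurable_fun setT d -> (forall x t, `|d x - d t| = `|x - t|) -> sqint_le Q b ->
  forall x, (1 + L) * \int[mu]_t cmod (volterra_kernel (volterra_rate L b) d Q x t) <=
    2^-1 * volterra_weight (volterra_rate L b) d x.
Proof.
move=> L0 b0 md isometry [[mQ iQ2] Qb] x; set k := volterra_rate L b.
have k0 : 0 < k := volterra_rate_gt0 L0 b0; have h0 : 0 < 2 / k by rewrite divr_gt0.
have w0 : 0 < 1 + L by rewrite ltr_wpDr.
pose th := (2 * (1 + L) * b)^-1; have th0 : 0 < th by rewrite invr_gt0 !mulr_gt0.
have iP := rintegrable_poisson h0 (2 * x).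
pose e := volterra_weight k d x * 2^-1.
have e0 : 0 <= e by rewrite mulr_ge0 ?invr_ge0// expR_ge0.
pose g t := e * (th * cmod (Q t) ^+ 2 + th^-1 * k^-1 * poisson (2 / k) (2 * x - 2 * t)).
have ig : rintegrable g by apply: rintegrableZ; apply: rintegrableD; exact: rintegrableZ.
have mv : measurable_fun setT (fun t => cmod (volterra_kernel k d Q x t)).
  apply: cmeas_cmod; apply: cmeasM => //; apply: cmeas_real; apply: measurable_funM.
    by apply: measurable_natr_bool; apply: measurable_fun_ltr => //; exact: measurable_cst.
  by apply: (measurableT_comp (@measurable_expR R)); apply: measurable_funM => //;
    exact: measurable_cst.
have kernel_le t : cmod (volterra_kernel k d Q x t) <= g t.
  exact: volterra_kernel_young k0 th0 (isometry x t).
have iv := le_rintegrable mv ig.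
have int_g : \int[mu]_t g t = e * (th * sqnorm Q + th^-1 * k^-1 * pi).
  rewrite (RintegralZl _ measurableT); last by apply: rintegrableD; exact: rintegrableZ.
  rewrite (RintegralD measurableT (rintegrableZ _ iQ2) (rintegrableZ _ iP)).
  by rewrite (RintegralZl _ measurableT iQ2) (RintegralZl _ measurableT iP) Rintegral_poisson.
have -> : 2^-1 * volterra_weight k d x = (1 + L) * (e * (th * b + th^-1 * k^-1 * pi)).
  have := pi_gt0 R; rewrite /e /th /k /volterra_rate; move: (pi : R) => P P0.
  by field; rewrite !gt_eqF.
rewrite ler_pM2l//; apply: le_trans (le_Rintegral measurableT _ ig _) _ => //.
  by apply: iv => t; rewrite ger0_norm ?cmod_ge0.
rewrite int_g ler_wpM2l// lerD2r ler_wpM2l//; exact: ltW.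
Qed.

End VolterraWeight.

Section Solutions.
Variable R : realType.
Local Notation mu := (@lebesgue_measure R).
Local Notation rc := (real_complex R).
Local Notation AC := absolutely_continuous.
Implicit Types (y dy z dz Q : R -> R[i]) (r t : R).

Lemma ac_real a b (f df : R -> R) K : (forall x, is_derive x (1 : R) f (df x)) ->
  (forall x, `|df x| <= K) -> AC a b (fun x => rc (f x)).
Proof.
move=> f_deriv df_le; apply: (@ac_lip _ _ _ _ K) => x z _ xz _.
rewrite -rmorphB cmod_real; move: xz; rewrite le_eqVlt => /predU1P[->|xz].
  by rewrite !subrr normr0 mulr0.
have [|c _ ->] := @MVT R f df x z xz (fun t _ => f_deriv t).
  by apply: continuous_subspaceT => t; exact: is_derive_continuous (f_deriv t).
have zx : 0 <= z - x by rewrite subr_ge0 ltW.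
by rewrite normrM (ger0_norm zx); apply: ler_wpM2r.
Qed.

Lemma ac_within_continuous a b y (p : R[i] -> R) : AC a b y ->
  (forall u v, `|p u - p v| <= cmod (u - v)) -> {within `[a, b], continuous (p \o y)}.
Proof.
move=> acy p_lip; apply/subspace_continuousP => x; rewrite /= in_itv /= => /andP[ax xb].
apply/cvgrPdist_lt => e e0; have [d d0 y_close] := ac_uniform acy e0.
rewrite near_withinE; near=> t; rewrite /= in_itv /= => /andP[a_t tb].
have xt : `|x - t| < d by near: t; exact: cvgr_dist_lt.
apply: le_lt_trans (p_lip _ _) _; have [le_xt|lt_tx] := leP x t.
  by rewrite cmod_distC; apply: y_close => //; rewrite distrC ger0_norm ?subr_ge0// in xt.
by apply: y_close => //; [exact: ltW|rewrite gtr0_norm ?subr_gt0// in xt].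
Unshelve. all: by end_near.
Qed.

Lemma ac_cmeas L y : AC 0 L y -> cmeas (fun x => edge_mask L x * y x).
Proof.
move=> acy; have mp (p : R[i] -> R) : (forall u v, `|p u - p v| <= cmod (u - v)) ->
    measurable_fun setT (fun x : R => ((0 <= x <= L)%R : bool)%:R * p (y x)).
  move=> /(ac_within_continuous acy)/(subspace_continuous_measurable_fun (measurable_itv _)).
  move=> /(measurable_restrictT _ (measurable_itv _)); congr (measurable_fun _ _).
  by apply/funext => x; rewrite patchE mem_setE in_itv /=; case: ifP => _; rewrite ?mul1r ?mul0r.
split.
- rewrite (_ : (fun x => _) = fun x : R => ((0 <= x <= L)%R : bool)%:R * ReC (y x)).
    by apply: mp => u v; rewrite -ReCN -ReCD; exact: ler_norm_Re.
  by apply/funext => x; rewrite ReCM /= mul0r subr0.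
- rewrite (_ : (fun x => _) = fun x : R => ((0 <= x <= L)%R : bool)%:R * ImC (y x)).
    by apply: mp => u v; rewrite -ImCN -ImCD; exact: ler_norm_Im.
  by apply/funext => x; rewrite ImCM /= mul0r addr0.
Qed.

Lemma ac_mask_bounded L y : AC 0 L y -> exists B, forall x, cmod (edge_mask L x * y x) <= B.
Proof.
move=> /ac_bounded[B B0 y_le]; exists B => x; have [xL|xL] := boolP (0 <= x <= L).
  by rewrite edge_mask1// mul1r; case/andP: xL => *; exact: y_le.
by rewrite edge_mask0// mul0r cmod0.
Qed.

Lemma is_derive_reflect (f : R -> R) (c x d : R) : is_derive (c - x) (1 : R) f d ->
  is_derive x (1 : R) (fun t => f (c - t)) (- d).
Proof.
move=> f_deriv; have shift : is_derive x (1 : R) (fun t : R => c - t) (-1).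
  apply: eq_is_derive (is_deriveB (is_derive_cst c x (1 : R)) (is_derive_id x (1 : R))) => //.
  by rewrite sub0r.
by apply: eq_is_derive (@is_derive1_comp R f (fun t => c - t) x d (-1) f_deriv shift) => //;
  rewrite mulrN1.
Qed.

Section Edge.
Variable L : R.

Definition is_sol Q r y dy := [/\ AC 0 L y, AC 0 L dy,
  forall x, 0 < x < L -> has_cderive y x (dy x) &
  {ae mu, forall x, 0 < x < L -> has_cderive dy x ((Q x - rc r ^+ 2) * y x)}].

Lemma is_sol_lin Q r a b y dy z dz : is_sol Q r y dy -> is_sol Q r z dz ->
  is_sol Q r (fun x => a * y x - b * z x) (fun x => a * dy x - b * dz x).
Proof.
move=> [acy acdy y_deriv y_eq] [acz acdz z_deriv z_eq]; split.
- by apply: acB; apply: acM => //; exact: ac_cst.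
- by apply: acB; apply: acM => //; exact: ac_cst.
- by move=> x xL; apply: has_cderiveB; apply: has_cderiveZ; [exact: y_deriv|exact: z_deriv].
apply: (@filterS2 _ _ (ae_filter_ringOfSetsType mu) _ _ _ _ y_eq z_eq) => x dy_deriv dz_deriv xL.
have -> : (Q x - rc r ^+ 2) * (a * y x - b * z x) =
  a * ((Q x - rc r ^+ 2) * y x) - b * ((Q x - rc r ^+ 2) * z x) by ring.
by apply: has_cderiveB; apply: has_cderiveZ; [exact: dy_deriv|exact: dz_deriv].
Qed.

Lemma is_solZ Q r a y dy : is_sol Q r y dy -> is_sol Q r (fun x => a * y x) (fun x => a * dy x).
Proof.
move=> soly; have := is_sol_lin a 0 soly soly.
by under eq_fun do rewrite mul0r subr0; under [X in is_sol _ _ _ X]eq_fun do rewrite mul0r subr0.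
Qed.

Lemma norm_sqrM_sindiv (u r : R) : `|r ^+ 2 * sindiv u r| <= `|r|.
Proof. by rewrite expr2 -mulrA mulr_sindiv normrM ler_piMr// norm_sin_le1. Qed.

Lemma is_sol_sindiv c r : is_sol (fun=> 0) r (fun t => rc (sindiv (c - t) r))
  (fun t => rc (- cos (r * (c - t)))).
Proof.
have deriv x : is_derive x (1 : R) (fun t => sindiv (c - t) r) (- cos (r * (c - x))).
  exact: (is_derive_reflect (is_derive_sindiv r (c - x))).
have deriv2 x : is_derive x (1 : R) (fun t => - cos (r * (c - t))) (- (r ^+ 2 * sindiv (c - x) r)).
  have := is_deriveN (is_derive_reflect (is_derive_cos_sindiv r (c - x))).
  by apply: eq_is_derive => //; rewrite mulNr !opprK.
split.
- by apply: (@ac_real _ _ _ _ 1 deriv) => x; rewrite normrN norm_cos_le1.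
- by apply: (@ac_real _ _ _ _ `|r| deriv2) => x; rewrite normrN norm_sqrM_sindiv.
- by move=> x _; exact: has_cderive_real.
apply: aeW => x _; rewrite sub0r -rmorphXn -rmorphN -rmorphM mulNr.
exact: has_cderive_real.
Qed.

Lemma is_sol_cos c r : is_sol (fun=> 0) r (fun t => rc (cos (r * (c - t))))
  (fun t => rc (r ^+ 2 * sindiv (c - t) r)).
Proof.
have deriv x : is_derive x (1 : R) (fun t => cos (r * (c - t))) (r ^+ 2 * sindiv (c - x) r).
  have := is_derive_reflect (is_derive_cos_sindiv r (c - x)).
  by apply: eq_is_derive => //; rewrite mulNr opprK.
have deriv2 x : is_derive x (1 : R) (fun t => r ^+ 2 * sindiv (c - t) r)
  (- r ^+ 2 * cos (r * (c - x))).
  have := is_deriveZ (r ^+ 2) (is_derive_reflect (is_derive_sindiv r (c - x))).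
  by apply: eq_is_derive => //; rewrite /GRing.scale/= mulrN mulNr.
split.
- by apply: (@ac_real _ _ _ _ `|r| deriv) => x; exact: norm_sqrM_sindiv.
- apply: (@ac_real _ _ _ _ (r ^+ 2) deriv2) => x; rewrite mulNr normrN normrM.
  by rewrite (ger0_norm (sqr_ge0 _)) ler_piMr ?sqr_ge0 ?norm_cos_le1.
- by move=> x _; exact: has_cderive_real.
apply: aeW => x _; rewrite sub0r -rmorphXn -rmorphN -rmorphM.
exact: has_cderive_real.
Qed.

End Edge.

Lemma cintegral_indicM D (f : R -> R[i]) : cintegral D f = cint (fun x => rc (\1_D x) * f x).
Proof.
apply: complex_ext => /=; rewrite -Rintegral_indicM; apply: eq_Rintegral => x _.
  by rewrite ReCM /= mul0r subr0.
by rewrite ImCM /= mul0r addr0.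
Qed.

Lemma cintegral_itv (f : R -> R[i]) s t :
  cintegral `]s, t[ f = cint (fun x => rc ((s < x < t)%R : bool)%:R * f x).
Proof. by rewrite cintegral_indicM; apply: eq_cint => x; rewrite indicE mem_setE in_itv. Qed.

Section Lagrange.
Variables (L : R) (Q Q' : R -> R[i]) (r : R) (y dy z dz : R -> R[i]).
Hypotheses (iQ : cintegrable Q) (iQ' : cintegrable Q').
Hypotheses (soly : is_sol L Q r y dy) (solz : is_sol L Q' r z dz).

Lemma cintegrable_lagrange :
  cintegrable (fun x => (Q x - Q' x) * ((edge_mask L x * y x) * (edge_mask L x * z x))).
Proof.
have [acy _ _ _] := soly; have [acz _ _ _] := solz.
have [B y_le] := ac_mask_bounded acy; have [B' z_le] := ac_mask_bounded acz.
apply: (@cintegrableM_bounded _ _ _ (B * B') (cintegrableB iQ iQ')).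
  by apply: cmeasM; exact: ac_cmeas.
by move=> x _; rewrite cmodM; apply: ler_pM; rewrite ?cmod_ge0.
Qed.

Lemma cintegrable_lagrange_itv s t : cintegrable (fun x => rc ((s < x < t)%R : bool)%:R *
  ((Q x - Q' x) * ((edge_mask L x * y x) * (edge_mask L x * z x)))).
Proof.
apply: (@cintegrable_boundedM _ _ _ 1); last exact: cintegrable_lagrange.
  apply: cmeas_real; apply: measurable_natr_bool.
  by apply: measurable_and; apply: measurable_fun_ltr.
by move=> x; rewrite cmod_real; case: (_ < _ < _); rewrite ?normr1 ?normr0.
Qed.

Lemma lagrange s t : 0 <= s -> s <= t -> t <= L ->
  (y s * dz s - dy s * z s) - (y t * dz t - dy t * z t) =
  cint (fun x => rc ((s < x < t)%R : bool)%:R *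
    ((Q x - Q' x) * ((edge_mask L x * y x) * (edge_mask L x * z x)))).
Proof.
move=> s0 + tL; rewrite le_eqVlt => /predU1P[->|st].
  rewrite subrr (_ : (fun x => _) = fun=> 0) ?cint0//; apply/funext => x.
  have -> : (t < x < t) = false by apply/negbTE/negP => /andP[/lt_trans tt /tt]; rewrite ltxx.
  by rewrite mul0r.
have [acy acdy y_deriv y_eq] := soly; have [acz acdz z_deriv z_eq] := solz.
rewrite -cintegral_itv -opprB -[RHS]opprK; congr (- _).
rewrite (@ac_ftc R s t (fun x => y x * dz x - dy x * z x)
  (fun x => - ((Q x - Q' x) * ((edge_mask L x * y x) * (edge_mask L x * z x)))))//.
- by rewrite !cintegral_itv -(cintN (cintegrable_lagrange_itv s t)); apply: eq_cint => x;
    rewrite mulrN.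
- by apply: ac_subitv s0 tL _; apply: acB; apply: acM.
- exact: cintegrableN cintegrable_lagrange.
apply: (@filterS2 _ _ (ae_filter_ringOfSetsType mu) _ _ _ _ y_eq z_eq)
  => x dy_deriv dz_deriv /andP[sx xt].
have xL : 0 < x < L by rewrite (le_lt_trans s0 sx) (lt_le_trans xt tL).
have xL' := itvoo_cc xL.
have := has_cderiveB (has_cderiveM (y_deriv x xL) (dz_deriv xL))
  (has_cderiveM (dy_deriv xL) (z_deriv x xL)).
by congr (has_cderive _ _ _); rewrite edge_mask1// !mul1r; ring.
Qed.

End Lagrange.
End Solutions.

Section Asymptotics.
Variables (R : realType) (L : R).
Implicit Types (s : R -> R) (K M : R) (y : R -> R -> R[i]).

Definition asymptotic s K y0 y := [/\ cmeas2 (fun x r => edge_mask L x * y x r),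
  (forall x, 0 <= x <= L -> spectral (s x) K (y x)) &
  forall x r, 0 <= x <= L -> cmod (y x r - y0 x r) <= K * decay r].

Lemma asymptotic_le s K K' y0 y : K <= K' -> asymptotic s K y0 y -> asymptotic s K' y0 y.
Proof.
move=> KK' [my sy y_close]; split => // x; first by move=> /sy; exact: spectral_le.
by move=> r /(y_close x r)/le_trans; apply; rewrite ler_wpM2r ?decay_ge0.
Qed.

Lemma asymptotic_wavefront s K y0 y p d c M : 0 <= K -> asymptotic s K y0 y -> s =1 p ->
  wavefront L p d c M y0 -> wavefront L p d c (M + K + K) (fun x r => edge_mask L x * y x r).
Proof.
move=> K0 [my sy y_close] /funext <-.
apply: wavefront_perturb => // x.
- by move=> /itvoo_cc xL; apply: eq_spectral (sy x xL) => r; rewrite edge_mask1// mul1r.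
- by move=> r /itvoo_cc xL; rewrite edge_mask1// mul1r; exact: y_close.
Qed.

End Asymptotics.

Section IntegralEquations.
Variable R : realType.
Local Notation rc := (real_complex R).
Variables (L b : R) (Q : R -> R[i]) (y dy : R -> R -> R[i]).
Hypotheses (L0 : 0 <= L) (b0 : 0 < b) (Qb : sqint_le Q b) (Q0 : supported L Q).
Hypothesis soly : forall r, is_sol L Q r (y^~ r) (dy^~ r).

Definition volterra_const : R := 2 * expR (volterra_rate L b * L).

Lemma volterra_const_ge0 : 0 <= volterra_const. Proof. by rewrite mulr_ge0 ?expR_ge0. Qed.

Let iQ : cintegrable Q. Proof. exact: supported_cintegrable L0 Qb.1 Q0. Qed.

Let cintegrable0 : cintegrable (fun=> 0 : R[i]).
Proof. by split; exact: rintegrable0. Qed.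

Let supportedM t (u v : R[i]) : (0 < t < L -> u = v) -> Q t * u = Q t * v.
Proof. by have [tL ->//|/Q0 ->] := boolP (0 < t < L); rewrite !mul0r. Qed.

Let masked x r := edge_mask L x * y x r.

Lemma forward_equation x r : 0 <= x <= L ->
  masked x r = y 0 r * rc (cos (r * x)) + dy 0 r * rc (sindiv x r) + volterra id Q masked x r.
Proof.
move=> /andP[x0 xL]; rewrite /masked edge_mask1 ?x0//= mul1r.
have := lagrange iQ cintegrable0 (soly r) (is_sol_sindiv L x r) (lexx 0) x0 xL.
rewrite !subr0 subrr mulr0 cos0 sindiv0 !rmorphN rmorph1 rmorph0 mulr0 subr0 mulrN mulrN1 opprK.
set I := cint _; set J := volterra _ _ _ _ _ => lagrange_eq.
have -> : J = I; last by rewrite -lagrange_eq; ring.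
apply: eq_cint => t; rewrite subr0 [RHS]mulrCA; apply: supportedM => tL.
rewrite /= !edge_mask1 ?itvoo_cc// !mul1r rmorphM -!mulrA; case/andP: tL => -> _ /=.
by rewrite [y _ _ * _]mulrC.
Qed.

Lemma backward_equation x r : 0 <= x <= L ->
  masked x r = y L r * rc (cos (r * (L - x))) - dy L r * rc (sindiv (L - x) r)
    + volterra (fun t => L - t) Q masked x r.
Proof.
move=> /andP[x0 xL]; rewrite /masked edge_mask1 ?x0//= mul1r.
have := lagrange iQ cintegrable0 (soly r) (is_sol_sindiv L x r) x0 xL (lexx L).
rewrite subrr mulr0 cos0 sindiv0 !rmorphN rmorph1 rmorph0 mulr0 subr0 mulrN1.
have -> : cos (r * (x - L)) = cos (r * (L - x)) by rewrite -(opprB L x) mulrN cosN.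
have -> : sindiv (x - L) r = - sindiv (L - x) r by rewrite -(opprB L x) sindivN.
rewrite rmorphN; set I := cint _; set J := volterra _ _ _ _ _ => lagrange_eq.
have -> : J = - I; last by rewrite -lagrange_eq; ring.
rewrite -(cintN (cintegrable_lagrange_itv iQ cintegrable0 (soly r) (is_sol_sindiv L x r) x L)).
apply: eq_cint => t; rewrite subr0 [X in _ = - X]mulrCA -mulrN; apply: supportedM => tL.
rewrite /= !edge_mask1 ?itvoo_cc// !mul1r rmorphM ltrD2l ltrN2.
have -> : L - x - (L - t) = - (x - t) by ring.
rewrite sindivN rmorphN -!mulrA; case/andP: tL => _ ->; rewrite andbT.
by ring.
Qed.

Lemma derivative_equation r : dy L r =
  dy 0 r * rc (cos (r * L)) - y 0 r * rc (r ^+ 2 * sindiv L r)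
  + cint (fun t => Q t * (rc (cos (r * (L - t))) * masked t r)).
Proof.
have := lagrange iQ cintegrable0 (soly r) (is_sol_cos L L r) (lexx 0) L0 (lexx L).
rewrite subrr mulr0 cos0 sindiv0 subr0 mulr0 rmorph1 rmorph0 mulr0 mulr1 sub0r opprK.
set I := cint _; set J := cint _ => lagrange_eq;
have -> : J = I; last by rewrite -lagrange_eq; ring.
apply: eq_cint => t; rewrite subr0 [RHS]mulrCA; apply: supportedM => tL.
by rewrite /masked tL mul1r !edge_mask1 ?itvoo_cc// !mul1r mulrC.
Qed.

Lemma volterra_asymptotic (d : R -> R) a M (y0 : R -> R -> R[i]) : measurable_fun setT d ->
  (forall x, 0 <= x <= L -> 0 <= d x <= L) -> (forall x t, `|d x - d t| = `|x - t|) ->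
  cmeas2 y0 -> (forall x, 0 <= x <= L -> spectral (a - d x) M (y0 x)) ->
  (forall x r, 0 <= x <= L -> masked x r = y0 x r + volterra d Q masked x r) ->
  asymptotic L (fun x => a - d x) (volterra_const * M) y0 y.
Proof.
move=> md d_itv isometry my0 sy0 yE.
have rate0 := ltW (volterra_rate_gt0 L0 b0).
have contraction x (_ : 0 <= x <= L) := volterra_kernel_contraction L0 b0 md isometry Qb x.
have masked_out x r : ~~ (0 <= x <= L) -> masked x r = 0.
  by move=> xL; rewrite /masked edge_mask0// mul0r.
have mmasked r : cmeas (masked^~ r) by have [+ _ _ _] := soly r; exact: ac_cmeas.
have masked_le r : exists B, forall x, cmod (masked x r) <= B.
  by have [+ _ _ _] := soly r; exact: ac_mask_bounded.
have -> : volterra_const * M = 2 * M * expR (volterra_rate L b * L).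
  by rewrite /volterra_const mulrAC.
split=> [|x xL|x r xL].
- exact: (cmeas2_volterra_sol L0 rate0 md d_itv iQ Q0 contraction my0 sy0 yE masked_out mmasked
    masked_le).
- have := spectral_volterra_sol L0 rate0 md d_itv iQ Q0 contraction my0 sy0 yE masked_out mmasked
    masked_le xL.
  by apply: eq_spectral => r; rewrite /masked edge_mask1// mul1r.
- have := decay_volterra_sol L0 rate0 md d_itv iQ Q0 contraction my0 sy0 yE mmasked masked_le r xL.
  by rewrite /masked edge_mask1// mul1r.
Qed.

Lemma forward_asymptotic a M (y0 : R -> R -> R[i]) : cmeas2 y0 ->
  (forall x, 0 <= x <= L -> spectral (a - x) M (y0 x)) ->
  (forall x r, y0 x r = y 0 r * rc (cos (r * x)) + dy 0 r * rc (sindiv x r)) ->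
  asymptotic L (fun x => a - x) (volterra_const * M) y0 y.
Proof.
move=> my0 sy0 y0E; apply: (@volterra_asymptotic id) => //.
by move=> x r xL; rewrite y0E; exact: forward_equation.
Qed.

Lemma backward_asymptotic a M (y0 : R -> R -> R[i]) : cmeas2 y0 ->
  (forall x, 0 <= x <= L -> spectral (a - (L - x)) M (y0 x)) ->
  (forall x r, y0 x r = y L r * rc (cos (r * (L - x))) - dy L r * rc (sindiv (L - x) r)) ->
  asymptotic L (fun x => a - (L - x)) (volterra_const * M) y0 y.
Proof.
move=> my0 sy0 y0E; apply: (@volterra_asymptotic (fun x => L - x)) => //.
- by apply: measurable_funB => //; exact: measurable_cst.
- by move=> x /andP[x0 xL]; rewrite subr_ge0 xL lerBlDr lerDl.
- by move=> x t; rewrite (_ : L - x - (L - t) = - (x - t)) ?normrN//; ring.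
- by move=> x r xL; rewrite y0E; exact: backward_equation.
Qed.

End IntegralEquations.

(** * Edges of the graph *)

Section GraphEdge.
Variable R : realType.
Local Notation mu := (@lebesgue_measure R).
Local Notation rc := (real_complex R).

(* S, C and their derivatives are functions of x and of rho, where lambda = rho ^+ 2. *)
Record graph_edge (L b : R) := GraphEdge {
  edge_potential : R -> R[i];
  edge_S : R -> R -> R[i];
  edge_dS : R -> R -> R[i];
  edge_C : R -> R -> R[i];
  edge_dC : R -> R -> R[i];
  edge_potential_le : sqint_le edge_potential b;
  edge_potential_supported : supported L edge_potential;
  edge_S_sol : forall r, is_sol L edge_potential r (edge_S^~ r) (edge_dS^~ r);
  edge_C_sol : forall r, is_sol L edge_potential r (edge_C^~ r) (edge_dC^~ r);
  edge_S0 : forall r, edge_S 0 r = 0;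
  edge_dS0 : forall r, edge_dS 0 r = 1;
  edge_C0 : forall r, edge_C 0 r = 1;
  edge_dC0 : forall r, edge_dC 0 r = 0 }.

Variables L b : R.
Hypotheses (L0 : 0 <= L) (b0 : 0 < b).

Definition edge_const : R := 1 + volterra_const L b * ((1 + L) * (1 + (L + b))).

Definition end_const : R := 1 + edge_const + edge_const.

Local Notation growth := (volterra_const L b).

Let growth_ge0 : 0 <= growth. Proof. exact: volterra_const_ge0. Qed.
Let edge_const_bounds : [/\ 1 <= edge_const, growth <= edge_const & growth * L <= edge_const] /\
  [/\ 1 + growth * L * (L + b) <= edge_const, (growth * L + growth) * (L + b) <= edge_const
    & growth * (L + b) <= edge_const].
Proof.
have Lb0 : 0 <= L + b by rewrite addr_ge0// ltW.
have growth_L0 : 0 <= growth * L by exact: mulr_ge0.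
have growth_Lb0 : 0 <= growth * (L + b) by exact: mulr_ge0.
have growth_LLb0 : 0 <= growth * L * (L + b) by exact: mulr_ge0.
have -> : edge_const = 1 + growth + growth * L + growth * (L + b) + growth * L * (L + b).
  by rewrite /edge_const; ring.
by have := growth_ge0; do !split; lra.
Qed.

Lemma edge_const_ge1 : 1 <= edge_const.
Proof. by have [[]] := edge_const_bounds. Qed.

Lemma edge_const_ge0 : 0 <= edge_const.
Proof. exact: le_trans ler01 edge_const_ge1. Qed.

Lemma end_const_ge1 : 1 <= end_const.
Proof. by have := edge_const_ge1; rewrite /end_const; lra. Qed.

Variable e : graph_edge L b.

Definition edge_sine x r : R[i] := rc r * edge_S e x r.

Lemma edge_sine_sol r : is_sol L (edge_potential e) r (edge_sine^~ r)
  (fun x => rc r * edge_dS e x r).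
Proof. exact: is_solZ (edge_S_sol e r). Qed.

Let iQ : cintegrable (edge_potential e).
Proof. exact: supported_cintegrable L0 (edge_potential_le e).1 (edge_potential_supported e). Qed.

Let Q_le : \int[mu]_x cmod (edge_potential e x) <= L + b.
Proof. exact: Rintegral_cmod_supported L0 (edge_potential_le e) (edge_potential_supported e). Qed.

Let potential_neq0_itv (x : R) : edge_potential e x != 0 -> 0 <= x <= L.
Proof. by move=> /(supported_neq0 (edge_potential_supported e))/itvoo_cc. Qed.

Let forward M (y dy y0 : R -> R -> R[i]) :
  (forall r, is_sol L (edge_potential e) r (y^~ r) (dy^~ r)) -> cmeas2 y0 ->
  (forall x, 0 <= x <= L -> spectral (- `|x|) M (y0 x)) ->
  (forall x r, y0 x r = y 0 r * rc (cos (r * x)) + dy 0 r * rc (sindiv x r)) ->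
  asymptotic L (fun x => - x) (growth * M) y0 y.
Proof.
move=> soly my0 sy0 y0E; have := @forward_asymptotic _ _ _ _ _ _ L0 b0 (edge_potential_le e)
  (edge_potential_supported e) soly 0 M y0 my0 _ y0E.
under [X in asymptotic _ X]eq_fun do rewrite sub0r.
by apply=> x xL; have := sy0 x xL; rewrite sub0r ger0_norm//; case/andP: xL.
Qed.

Let sine_forward : asymptotic L (fun x => - x) growth (fun x r => rc (sin (r * x))) edge_sine.
Proof.
rewrite -[X in asymptotic _ _ X]mulr1; apply: (forward edge_sine_sol) => [|x _|x r].
- exact: cmeas2_sin.
- exact: spectral_sin.
- by rewrite /edge_sine edge_S0 edge_dS0 mulr0 mul0r add0r mulr1 -rmorphM mulr_sindiv.
Qed.

Let S_forward : asymptotic L (fun x => - x) (growth * L) (fun x r => rc (sindiv x r)) (edge_S e).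
Proof.
apply: (forward (edge_S_sol e)) => [|x /andP[x0 xL]|x r].
- exact: cmeas2_sindiv.
- by apply: spectral_le (spectral_sindiv x) => //; rewrite ger0_norm.
- by rewrite edge_S0 edge_dS0 mul0r add0r mul1r.
Qed.

Let C_forward : asymptotic L (fun x => - x) growth (fun x r => rc (cos (r * x))) (edge_C e).
Proof.
rewrite -[X in asymptotic _ _ X]mulr1; apply: (forward (edge_C_sol e)) => [|x _|x r].
- exact: cmeas2_cos.
- exact: spectral_cos.
- by rewrite edge_C0 edge_dC0 mul0r addr0 mul1r.
Qed.

Lemma edge_sine_asymptotic :
  asymptotic L (fun x => - x) edge_const (fun x r => rc (sin (r * x))) edge_sine.
Proof. by apply: asymptotic_le sine_forward; have [[]] := edge_const_bounds. Qed.

Lemma edge_S_asymptotic :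
  asymptotic L (fun x => - x) edge_const (fun x r => rc (sindiv x r)) (edge_S e).
Proof. by apply: asymptotic_le S_forward; have [[]] := edge_const_bounds. Qed.

Lemma edge_C_asymptotic :
  asymptotic L (fun x => - x) edge_const (fun x r => rc (cos (r * x))) (edge_C e).
Proof. by apply: asymptotic_le C_forward; have [[]] := edge_const_bounds. Qed.

Let cmeas2_cos_reflectM (y : R -> R -> R[i]) : cmeas2 (fun t r => edge_mask L t * y t r) ->
  cmeas2 (fun t r => rc (cos (r * (L - t))) * (edge_mask L t * y t r)).
Proof. exact: cmeas2M (cmeas2_reflect L (@cmeas2_cos R)). Qed.

Let le_cmod_perturbation (y : R -> R -> R[i]) r M : cmeas2 (fun t r => edge_mask L t * y t r) ->
  0 <= M -> (forall t, 0 <= t <= L -> cmod (y t r) <= M) ->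
  cmod (cint (fun t => edge_potential e t * (rc (cos (r * (L - t))) * (edge_mask L t * y t r)))) <=
  M * (L + b).
Proof.
move=> my M0 y_le; have mE := cmeas_section2 r (cmeas2_cos_reflectM my).
apply: le_trans (ler_wpM2l M0 Q_le); apply: (le_cmod_cintM iQ mE) => t /potential_neq0_itv tL.
rewrite cmodM cmod_real edge_mask1// mul1r -[leRHS]mul1r.
by apply: ler_pM; rewrite ?cmod_ge0 ?norm_cos_le1// y_le.
Qed.

Let edge_dSE r : edge_dS e L r = rc (cos (r * L)) +
  cint (fun t => edge_potential e t * (rc (cos (r * (L - t))) * (edge_mask L t * edge_S e t r))).
Proof.
rewrite (derivative_equation L0 (edge_potential_le e) (edge_potential_supported e) (edge_S_sol e)).
by rewrite edge_S0 edge_dS0 mul1r mul0r subr0.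
Qed.

Let edge_dCE r : edge_dC e L r = - rc (r * sin (r * L)) +
  cint (fun t => edge_potential e t * (rc (cos (r * (L - t))) * (edge_mask L t * edge_C e t r))).
Proof.
rewrite (derivative_equation L0 (edge_potential_le e) (edge_potential_supported e) (edge_C_sol e)).
by rewrite edge_C0 edge_dC0 mul0r mul1r sub0r expr2 -mulrA mulr_sindiv.
Qed.

Lemma spectral_edge_dS : spectral (- L) edge_const (edge_dS e L).
Proof.
have [mS sS _] := S_forward; have growth_L0 : 0 <= growth * L by exact: mulr_ge0.
have sE t : edge_potential e t != 0 ->
    spectral (- L) (growth * L) (fun r => rc (cos (r * (L - t))) * (edge_mask L t * edge_S e t r)).
  move=> /potential_neq0_itv tL; have := spectralM (spectral_cos (L - t)) (sS t tL).
  have [_ t_le] := andP tL; rewrite ger0_norm ?subr_ge0// (_ : - (L - t) + - t = - L); last by ring.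
  by rewrite mul1r; apply: eq_spectral => r; rewrite edge_mask1// mul1r.
have := spectralD (spectral_cos L) (spectral_le (_ : - `|L| <= - L) (lexx _)
  (spectral_cintM iQ (cmeas2_cos_reflectM mS) sE)).
rewrite ger0_norm// => /(_ (lexx _)) s.
apply: eq_spectral (spectral_le (lexx _) _ s) => [r|]; first by rewrite edge_dSE.
by apply: le_trans (lerD (lexx _) (ler_wpM2l growth_L0 Q_le)) _; have [_ []] := edge_const_bounds.
Qed.

Lemma edge_dS_decay r : cmod (edge_dS e L r - rc (cos (r * L))) <= edge_const * decay r.
Proof.
have [mS sS _] := S_forward; have [_ s_sine _] := sine_forward.
have S_le t : 0 <= t <= L -> cmod (edge_S e t r) <= (growth * L + growth) * decay r.
  move=> tL; apply: le_decay; [exact: cmod_ge0|exact: spectral_bound (sS t tL) r|].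
  by have := spectral_bound (s_sine t tL) r; rewrite cmodM cmod_real.
have bound0 : 0 <= (growth * L + growth) * decay r.
  by rewrite mulr_ge0 ?decay_ge0// addr_ge0// mulr_ge0.
rewrite edge_dSE addrAC subrr add0r; apply: le_trans (le_cmod_perturbation mS bound0 S_le) _.
by rewrite mulrAC; apply: ler_wpM2r; [exact: decay_ge0|have [_ []] := edge_const_bounds].
Qed.

Lemma cmeas_edge_dC : cmeas (edge_dC e L).
Proof.
have [mC _ _] := C_forward; have mlead : cmeas (fun r : R => - rc (r * sin (r * L))).
  apply: cmeasN; apply: cmeas_real; apply: measurable_funM => //.
  apply: (measurableT_comp (continuous_measurable_fun (@continuous_sin R))).
  exact: mulrr_measurable.
by apply: eq_cmeas (cmeasD mlead (cmeas_cintM iQ (cmeas2_cos_reflectM mC))) => r; rewrite edge_dCE.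
Qed.

Lemma edge_dC_le r : cmod (edge_dC e L r + rc (r * sin (r * L))) <= edge_const.
Proof.
have [mC sC _] := C_forward; rewrite edge_dCE addrAC addNr add0r.
apply: le_trans (le_cmod_perturbation mC growth_ge0 (fun t tL => spectral_bound (sC t tL) r)) _.
by have [_ []] := edge_const_bounds.
Qed.

Lemma edge_wronskian r :
  edge_C e L r * edge_dS e L r - edge_dC e L r * edge_S e L r = 1.
Proof.
have := lagrange iQ iQ (edge_C_sol e r) (edge_S_sol e r) (lexx 0) L0 (lexx L).
rewrite (_ : (fun x => _) = fun=> 0); last by apply/funext => x; rewrite subrr mul0r mulr0.
rewrite cint0 edge_S0 edge_dS0 edge_C0 edge_dC0 mulr0 mulr1 subr0.
by move/eqP; rewrite subr_eq0 => /eqP.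
Qed.

Lemma wavefront_end (e0 e1 : R -> R[i]) d c : spectral (- L) edge_const e1 ->
  (forall r, cmod (e1 r - e0 r) <= edge_const * decay r) ->
  wavefront L (fun=> - L) d c 1 (fun _ => e0) ->
  wavefront L (fun=> - L) d c end_const (fun _ => e1).
Proof.
move=> s1 close; have const0 := edge_const_ge0.
by apply: wavefront_perturb => //; exact: cmeas2_snd (cmeas_spectral s1).
Qed.

Lemma edge_sine_end_wavefront :
  wavefront L (fun=> - L) (fun=> 2 * L) (half_i R) end_const (fun _ => edge_sine L).
Proof.
have [_ s close] := edge_sine_asymptotic; have LL : 0 <= L <= L by rewrite L0 lexx.
apply: (wavefront_end (s L LL) (fun r => close L r LL)).
by apply: (@wavefront_sin _ _ (fun=> L)) => //; exact: measurable_cst.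
Qed.

Lemma edge_C_end_wavefront :
  wavefront L (fun=> - L) (fun=> 2 * L) (rc 2^-1) end_const (fun _ => edge_C e L).
Proof.
have [_ s close] := edge_C_asymptotic; have LL : 0 <= L <= L by rewrite L0 lexx.
apply: (wavefront_end (s L LL) (fun r => close L r LL)).
by apply: (@wavefront_cos _ _ (fun=> L)) => //; exact: measurable_cst.
Qed.

Lemma edge_dS_end_wavefront :
  wavefront L (fun=> - L) (fun=> 2 * L) (rc 2^-1) end_const (fun _ => edge_dS e L).
Proof.
apply: (wavefront_end spectral_edge_dS edge_dS_decay).
by apply: (@wavefront_cos _ _ (fun=> L)) => //; exact: measurable_cst.
Qed.

End GraphEdge.

(** * The star graph *)

Section StarAlgebra.
Variables (F : comNzRingType) (N : nat) (o : 'I_N).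
Implicit Types (S C D B : 'I_N -> F) (j k : 'I_N).

Definition prod_but1 S k : F := \prod_(l | l != k) S l.
Definition prod_but2 S j k : F := \prod_(l | (l != j) && (l != k)) S l.

(* The characteristic function of the graph without the edge k. *)
Definition pruned_Delta S D C k : F :=
  C o * prod_but2 S o k + \sum_(j | (j != o) && (j != k)) D j * prod_but2 S j k.

Definition star_Delta S D C : F := C o * prod_but1 S o + \sum_(j | j != o) D j * prod_but1 S j.
Definition star_DeltaK S D C B k : F := C k * pruned_Delta S D C k + B k * prod_but1 S k.

Lemma prod_but1D1 S j k : j != k -> prod_but1 S k = S j * prod_but2 S j k.
Proof.
by move=> jk; rewrite /prod_but1 (bigD1 j)//=; congr (_ * _); apply: eq_bigl => l; rewrite andbC.
Qed.

Lemma prod_but2C S j k : prod_but2 S j k = prod_but2 S k j.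
Proof. by apply: eq_bigl => l; rewrite andbC. Qed.

Lemma star_Delta_pruned S D C k : k != o ->
  star_Delta S D C = S k * pruned_Delta S D C k + D k * prod_but1 S k.
Proof.
move=> ko; rewrite /star_Delta (prod_but1D1 S ko) (bigD1 k)//= prod_but2C /pruned_Delta mulrDr.
rewrite mulr_sumr mulrCA -addrA; congr (_ + _); rewrite addrC; congr (_ + _).
apply: eq_bigr => j /andP[_ jk]; rewrite (prod_but1D1 S (_ : k != j)) 1?eq_sym//.
by rewrite prod_but2C mulrCA.
Qed.

Lemma pruned_Delta_cross S D C (S' D' C' : 'I_N -> F) k : k != o ->
  pruned_Delta S D C k * prod_but1 S' k - prod_but1 S k * pruned_Delta S' D' C' k =
  prod_but2 S o k * prod_but2 S' o k * (C o * S' o - S o * C' o)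
  + \sum_(j | (j != o) && (j != k)) prod_but2 S j k * prod_but2 S' j k * (D j * S' j - S j * D' j).
Proof.
move=> ko; rewrite /pruned_Delta mulrDl mulrDr mulr_suml mulr_sumr opprD addrACA -sumrB.
congr (_ + _).
  by rewrite !(@prod_but1D1 _ o k) 1?eq_sym//; ring.
by apply: eq_bigr => j /andP[_ jk]; rewrite !(prod_but1D1 _ jk); ring.
Qed.

Lemma card_but1 k : #|[pred l | l != k]| = N.-1.
Proof. by rewrite -[in RHS](card_ord N) -(cardC1 k); apply: eq_card. Qed.

Lemma card_but2 j k : j != k -> #|[pred l | (l != j) && (l != k)]| = N.-2.
Proof.
move=> jk; have := cardD1 j [pred l | l != k]; rewrite card_but1 inE jk add1n => cardE.
by rewrite -[N.-2]/(N.-1.-1) cardE /=; apply: eq_card => l; rewrite !inE.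
Qed.

Lemma prod_but1Z z S k : prod_but1 (fun l => z * S l) k = z ^+ N.-1 * prod_but1 S k.
Proof. by rewrite /prod_but1 big_split prodr_const card_but1. Qed.

Lemma prod_but2Z z S j k : j != k -> prod_but2 (fun l => z * S l) j k = z ^+ N.-2 * prod_but2 S j k.
Proof. by move=> jk; rewrite /prod_but2 big_split prodr_const card_but2. Qed.

Lemma pruned_DeltaZ z S D C k : k != o ->
  pruned_Delta (fun l => z * S l) D C k = z ^+ N.-2 * pruned_Delta S D C k.
Proof.
move=> ko; rewrite /pruned_Delta prod_but2Z 1?eq_sym// mulrDr mulrCA mulr_sumr; congr (_ + _).
by apply: eq_bigr => j /andP[_ jk]; rewrite prod_but2Z// mulrCA.
Qed.

End StarAlgebra.

Section StarConstants.
Variables (R : realType) (N : nat) (L b : R).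

Definition prod_const : R := (3 * end_const L b) ^+ N.
Definition pruned_const : R := (3 * (end_const L b * prod_const)) *+ N.-1.
Definition leaf_start_const : R := prod_const + pruned_const.
Definition leaf_const : R := 3 * leaf_start_const + volterra_const L b * leaf_start_const +
  volterra_const L b * leaf_start_const.
Definition root_const : R := 1 + volterra_const L b + volterra_const L b.
Definition Delta_const : R := (edge_const L b + edge_const L b * edge_const L b) * leaf_start_const.
Definition leaf_lead : R[i] := (real_complex R 2^-1 * half_i R ^+ N.-1) *+ N.

Hypotheses (L0 : 0 < L) (b0 : 0 < b).

Let end_const_ge0 : 0 <= end_const L b.
Proof. exact: le_trans ler01 (end_const_ge1 (ltW L0) b0). Qed.

Lemma prod_const_ge0 : 0 <= prod_const.
Proof. by rewrite exprn_ge0// mulr_ge0. Qed.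

Lemma pruned_const_ge0 : 0 <= pruned_const.
Proof. by rewrite mulrn_wge0// !mulr_ge0 ?prod_const_ge0. Qed.

Lemma leaf_start_const_ge0 : 0 <= leaf_start_const.
Proof. by rewrite addr_ge0 ?prod_const_ge0 ?pruned_const_ge0. Qed.

Lemma le_prod_const n : (n <= N)%N -> (3 * end_const L b) ^+ n <= prod_const.
Proof.
by move=> nN; apply: ler_weXn2l => //; apply: le_trans (end_const_ge1 (ltW L0) b0) _;
  rewrite ler_peMl ?ler1n.
Qed.

Lemma half_i_neq0 : half_i R != 0.
Proof. by rewrite eq_complex /= eqxx /= invr_eq0 pnatr_eq0. Qed.

Lemma leaf_lead_neq0 : (0 < N)%N -> leaf_lead != 0.
Proof.
move=> N0; rewrite mulrn_eq0 negb_or -lt0n N0 mulf_neq0 ?expf_neq0 ?half_i_neq0//.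
by rewrite eq_complex /= eqxx andbT invr_eq0 pnatr_eq0.
Qed.

End StarConstants.

Section StarGraph.
Variable R : realType.
Local Notation rc := (real_complex R).
Variables (N : nat) (o : 'I_N) (L b : R).
Hypotheses (hN : (2 <= N)%N) (L0 : 0 < L) (b0 : 0 < b).
Variable e : 'I_N -> graph_edge L b.

Definition sine_but1 k r : R[i] := prod_but1 (fun l => edge_sine (e l) L r) k.
Definition sine_but2 j k r : R[i] := prod_but2 (fun l => edge_sine (e l) L r) j k.
Definition pruned k r : R[i] := pruned_Delta o (fun l => edge_sine (e l) L r)
  (fun j => edge_dS (e j) L r) (fun j => edge_C (e j) L r) k.
Definition edges_Delta r : R[i] := star_Delta o (fun l => edge_S (e l) L r)
  (fun j => edge_dS (e j) L r) (fun j => edge_C (e j) L r).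
Definition edges_DeltaK k r : R[i] := star_DeltaK o (fun l => edge_S (e l) L r)
  (fun j => edge_dS (e j) L r) (fun j => edge_C (e j) L r) (fun j => edge_dC (e j) L r) k.

Let LL : 0 <= L <= L. Proof. by rewrite lexx ltW. Qed.
Let gap0 : 0 <= 2 * L. Proof. by rewrite mulr_ge0// ltW. Qed.
Let mcst (u : R) : measurable_fun setT (fun _ : R => u). Proof. exact: measurable_cst. Qed.
Let N_pred : N.-1 = N.-2.+1. Proof. by case: N hN => // -[]. Qed.

Lemma sine_but2_wavefront j k : j != k -> wavefront L (fun=> N.-2%:R * - L) (fun=> 2 * L)
  (half_i R ^+ N.-2) (prod_const N L b) (fun _ => sine_but2 j k).
Proof.
move=> jk; have := wavefront_prod [pred l | (l != j) && (l != k)] gap0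
  (fun l => edge_sine_end_wavefront (ltW L0) b0 (e l)).
rewrite card_but2//; apply: wavefront_le; apply: le_prod_const => //.
exact: leq_trans (leq_pred _) (leq_pred _).
Qed.

Lemma sine_but1_wavefront k : wavefront L (fun=> N.-1%:R * - L) (fun=> 2 * L)
  (half_i R ^+ N.-1) (prod_const N L b) (fun _ => sine_but1 k).
Proof.
have := wavefront_prod [pred l | l != k] gap0 (fun l => edge_sine_end_wavefront (ltW L0) b0 (e l)).
by rewrite card_but1; apply: wavefront_le; apply: le_prod_const => //; exact: leq_pred.
Qed.

Let pruned_term_wavefront k j (f : R -> R[i]) : j != k ->
  wavefront L (fun=> - L) (fun=> 2 * L) (rc 2^-1) (end_const L b) (fun _ => f) ->
  wavefront L (fun=> N.-1%:R * - L) (fun=> 2 * L) (rc 2^-1 * half_i R ^+ N.-2)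
    (3 * (end_const L b * prod_const N L b)) (fun _ r => f r * sine_but2 j k r).
Proof.
move=> jk ff; have := @wavefrontM _ _ _ _ _ _ _ _ _ _ _ _ (fun=> 2 * L) (mcst _) (mcst _) _ ff
  (sine_but2_wavefront jk).
move=> /(_ (fun _ _ => And3 gap0 (lexx _) (lexx _))); apply: eq_wavefront => // x.
by rewrite N_pred -[in RHS]add1n natrD mulrDl mul1r.
Qed.

Lemma pruned_wavefront k : k != o -> wavefront L (fun=> N.-1%:R * - L) (fun=> 2 * L)
  ((rc 2^-1 * half_i R ^+ N.-2) *+ N.-1) (pruned_const N L b) (fun _ => pruned k).
Proof.
move=> ko; have ok : o != k by rewrite eq_sym.
have terms := wavefront_sum (P := [pred j | (j != o) && (j != k)])
  (fun j => fun Pj => pruned_term_wavefront (proj2 (andP Pj))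
    (edge_dS_end_wavefront (ltW L0) b0 (e j))).
have := wavefrontD (pruned_term_wavefront ok (edge_C_end_wavefront (ltW L0) b0 (e o))) terms.
by rewrite !sumr_const card_but2// -!mulrS -N_pred.
Qed.

Lemma spectral_sine_but2 j k : j != k ->
  spectral (N.-2%:R * - L) (prod_const N L b) (sine_but2 j k).
Proof. by move=> /sine_but2_wavefront/(spectral_wavefront_cst L0). Qed.

Lemma spectral_sine_but1 k : spectral (N.-1%:R * - L) (prod_const N L b) (sine_but1 k).
Proof. exact: spectral_wavefront_cst L0 (sine_but1_wavefront k). Qed.

Lemma spectral_pruned k : k != o -> spectral (N.-1%:R * - L) (pruned_const N L b) (pruned k).
Proof. by move=> /pruned_wavefront/(spectral_wavefront_cst L0). Qed.

(* The solution on the leaf k with Cauchy data at the centre built from the other edges; its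
   Cauchy data at the free end are the scaled characteristic functions. *)
Definition leaf_sol k x r : R[i] :=
  rc r ^+ N.-1 * edges_Delta r * edge_C (e k) x r -
  rc r ^+ N.-1 * edges_DeltaK k r * edge_S (e k) x r.
Definition dleaf_sol k x r : R[i] :=
  rc r ^+ N.-1 * edges_Delta r * edge_dC (e k) x r -
  rc r ^+ N.-1 * edges_DeltaK k r * edge_dS (e k) x r.

Lemma leaf_sol_is_sol k r : is_sol L (edge_potential (e k)) r ((leaf_sol k)^~ r)
  ((dleaf_sol k)^~ r).
Proof. exact: is_sol_lin (edge_C_sol (e k) r) (edge_S_sol (e k) r). Qed.

Lemma leaf_sol_end k r : k != o -> leaf_sol k L r = sine_but1 k r.
Proof.
move=> ko; rewrite /leaf_sol /sine_but1 prod_but1Z /edges_Delta (star_Delta_pruned _ _ _ ko).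
rewrite /edges_DeltaK /star_DeltaK -!mulrA -mulrBr; congr (_ * _).
by rewrite -[RHS]mulr1 -(edge_wronskian (ltW L0) (e k) r); ring.
Qed.

Lemma dleaf_sol_end k r : k != o -> dleaf_sol k L r = - (rc r * pruned k r).
Proof.
move=> ko; rewrite /dleaf_sol /pruned pruned_DeltaZ// /edges_Delta (star_Delta_pruned _ _ _ ko).
rewrite /edges_DeltaK /star_DeltaK -!mulrA -mulrBr [in RHS]mulrA -exprS -N_pred -[RHS]mulrN.
by congr (_ * _); rewrite -[RHS]mulr1 -(edge_wronskian (ltW L0) (e k) r); ring.
Qed.

Lemma leaf_sol0 k r : leaf_sol k 0 r = rc r ^+ N.-1 * edges_Delta r.
Proof. by rewrite /leaf_sol edge_C0 edge_S0 mulr1 mulr0 subr0. Qed.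

Lemma dleaf_sol0 k r : dleaf_sol k 0 r = - (rc r ^+ N.-1 * edges_DeltaK k r).
Proof. by rewrite /dleaf_sol edge_dC0 edge_dS0 mulr1 mulr0 sub0r. Qed.

Definition leaf_start k x r : R[i] :=
  sine_but1 k r * rc (cos (r * (L - x))) + pruned k r * rc (sin (r * (L - x))).

Lemma leaf_sol_asymptotic k : k != o -> asymptotic L (fun x => N.-1%:R * - L - (L - x))
  (volterra_const L b * leaf_start_const N L b) (leaf_start k) (leaf_sol k).
Proof.
move=> ko; have sY := spectral_sine_but1 k; have sX := spectral_pruned ko.
apply: (backward_asymptotic (ltW L0) b0 (edge_potential_le (e k)) (edge_potential_supported (e k))
  (leaf_sol_is_sol k)) => [|x /andP[x0 xL]|x r].
- apply: cmeas2D; apply: cmeas2M; first exact: (cmeas2_snd (cmeas_spectral sY)).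
  + exact: (cmeas2_reflect L (@cmeas2_cos R)).
  + exact: (cmeas2_snd (cmeas_spectral sX)).
  + exact: (cmeas2_reflect L (@cmeas2_sin R)).
- have := spectralD (spectralM sY (spectral_cos (L - x))) (spectralM sX (spectral_sin (L - x))).
  by rewrite ger0_norm ?subr_ge0// !mulr1.
- rewrite leaf_sol_end// dleaf_sol_end// mulNr opprK; congr (_ + _).
  by rewrite mulrAC -rmorphM mulr_sindiv mulrC.
Qed.

Let mreflect : measurable_fun setT (fun x : R => L - x).
Proof. by apply: measurable_funB => //; exact: measurable_cst. Qed.

Let leaf_perturb_ge0 : 0 <= volterra_const L b * leaf_start_const N L b.
Proof. by rewrite mulr_ge0 ?volterra_const_ge0// leaf_start_const_ge0. Qed.

Lemma leaf_sol_wavefront k : k != o -> wavefront L (fun x => N.-1%:R * - L - (L - x))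
  (fun x => 2 * (L - x)) (leaf_lead R N) (leaf_const N L b)
  (fun x r => edge_mask L x * leaf_sol k x r).
Proof.
move=> ko; apply: (asymptotic_wavefront leaf_perturb_ge0 (leaf_sol_asymptotic ko)) => //.
have reflect0 x : 0 < x < L -> 0 <= L - x by move=> /andP[_ xL]; rewrite subr_ge0 ltW.
have gap (x : R) : 0 < x < L ->
    [/\ 0 <= 2 * (L - x), 2 * (L - x) <= 2 * L & 2 * (L - x) <= 2 * (L - x)].
  move=> xL; have := reflect0 x xL; case/andP: xL => x0 _ Lx0; split; lra.
have mN : measurable_fun setT (fun x : R => - (L - x)) by exact: measurableT_comp.
have front_cos := wavefrontM (mcst _) mN gap (sine_but1_wavefront k)
  (wavefront_cos mreflect reflect0).
have front_sin := wavefrontM (mcst _) mN gap (pruned_wavefront ko)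
  (wavefront_sin mreflect reflect0).
have := wavefrontD front_cos front_sin; rewrite !mulr1 -mulrDr; apply: eq_wavefront => //.
rewrite /leaf_lead -[X in _ = _ *+ X](prednK (ltnW hN)) [RHS]mulrS mulrC.
by rewrite mulrnAl -mulrA -exprSr -N_pred.
Qed.

Definition leaf_wave_plus k r : R[i] :=
  (rc 2^-1 * sine_but1 k r + half_i R * pruned k r) * cis (- L * r).
Definition leaf_wave_minus k r : R[i] :=
  (rc 2^-1 * sine_but1 k r - half_i R * pruned k r) * cis (L * r).

Lemma leaf_start_waves k x r :
  leaf_start k x r = plane_waves (leaf_wave_plus k) (leaf_wave_minus k) x r.
Proof.
rewrite /plane_waves /leaf_start cos_cis sin_cis -![_ * cis _ * cis _]mulrA -!cisD.
have -> : - L * r + x * r = - (r * (L - x)) by ring.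
have -> : L * r + - x * r = r * (L - x) by ring.
by ring.
Qed.

Lemma leaf_sol_waves k : k != o -> asymptotic_waves L (leaf_const N L b)
  (leaf_wave_plus k) (leaf_wave_minus k) (fun x r => edge_mask L x * leaf_sol k x r).
Proof.
move=> ko; have sY := spectral_sine_but1 k; have sX := spectral_pruned ko.
have mY : cmeas (fun r => rc 2^-1 * sine_but1 k r).
  by apply: cmeasM; [exact: cmeas_cst|exact: cmeas_spectral sY].
have mX : cmeas (fun r => half_i R * pruned k r).
  by apply: cmeasM; [exact: cmeas_cst|exact: cmeas_spectral sX].
have [msol _ sol_close] := leaf_sol_asymptotic ko.
have start0 := leaf_start_const_ge0 N L0 b0.
have waves_le r : cmod (rc 2^-1 * sine_but1 k r) + cmod (half_i R * pruned k r) <= leaf_const N L b.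
  apply: (@le_trans _ _ (leaf_start_const N L b)).
    have := spectral_bound sY r; have := spectral_bound sX r.
    have := cmod_ge0 (sine_but1 k r); have := cmod_ge0 (pruned k r).
    rewrite !cmodM cmod_half_i cmod_real ger0_norm ?invr_ge0// /leaf_start_const.
    by move: (cmod _) (cmod _) => u v; lra.
  by have := leaf_perturb_ge0; rewrite /leaf_const; lra.
split => //.
- by apply: cmeasM; [exact: cmeasD|exact: cmeas_cisM].
- by apply: cmeasM; [exact: cmeasB|exact: cmeas_cisM].
- move=> r; rewrite !cmodM !cmod_cis !mulr1; split; first exact: le_trans (cmodD _ _) (waves_le r).
  exact: le_trans (cmodB _ _) (waves_le r).
- move=> x r /itvoo_cc xL.
  rewrite edge_mask1// mul1r -leaf_start_waves; apply: le_trans (sol_close x r xL) _.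
  by apply: ler_wpM2r; [exact: decay_ge0|rewrite /leaf_const lerDr addr_ge0// mulr_ge0].
Qed.

Definition root_sol x r : R[i] :=
  edge_sine (e o) L r * edge_C (e o) x r - rc r * edge_C (e o) L r * edge_S (e o) x r.
Definition droot_sol x r : R[i] :=
  edge_sine (e o) L r * edge_dC (e o) x r - rc r * edge_C (e o) L r * edge_dS (e o) x r.

Lemma root_sol_is_sol r : is_sol L (edge_potential (e o)) r (root_sol^~ r) (droot_sol^~ r).
Proof. exact: is_sol_lin (edge_C_sol (e o) r) (edge_S_sol (e o) r). Qed.

Lemma root_sol_end r : root_sol L r = 0. Proof. by rewrite /root_sol /edge_sine; ring. Qed.

Lemma droot_sol_end r : droot_sol L r = - rc r.
Proof.
by rewrite /droot_sol /edge_sine -[RHS]mulr1 -(edge_wronskian (ltW L0) (e o) r); ring.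
Qed.

Lemma root_sol0 r : root_sol 0 r = edge_sine (e o) L r.
Proof. by rewrite /root_sol edge_C0 edge_S0 mulr1 mulr0 subr0. Qed.

Lemma droot_sol0 r : droot_sol 0 r = - (rc r * edge_C (e o) L r).
Proof. by rewrite /droot_sol edge_dC0 edge_dS0 mulr1 mulr0 sub0r. Qed.

Lemma root_sol_asymptotic : asymptotic L (fun x => - (L - x)) (volterra_const L b)
  (fun x r => rc (sin (r * (L - x)))) root_sol.
Proof.
have := @backward_asymptotic _ _ _ _ _ _ (ltW L0) b0 (edge_potential_le (e o))
  (edge_potential_supported (e o)) root_sol_is_sol 0 1 (fun x r => rc (sin (r * (L - x)))).
under [X in asymptotic _ X]eq_fun do rewrite sub0r.
rewrite mulr1; apply=> [|x /andP[_ xL]|x r].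
- exact: (cmeas2_reflect L (@cmeas2_sin R)).
- by have := spectral_sin (L - x); rewrite ger0_norm ?subr_ge0// sub0r.
- by rewrite root_sol_end droot_sol_end mul0r mulNr opprK add0r -rmorphM mulr_sindiv.
Qed.

Lemma root_sol_wavefront : wavefront L (fun x => - (L - x)) (fun x => 2 * (L - x)) (half_i R)
  (root_const L b) (fun x r => edge_mask L x * root_sol x r).
Proof.
apply: (asymptotic_wavefront (volterra_const_ge0 L b) root_sol_asymptotic) => //.
by apply: wavefront_sin mreflect _ => x /andP[_ xL]; rewrite subr_ge0 ltW.
Qed.

Let edges_Delta_scaled k r : k != o -> rc r ^+ N.-1 * edges_Delta r =
  edge_sine (e k) L r * pruned k r + edge_dS (e k) L r * sine_but1 k r.
Proof.
move=> ko; rewrite /edges_Delta (star_Delta_pruned _ _ _ ko) /pruned pruned_DeltaZ//.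
by rewrite /sine_but1 prod_but1Z /edge_sine N_pred exprS; ring.
Qed.

Let edges_DeltaK_scaled k r : k != o -> rc r ^+ N.-2 * edges_DeltaK k r =
  edge_C (e k) L r * pruned k r + edge_dC (e k) L r * (edge_S (e o) L r * sine_but2 o k r).
Proof.
move=> ko; have ok : o != k by rewrite eq_sym.
rewrite /edges_DeltaK /star_DeltaK (prod_but1D1 _ ok) /pruned pruned_DeltaZ//.
by rewrite /sine_but2 prod_but2Z//; ring.
Qed.

Let sine_end_le k r : cmod (edge_sine (e k) L r) <= edge_const L b.
Proof.
have [_ /(_ L LL) s _] := edge_sine_asymptotic (ltW L0) b0 (e k).
exact: spectral_bound s r.
Qed.

Lemma edges_Delta_le k r : k != o -> cmod (rc r ^+ N.-1 * edges_Delta r) <= Delta_const N L b.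
Proof.
move=> ko; rewrite (edges_Delta_scaled _ ko).
have X_le := spectral_bound (spectral_pruned ko) r.
have dS_le := spectral_bound (spectral_edge_dS (ltW L0) b0 (e k)) r.
have Y_le := spectral_bound (spectral_sine_but1 k) r.
apply: le_trans (cmodD _ _) _; rewrite (cmodM (edge_sine _ _ _)) (cmodM (edge_dS _ _ _)).
apply: le_trans (lerD (ler_pM (cmod_ge0 _) (cmod_ge0 _) (sine_end_le k r) X_le)
  (ler_pM (cmod_ge0 _) (cmod_ge0 _) dS_le Y_le)) _.
rewrite -mulrDr [pruned_const _ _ _ + _]addrC; apply: ler_wpM2r; first exact: leaf_start_const_ge0.
by rewrite lerDl mulr_ge0 ?edge_const_ge0 ?ltW.
Qed.

(* The derivative of C grows like r and S decays like 1 / r. *)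
Let edge_dC_S_le j k r : cmod (edge_dC (e k) L r * edge_S (e j) L r) <=
  edge_const L b * edge_const L b + edge_const L b.
Proof.
have [_ /(_ L LL) sS _] := edge_S_asymptotic (ltW L0) b0 (e j).
rewrite [X in cmod X](_ : _ = (edge_dC (e k) L r + rc (r * sin (r * L))) * edge_S (e j) L r -
    rc (sin (r * L)) * edge_sine (e j) L r); last by rewrite /edge_sine rmorphM; ring.
apply: le_trans (cmodB _ _) _; rewrite (cmodM (_ + _)) (cmodM (rc (sin _))); apply: lerD.
  by apply: ler_pM; rewrite ?cmod_ge0 ?edge_dC_le ?(ltW L0)//; exact: spectral_bound sS r.
rewrite -[leRHS]mul1r; apply: ler_pM; rewrite ?cmod_ge0 ?sine_end_le//.
by rewrite cmod_real norm_sin_le1.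
Qed.

Lemma edges_DeltaK_le k r : k != o -> cmod (rc r ^+ N.-2 * edges_DeltaK k r) <= Delta_const N L b.
Proof.
move=> ko; have ok : o != k by rewrite eq_sym.
have [_ /(_ L LL) sC _] := edge_C_asymptotic (ltW L0) b0 (e k).
have X_le := spectral_bound (spectral_pruned ko) r.
have P_le := spectral_bound (spectral_sine_but2 ok) r.
rewrite (edges_DeltaK_scaled _ ko) [X in _ + X]mulrA; apply: le_trans (cmodD _ _) _.
rewrite (cmodM (edge_C _ _ _)) (cmodM (_ * _)).
apply: le_trans (lerD (ler_pM (cmod_ge0 _) (cmod_ge0 _) (spectral_bound sC r) X_le)
  (ler_pM (cmod_ge0 _) (cmod_ge0 _) (edge_dC_S_le o k r) P_le)) _.
have -> : Delta_const N L b =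
    (edge_const L b + edge_const L b * edge_const L b) * pruned_const N L b +
    (edge_const L b * edge_const L b + edge_const L b) * prod_const N L b.
  by rewrite /Delta_const /leaf_start_const; ring.
by rewrite lerD2r ler_wpM2r ?pruned_const_ge0// lerDl mulr_ge0 ?edge_const_ge0 ?ltW.
Qed.

Lemma cmeas_edges_Delta k : k != o -> cmeas (fun r => rc r ^+ N.-1 * edges_Delta r).
Proof.
move=> ko; have [_ /(_ L LL) s_sine _] := edge_sine_asymptotic (ltW L0) b0 (e k).
apply: (eq_cmeas (fun r => esym (edges_Delta_scaled r ko))); apply: cmeasD; apply: cmeasM.
- exact: cmeas_spectral s_sine.
- exact: cmeas_spectral (spectral_pruned ko).
- exact: cmeas_spectral (spectral_edge_dS (ltW L0) b0 (e k)).
- exact: cmeas_spectral (spectral_sine_but1 k).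
Qed.

Lemma cmeas_edges_DeltaK k : k != o -> cmeas (fun r => rc r ^+ N.-2 * edges_DeltaK k r).
Proof.
move=> ko; have ok : o != k by rewrite eq_sym.
have [_ /(_ L LL) sC _] := edge_C_asymptotic (ltW L0) b0 (e k).
have [_ /(_ L LL) sS _] := edge_S_asymptotic (ltW L0) b0 (e o).
apply: (eq_cmeas (fun r => esym (edges_DeltaK_scaled r ko))); apply: cmeasD; apply: cmeasM.
- exact: cmeas_spectral sC.
- exact: cmeas_spectral (spectral_pruned ko).
- exact: cmeas_edge_dC (ltW L0) b0 (e k).
- by apply: cmeasM; [exact: cmeas_spectral sS|exact: cmeas_spectral (spectral_sine_but2 ok)].
Qed.

End StarGraph.

(** * Stability *)

Section Pairing.
Variables (R : realType) (L : R).

Definition pairing (f : R -> R[i]) (y z : R -> R -> R[i]) r : R[i] :=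
  cint (fun x => f x * ((edge_mask L x * y x r) * (edge_mask L x * z x r))).

Variables (Q Q' : R -> R[i]) (b b' : R).
Hypotheses (L0 : 0 <= L) (Qb : sqint_le Q b) (Q'b : sqint_le Q' b').
Hypotheses (Q0 : supported L Q) (Q'0 : supported L Q').

Let f x := Q x - Q' x.
Let iQ := supported_cintegrable L0 Qb.1 Q0.
Let iQ' := supported_cintegrable L0 Q'b.1 Q'0.

Lemma lagrange_pairing (y z : R -> R -> R[i]) (dy dz : R -> R[i]) r :
  is_sol L Q r (y^~ r) dy -> is_sol L Q' r (z^~ r) dz ->
  pairing f y z r = (y 0 r * dz 0 - dy 0 * z 0 r) - (y L r * dz L - dy L * z L r).
Proof.
move=> soly solz; rewrite (lagrange iQ iQ' soly solz (lexx 0) L0 (lexx L)).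
apply: eq_cint => x; have [xL|/(supportedB Q0 Q'0)] := boolP (0 < x < L); first by rewrite mul1r.
by rewrite /f => ->; rewrite !mul0r.
Qed.

Lemma pairingZ (y z : R -> R -> R[i]) (dy dz : R -> R[i]) (c : R[i]) r :
  is_sol L Q r (y^~ r) dy -> is_sol L Q' r (z^~ r) dz ->
  c * pairing f y z r =
  cint (fun x => f x * (c * ((edge_mask L x * y x r) * (edge_mask L x * z x r)))).
Proof.
move=> soly solz; rewrite /pairing -cintZ; last exact: cintegrable_lagrange iQ iQ' soly solz.
by apply: eq_cint => x; rewrite mulrCA.
Qed.

Lemma spectral_pairing s M M' (y0 z0 y z : R -> R -> R[i]) :
  asymptotic L s M y0 y -> asymptotic L s M' z0 z -> (forall x, 0 <= x <= L -> - L <= s x) ->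
  exists K, spectral (- 2 * L) K (pairing f y z).
Proof.
move=> [my sy _] [mz sz _] s_ge; exists (M * M' * \int[lebesgue_measure]_x cmod (f x)).
apply: spectral_cintM; [exact: cintegrableB|exact: (cmeas2M my mz)|].
move=> x /(supported_neq0 (supportedB Q0 Q'0))/itvoo_cc xL.
have ss_ge : - 2 * L <= s x + s x by have := s_ge x xL; lra.
apply: eq_spectral (spectral_le ss_ge (lexx _) (spectralM (sy x xL) (sz x xL))) => r.
by rewrite edge_mask1// !mul1r.
Qed.

End Pairing.

Section CrossDelta.
Variable R : realType.
Local Notation rc := (real_complex R).
Variables (N : nat) (o : 'I_N) (L b : R).
Hypotheses (hN : (2 <= N)%N) (L0 : 0 < L) (b0 : 0 < b).
Variables e e' : 'I_N -> graph_edge L b.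

Definition potential_diff j x : R[i] := edge_potential (e j) x - edge_potential (e' j) x.

Definition cross_Delta k r : R[i] :=
  rc r ^+ N.-1 * edges_DeltaK o e k r * (rc r ^+ N.-1 * edges_Delta o e' r)
  - rc r ^+ N.-1 * edges_Delta o e r * (rc r ^+ N.-1 * edges_DeltaK o e' k r).

Definition leaf_pairing k r : R[i] :=
  pairing L (potential_diff k) (leaf_sol o e k) (leaf_sol o e' k) r.
Definition root_pairing r : R[i] := pairing L (potential_diff o) (root_sol o e) (root_sol o e') r.
Definition sine_pairing j r : R[i] :=
  pairing L (potential_diff j) (edge_sine (e j)) (edge_sine (e' j)) r.

Definition sine_but2M j k r : R[i] := sine_but2 e j k r * sine_but2 e' j k r.

Definition inner_pairings k r : R[i] := sine_but2M o k r * root_pairing r +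
  \sum_(j | (j != o) && (j != k)) sine_but2M j k r * sine_pairing j r.

Let N_pred : N.-1 = N.-2.+1. Proof. by case: N hN => // -[]. Qed.

Let edge_lagrange j := lagrange_pairing (ltW L0) (edge_potential_le (e j)) (edge_potential_le (e' j))
  (edge_potential_supported (e j)) (edge_potential_supported (e' j)).

Let edge_pairingZ j := pairingZ (ltW L0) (edge_potential_le (e j)) (edge_potential_le (e' j))
  (edge_potential_supported (e j)) (edge_potential_supported (e' j)).

Lemma potential_diff_supported j : supported L (potential_diff j).
Proof. exact: supportedB (edge_potential_supported _) (edge_potential_supported _). Qed.

Lemma sqint_potential_diff j : sqint (potential_diff j).
Proof. exact: (sqint_leB (edge_potential_le (e j)) (edge_potential_le (e' j))).1. Qed.

Lemma leaf_pairingE k r : k != o -> leaf_pairing k r = cross_Delta k r -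
  rc r * (pruned o e k r * sine_but1 e' k r - sine_but1 e k r * pruned o e' k r).
Proof.
move=> ko; rewrite /leaf_pairing
  (edge_lagrange (leaf_sol_is_sol o e k r) (leaf_sol_is_sol o e' k r)).
by rewrite !leaf_sol_end// !dleaf_sol_end// !leaf_sol0 !dleaf_sol0 /cross_Delta; ring.
Qed.

Lemma root_pairingE r : root_pairing r = rc r * (edge_C (e o) L r * edge_sine (e' o) L r -
  edge_sine (e o) L r * edge_C (e' o) L r).
Proof.
rewrite /root_pairing (edge_lagrange (root_sol_is_sol o e r) (root_sol_is_sol o e' r)).
by rewrite !root_sol0 !droot_sol0 !root_sol_end; ring.
Qed.

Lemma sine_pairingE j r : sine_pairing j r = rc r * (edge_dS (e j) L r * edge_sine (e' j) L r -
  edge_sine (e j) L r * edge_dS (e' j) L r).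
Proof.
rewrite /sine_pairing (edge_lagrange (edge_sine_sol (e j) r) (edge_sine_sol (e' j) r)).
by rewrite /edge_sine !edge_S0; ring.
Qed.

Theorem cross_DeltaE k r : k != o -> cross_Delta k r = leaf_pairing k r + inner_pairings k r.
Proof.
move=> ko; rewrite leaf_pairingE// [pruned o e k r * _ - _]pruned_Delta_cross// mulrDr mulr_sumr.
rewrite /inner_pairings root_pairingE mulrCA -addrA; apply/esym; rewrite -[RHS]addr0; congr (_ + _).
rewrite addrC; apply/eqP; rewrite subr_eq0; apply/eqP; congr (_ + _).
by apply: eq_bigr => j _; rewrite sine_pairingE mulrCA.
Qed.

Lemma spectral_inner_pairings k : k != o ->
  exists M, spectral (2 * (N.-1%:R * - L)) M (inner_pairings k).
Proof.
move=> ko; have ok : o != k by rewrite eq_sym.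
have exponentE : N.-2%:R * - L + N.-2%:R * - L + - 2 * L = 2 * (N.-1%:R * - L) :> R.
  by rewrite N_pred -natr1; ring.
have spectral_term j M (p : R -> R[i]) : j != k -> spectral (- 2 * L) M p ->
    spectral (2 * (N.-1%:R * - L)) (prod_const N L b * prod_const N L b * M)
      (fun r => sine_but2M j k r * p r).
  move=> jk sp; rewrite -exponentE; apply: spectralM _ sp.
  exact: spectralM (spectral_sine_but2 L0 b0 e jk) (spectral_sine_but2 L0 b0 e' jk).
have [Mo so] : exists M, spectral (- 2 * L) M root_pairing.
  apply: (spectral_pairing (ltW L0) (edge_potential_le _) (edge_potential_le _)
    (edge_potential_supported _) (edge_potential_supported _)
    (root_sol_asymptotic o L0 b0 e) (root_sol_asymptotic o L0 b0 e')) => x /andP[x0 _]; lra.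
have /choice[M sj] j : exists M, spectral (- 2 * L) M (sine_pairing j).
  apply: (spectral_pairing (ltW L0) (edge_potential_le _) (edge_potential_le _)
    (edge_potential_supported _) (edge_potential_supported _)
    (edge_sine_asymptotic (ltW L0) b0 (e j)) (edge_sine_asymptotic (ltW L0) b0 (e' j)))
    => x /andP[_ xL].
  by rewrite lerN2.
eexists; apply: spectralD (spectral_term o Mo _ ok so) _.
by apply: spectral_sum => j /andP[_ jk]; exact: spectral_term (sj j).
Qed.

Definition leaf_pair_lead : R[i] := leaf_lead R N * leaf_lead R N.
Definition leaf_pair_const : R := 3 * (leaf_const N L b * leaf_const N L b).

Let gap (x : R) : 0 < x < L ->
  [/\ 0 <= 2 * L - 2 * x, 2 * L - 2 * x <= 2 * (L - x) & 2 * L - 2 * x <= 2 * (L - x)].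
Proof. by move=> /andP[_ xL]; split; lra. Qed.

Let mcst (u : R) : measurable_fun setT (fun _ : R => u). Proof. exact: measurable_cst. Qed.

Let mreflect : measurable_fun setT (fun x : R => - (L - x)).
Proof. by apply: measurableT_comp => //; apply: measurable_funB. Qed.

Let leaf_pair_wavefront k : k != o -> wavefront L (fun x => 2 * (N.-1%:R * - L) - 2 * L + 2 * x)
  (fun x => 2 * L - 2 * x) leaf_pair_lead leaf_pair_const
  (fun x r => (edge_mask L x * leaf_sol o e k x r) * (edge_mask L x * leaf_sol o e' k x r)).
Proof.
move=> ko; have mlin : measurable_fun setT (fun x : R => N.-1%:R * - L - (L - x)).
  by apply: measurable_funD => //; exact: mcst.
have := wavefrontM mlin mlin gap (leaf_sol_wavefront hN L0 b0 e ko)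
  (leaf_sol_wavefront hN L0 b0 e' ko).
by apply: eq_wavefront => // x; ring.
Qed.

Lemma leaf_recovery K a k : recovers L leaf_pair_const leaf_pair_lead K -> k != o ->
  sqint_le (cross_Delta k) a -> sqnorm (potential_diff k) <= K * a.
Proof.
move=> rec ko /(eq_sqint_le (fun r => cross_DeltaE r ko)).
have [M s_inner] := spectral_inner_pairings ko.
apply: (rec _ _ _ (2 * (N.-1%:R * - L) - 2 * L) M _ (sqint_potential_diff k)
  (potential_diff_supported k) (leaf_pair_wavefront ko)).
by rewrite subrK.
Qed.

Definition root_pair_lead : R[i] :=
  (half_i R ^+ N.-2 * half_i R ^+ N.-2) * (half_i R * half_i R).
Definition root_pair_const : R :=
  3 * ((3 * (prod_const N L b * prod_const N L b)) * (3 * (root_const L b * root_const L b))).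

Let root_pair_wavefront k : k != o -> wavefront L (fun x => 2 * (N.-2%:R * - L) - 2 * L + 2 * x)
  (fun x => 2 * L - 2 * x) root_pair_lead root_pair_const
  (fun x r => sine_but2M o k r *
    ((edge_mask L x * root_sol o e x r) * (edge_mask L x * root_sol o e' x r))).
Proof.
move=> ko; have ok : o != k by rewrite eq_sym.
have gap2 (x : R) : 0 < x < L -> [/\ 0 <= 2 * L, 2 * L <= 2 * L & 2 * L <= 2 * L].
  by move=> _; rewrite lexx mulr_ge0// ltW.
have front_but2 := wavefrontM (mcst _) (mcst _) gap2 (sine_but2_wavefront L0 b0 e ok)
  (sine_but2_wavefront L0 b0 e' ok).
have front_root := wavefrontM mreflect mreflect gap (root_sol_wavefront o L0 b0 e)
  (root_sol_wavefront o L0 b0 e').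
have gap_min (x : R) : 0 < x < L ->
    [/\ 0 <= 2 * L - 2 * x, 2 * L - 2 * x <= 2 * L & 2 * L - 2 * x <= 2 * L - 2 * x].
  by move=> /andP[x0 xL]; split; lra.
have := wavefrontM (mcst _) (measurable_funD mreflect mreflect) gap_min front_but2 front_root.
by apply: eq_wavefront => // x; rewrite /=; ring.
Qed.

Section MeanZero.
Variable a : R.
Hypothesis mean0 : forall j, cint (potential_diff j) = 0.
Hypothesis leaf_le : forall j, j != o -> sqnorm (potential_diff j) <= a.

Lemma leaf_pairing_upper k : k != o ->
  sqint_le (leaf_pairing k) (wave_pairing_const L (leaf_const N L b) * a).
Proof.
move=> ko; apply: (wave_pairing_upper (ltW L0) (conj (sqint_potential_diff k) (leaf_le ko))
  (@potential_diff_supported k) (mean0 k) (leaf_sol_waves hN L0 b0 e ko)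
    (leaf_sol_waves hN L0 b0 e' ko)).
Qed.

Let sine_waves (d : graph_edge L b) (p : R -> R[i]) : cmeas p ->
  (forall r, cmod (p r) <= prod_const N L b) ->
  asymptotic_waves L (prod_const N L b * edge_const L b) (fun r => - half_i R * p r)
    (fun r => half_i R * p r) (fun x r => p r * (edge_mask L x * edge_sine d x r)).
Proof.
move=> mp p_le; have [msine _ sine_close] := edge_sine_asymptotic (ltW L0) b0 d.
have half_le r : cmod (half_i R * p r) <= prod_const N L b * edge_const L b.
  rewrite cmodM cmod_half_i mulrC; apply: ler_pM; rewrite ?cmod_ge0 ?invr_ge0//.
  by apply: le_trans (edge_const_ge1 (ltW L0) b0); rewrite invf_le1// ler1n.
split.
- by apply: cmeasM => //; exact: cmeas_cst.
- by apply: cmeasM => //; exact: cmeas_cst.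
- by apply: cmeas2M => //; exact: (cmeas2_snd mp).
- by move=> r; rewrite mulNr cmodN.
move=> x r /itvoo_cc xL.
rewrite [X in cmod X](_ : _ = p r * (edge_sine d x r - rc (sin (r * x)))).
  by rewrite cmodM -mulrA ler_pM ?cmod_ge0 ?sine_close.
by rewrite /plane_waves edge_mask1// sin_cis -[- (r * x)]mulrN [r * - x]mulrC [r * x]mulrC; ring.
Qed.

Lemma sine_pairing_upper j k : j != o -> j != k ->
  sqint_le (fun r => sine_but2M j k r * sine_pairing j r)
    (wave_pairing_const L (prod_const N L b * edge_const L b) * a).
Proof.
move=> jo jk; have sP := spectral_sine_but2 L0 b0 e jk; have sP' := spectral_sine_but2 L0 b0 e' jk.
have := wave_pairing_upper (ltW L0) (conj (sqint_potential_diff j) (leaf_le jo))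
  (@potential_diff_supported j) (mean0 j) (sine_waves (e j) (cmeas_spectral sP) (spectral_bound sP))
  (sine_waves (e' j) (cmeas_spectral sP') (spectral_bound sP')).
apply: eq_sqint_le => r; rewrite /sine_pairing.
rewrite [RHS](edge_pairingZ _ (edge_sine_sol (e j) r) (edge_sine_sol (e' j) r)).
by apply: eq_cint => x; rewrite /sine_but2M /potential_diff; ring.

Qed.

Definition root_transfer_const : R := wave_pairing_const L (leaf_const N L b) +
  2 ^+ N.-2 * (wave_pairing_const L (prod_const N L b * edge_const L b) *+ N.-2).

Lemma root_recovery K c k : recovers L root_pair_const root_pair_lead K -> k != o ->
  sqint_le (cross_Delta k) c ->
  sqnorm (potential_diff o) <= K * (2 * c + 2 * (2 * (root_transfer_const * a))).
Proof.
move=> rec ko cross_le; have ok : o != k by rewrite eq_sym.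
have sine_le := sqint_le_sum (fun j (Pj : (j != o) && (j != k)) =>
  sine_pairing_upper (proj1 (andP Pj)) (proj2 (andP Pj))).
have root_le := sqint_leB cross_le (sqint_leD (leaf_pairing_upper ko) sine_le).
have root_eq r : cross_Delta k r - (leaf_pairing k r +
    \sum_(j | (j != o) && (j != k)) sine_but2M j k r * sine_pairing j r) =
    cint (fun x => potential_diff o x * (sine_but2M o k r *
      ((edge_mask L x * root_sol o e x r) * (edge_mask L x * root_sol o e' x r)))) + 0.
  rewrite cross_DeltaE// addr0 -(edge_pairingZ _ (root_sol_is_sol o e r) (root_sol_is_sol o e' r)).
  by rewrite /inner_pairings /root_pairing; ring.
have := rec _ _ (fun=> 0) (2 * (N.-2%:R * - L) - 2 * L) 0 _ (sqint_potential_diff o)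
  (@potential_diff_supported o) (root_pair_wavefront ko) (spectral0 _)
    (eq_sqint_le root_eq root_le).
rewrite sumr_const card_but2// => /le_trans; apply; rewrite le_eqVlt; apply/orP; left; apply/eqP.
by rewrite /root_transfer_const -mulrnAl; ring.
Qed.

End MeanZero.
End CrossDelta.

Section Stability.
Variables (R : realType) (N : nat) (o : 'I_N) (L b : R).
Hypotheses (hN : (2 <= N)%N) (L0 : 0 < L) (b0 : 0 < b).

Lemma leaf_exists : exists k, k != o.
Proof.
have : (0 < #|[pred k : 'I_N | k != o]|)%N by rewrite card_but1; case: N hN => // -[].
by case/card_gt0P => k; exists k.
Qed.

Theorem cross_Delta_stability : exists2 A, 0 <= A & forall (e e' : 'I_N -> graph_edge L b) c,
  (forall j, cint (potential_diff e e' j) = 0) ->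
  (forall k, k != o -> sqint_le (cross_Delta o e e' k) c) ->
  forall j, sqint_le (potential_diff e e' j) (A * c).
Proof.
have half_neq0 := half_i_neq0 R.
have leaf_neq0 : leaf_pair_lead R N != 0 by rewrite mulf_neq0 ?leaf_lead_neq0// ltnW.
have root_neq0 : root_pair_lead R N != 0 by rewrite !mulf_neq0 ?expf_neq0.
have [K K0 leaf_rec] := wavefront_recovery (leaf_pair_const N L b) L0 leaf_neq0.
have [K' K'0 root_rec] := wavefront_recovery (root_pair_const N L b) L0 root_neq0.
pose A := K' * (2 + 2 * (2 * (root_transfer_const N L b * K))).
have A0 : 0 <= A.
  have wave0 M := wave_pairing_const_ge0 M (ltW L0).
  rewrite mulr_ge0// addr_ge0// mulr_ge0// mulr_ge0// mulr_ge0//.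
  by rewrite addr_ge0// mulr_ge0 ?exprn_ge0// mulrn_wge0.
exists (K + A); first exact: addr_ge0.
move=> e e' c mean0 cross_le j; split; first exact: sqint_potential_diff.
have [k ko] := leaf_exists; have c0 := sqint_le_ge0 (cross_le k ko).
have leaf_le i : i != o -> sqnorm (potential_diff e e' i) <= K * c.
  by move=> io; exact: leaf_recovery hN L0 b0 e e' K c i leaf_rec io (cross_le i io).
have [->|/leaf_le/le_trans] := eqVneq j o; last by apply; rewrite ler_wpM2r// lerDl.
have := root_recovery hN L0 b0 mean0 leaf_le root_rec ko (cross_le k ko).
move=> /le_trans; apply; rewrite [leRHS]mulrDl -[leLHS]add0r; apply: lerD; first exact: mulr_ge0.
by rewrite le_eqVlt; apply/orP; left; apply/eqP; rewrite /A; ring.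
Qed.

End Stability.

(** * From spectral data to potentials *)

Section CrossDeltaUpper.
Variable R : realType.
Local Notation rc := (real_complex R).
Variables (N : nat) (o : 'I_N) (L b : R).
Hypotheses (hN : (2 <= N)%N) (L0 : 0 < L) (b0 : 0 < b).
Variables e e' : 'I_N -> graph_edge L b.

Definition scaled_Delta_diff r : R[i] := rc r ^+ N * (edges_Delta o e r - edges_Delta o e' r).
Definition scaled_DeltaK_diff k r : R[i] :=
  rc r ^+ N.-1 * (edges_DeltaK o e k r - edges_DeltaK o e' k r).

Let exprN z : z ^+ N = z * z ^+ N.-1 :> R[i].
Proof. by rewrite -exprS prednK// ltnW. Qed.
Let exprN1 z : z ^+ N.-1 = z * z ^+ N.-2 :> R[i].
Proof. by rewrite -exprS; case: N hN => // -[]. Qed.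

Let cmeas_rho : cmeas (fun r : R => rc r).
Proof. by apply: cmeas_real; exact: measurable_id. Qed.

Lemma cmeas_scaled_Delta_diff : cmeas scaled_Delta_diff.
Proof.
have [k ko] := leaf_exists o hN.
have := cmeasM cmeas_rho
  (cmeasB (cmeas_edges_Delta hN L0 b0 e ko) (cmeas_edges_Delta hN L0 b0 e' ko)).
by apply: eq_cmeas => r; rewrite /scaled_Delta_diff exprN -mulrBr mulrA.
Qed.

Lemma cmeas_scaled_DeltaK_diff k : k != o -> cmeas (scaled_DeltaK_diff k).
Proof.
move=> ko.
have := cmeasM cmeas_rho
  (cmeasB (cmeas_edges_DeltaK hN L0 b0 e ko) (cmeas_edges_DeltaK hN L0 b0 e' ko)).
by apply: eq_cmeas => r; rewrite /scaled_DeltaK_diff exprN1 -mulrBr mulrA.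
Qed.

Lemma cross_Delta_upper k c : k != o -> sqint_le scaled_Delta_diff c ->
  sqint_le (scaled_DeltaK_diff k) c ->
  sqint_le (cross_Delta o e e' k) (4 * Delta_const N L b ^+ 2 * c).
Proof.
move=> ko Delta_le DeltaK_le.
have cross1 := sqint_le_boundedM (cmeas_edges_Delta hN L0 b0 e' ko)
  (fun r => edges_Delta_le hN L0 b0 e' r ko) DeltaK_le.
have cross2 := sqint_le_boundedM (cmeas_edges_DeltaK hN L0 b0 e' ko)
  (fun r => edges_DeltaK_le hN L0 b0 e' r ko) Delta_le.
have -> : 4 * Delta_const N L b ^+ 2 * c =
    2 * (Delta_const N L b ^+ 2 * c) + 2 * (Delta_const N L b ^+ 2 * c) by ring.
apply: eq_sqint_le (sqint_leB cross1 cross2) => r.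
by rewrite /cross_Delta /scaled_Delta_diff /scaled_DeltaK_diff exprN exprN1; ring.
Qed.

End CrossDeltaUpper.

Section SquareNorms.
Variable R : realType.
Local Notation mu := (@lebesgue_measure R).
Local Notation rc := (real_complex R).
Implicit Types (f : R -> R[i]) (D : set R).

Definition truncate D f x : R[i] := rc (\1_D x) * f x.

Lemma truncateT f : truncate setT f = f.
Proof. by apply/funext => x; rewrite /truncate indicT mul1r. Qed.

Lemma cmeas_truncate D f : measurable D -> cmeasurable D f -> cmeas (truncate D f).
Proof.
move=> mD [/(measurable_restrictT _ mD) mRe /(measurable_restrictT _ mD) mIm]; split.
- congr (measurable_fun _ _): mRe; apply/funext => x.
  by rewrite /truncate ReCM /= mul0r subr0 patchE indicE; case: (x \in D); rewrite ?mul1r ?mul0r.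
- congr (measurable_fun _ _): mIm; apply/funext => x.
  by rewrite /truncate ImCM /= mul0r addr0 patchE indicE; case: (x \in D); rewrite ?mul1r ?mul0r.
Qed.

Lemma L2norm_truncate D f :
  L2norm D f = ((\int[mu]_x (cmod (truncate D f x) ^+ 2)%:E) `^ 2^-1)%E.
Proof.
rewrite /L2norm unlock; congr (_ `^ _)%E; apply: eq_integral => x _.
have <- : cmod (truncate D f x) = \1_D x * cmod (f x).
  by rewrite cmodM cmod_real ger0_norm// indicE.
by rewrite /= ger0_norm ?cmod_ge0// powR_mulrn ?cmod_ge0.
Qed.

Lemma sqint_le_L2norm D f a : cmeas (truncate D f) -> 0 <= a -> (L2norm D f <= a%:E)%E ->
  sqint_le (truncate D f) (a ^+ 2).
Proof.
move=> mf a0; rewrite L2norm_truncate => f_le; apply: integral_sqint_le => //.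
have int0 : (0 <= \int[mu]_x (cmod (truncate D f x) ^+ 2)%:E)%E.
  by apply: integral_ge0 => x _; rewrite lee_fin sqr_ge0.
move: f_le int0; case: (\int[mu]_x _)%E => [s| |] //=.
- rewrite !lee_fin => s_le s0; move: s_le; rewrite powR12_sqrt// => s_le.
  by rewrite -(sqr_sqrtr s0) ler_sqr ?nnegrE ?sqrtr_ge0.
- by rewrite invr_eq0 pnatr_eq0.
Qed.

Lemma L2norm_le D f a : 0 <= a -> sqint_le (truncate D f) (a ^+ 2) -> (L2norm D f <= a%:E)%E.
Proof.
move=> a0 [[_ f_int] f_le]; rewrite L2norm_truncate.
have -> : (\int[mu]_x (cmod (truncate D f x) ^+ 2)%:E = (sqnorm (truncate D f))%:E)%E.
  by rewrite integral_rintegrable.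
rewrite poweR_EFin powR12_sqrt ?sqnorm_ge0// lee_fin -[leRHS](ger0_norm a0) -sqrtr_sqr.
exact: ler_wsqrtr.
Qed.

End SquareNorms.

Section PotentialEdge.
Variable R : realType.
Local Notation rc := (real_complex R).
Local Notation edge := (@edge R).
Implicit Types (q : R -> R[i]) (a b : R).

Let truncate_edgeE q x : 0 < x < pi -> truncate edge q x = q x.
Proof. by move=> xp; rewrite /truncate /Defs.edge indicE mem_setE in_itv/= xp mul1r. Qed.

Lemma supported_truncate_edge q : supported pi (truncate edge q).
Proof.
by move=> x /negbTE xp; rewrite /truncate /Defs.edge indicE mem_setE in_itv/= xp mul0r.
Qed.

Lemma SL_solution_is_sol q r y dy : SL_solution q (rc r ^+ 2) y dy ->
  is_sol pi (truncate edge q) r y dy.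
Proof.
move=> [acy acdy y_deriv y_eq]; split => //.
apply: (@filterS _ _ (ae_filter_ringOfSetsType lebesgue_measure) _ _ _ y_eq) => x dy_eq xp.
have [|d2y dy_deriv eq_d2y] := dy_eq; first by rewrite /edge /= in_itv.
have -> : (truncate edge q x - rc r ^+ 2) * y x = d2y; last by [].
by rewrite truncate_edgeE// mulrBl -eq_d2y opprD opprK addrCA subrr addr0.
Qed.

Definition potential_edge q b (Y : edge_solutions q) (q_le : sqint_le (truncate edge q) b) :
    graph_edge pi b :=
  @GraphEdge _ _ _ (truncate edge q)
    (fun x r => solS Y x (rc r ^+ 2)) (fun x r => dsolS Y x (rc r ^+ 2))
    (fun x r => solC Y x (rc r ^+ 2)) (fun x r => dsolC Y x (rc r ^+ 2))
    q_le (supported_truncate_edge q)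
    (fun r => SL_solution_is_sol (solS_eq Y (rc r ^+ 2)))
    (fun r => SL_solution_is_sol (solC_eq Y (rc r ^+ 2)))
    (fun r => (solS_init Y (rc r ^+ 2)).1) (fun r => (solS_init Y (rc r ^+ 2)).2)
    (fun r => (solC_init Y (rc r ^+ 2)).1) (fun r => (solC_init Y (rc r ^+ 2)).2).

Lemma inL2_edge_le q a : 0 <= a -> inL2 edge q -> (L2norm edge q <= a%:E)%E ->
  sqint_le (truncate edge q) (a ^+ 2).
Proof.
move=> a0 [mq _]; apply: sqint_le_L2norm => //; apply: cmeas_truncate mq.
exact: measurable_itv.
Qed.

Lemma omega_mean (N : nat) (p p' : 'I_N -> R -> R[i]) b b' j : omega p j = omega p' j ->
  sqint_le (truncate edge (p j)) b -> sqint_le (truncate edge (p' j)) b' ->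
  cint (fun x => truncate edge (p j) x - truncate edge (p' j) x) = 0.
Proof.
move=> omega_eq p_le p'_le; have two_neq0 : (2^-1 : R[i]) != 0 by rewrite invr_neq0// pnatr_eq0.
rewrite cintB; last 2 first.
- exact: supported_cintegrable (pi_ge0 R) p_le.1 (supported_truncate_edge _).
- exact: supported_cintegrable (pi_ge0 R) p'_le.1 (supported_truncate_edge _).
apply/eqP; rewrite subr_eq0 -!cintegral_indicM; apply/eqP.
by move: omega_eq; rewrite /omega => /(mulfI two_neq0).
Qed.

End PotentialEdge.

Section SpectralDistance.
Variables (R : realType) (N : nat) (o : 'I_N).
Local Notation rc := (real_complex R).

Section Terms.
Variables (q q' : 'I_N -> R -> R[i]).
Variables (Y : forall j, edge_solutions (q j)) (Y' : forall j, edge_solutions (q' j)).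

Lemma Delta_le_spectral_distance : (L2norm setT (fun r : R => rc r ^+ N *
  (Delta o Y (rc r ^+ 2) - Delta o Y' (rc r ^+ 2)))%R <= spectral_distance o Y Y')%E.
Proof. by apply: leeDl; apply: sume_ge0 => k _; exact: Lnorm_ge0. Qed.

Lemma DeltaK_le_spectral_distance k : k != o -> (L2norm setT (fun r : R => rc r ^+ N.-1 *
  (DeltaK o Y (rc r ^+ 2) k - DeltaK o Y' (rc r ^+ 2) k))%R <= spectral_distance o Y Y')%E.
Proof.
move=> ko; rewrite /spectral_distance (bigD1 k)//= addeA.
apply: le_trans (leeDl _ _); last by apply: sume_ge0 => j _; exact: Lnorm_ge0.
by apply: leeDr; exact: Lnorm_ge0.
Qed.

Lemma spectral_distance_ge0 : (0 <= spectral_distance o Y Y')%E.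
Proof. exact: le_trans (Lnorm_ge0 _ _ _) Delta_le_spectral_distance. Qed.

End Terms.

Lemma L2norm_le_potential_norm (q : 'I_N -> R -> R[i]) j :
  (L2norm (@edge R) (q j) <= potential_norm q)%E.
Proof. exact: (le_bigmax _ (fun j => L2norm (@edge R) (q j))). Qed.

Hypothesis hN : (2 <= N)%N.

Theorem potential_stability a : 0 < a -> exists2 A, 0 < A &
  forall (q q' : 'I_N -> R -> R[i])
    (Y : forall j, edge_solutions (q j)) (Y' : forall j, edge_solutions (q' j)) d,
  is_potential q -> is_potential q' -> (forall j, omega q j = omega q' j) ->
  (forall j, L2norm (@edge R) (q j) <= a%:E)%E -> (forall j, L2norm (@edge R) (q' j) <= a%:E)%E ->
  0 <= d -> (spectral_distance o Y Y' <= d%:E)%E ->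
  forall j, (L2norm (@edge R) (fun x => q j x - q' j x)%R <= (A * d)%:E)%E.
Proof.
move=> a0; have b0 : 0 < a ^+ 2 by rewrite exprn_gt0.
have [A A0 stable] := cross_Delta_stability o hN (pi_gt0 R) b0.
pose B := A * (4 * Delta_const N pi (a ^+ 2) ^+ 2).
have B0 : 0 <= B by rewrite mulr_ge0// mulr_ge0// sqr_ge0.
exists (1 + Num.sqrt B) => [|q q' Y Y' d pq pq' omega_eq q_le q'_le d0 dist_le j].
  by rewrite ltr_wpDr// sqrtr_ge0.
have trunc_le i := inL2_edge_le (ltW a0) (pq i) (q_le i).
have trunc'_le i := inL2_edge_le (ltW a0) (pq' i) (q'_le i).
pose e i := potential_edge (Y i) (trunc_le i); pose e' i := potential_edge (Y' i) (trunc'_le i).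
have mean0 i : cint (potential_diff e e' i) = 0 :=
  omega_mean (omega_eq i) (trunc_le i) (trunc'_le i).
have Delta_le : sqint_le (scaled_Delta_diff o e e') (d ^+ 2).
  rewrite -[scaled_Delta_diff _ _ _]truncateT; apply: sqint_le_L2norm => //.
    by rewrite truncateT; exact: cmeas_scaled_Delta_diff hN (pi_gt0 R) b0 _ _.
  exact: le_trans (Delta_le_spectral_distance Y Y') dist_le.
have DeltaK_le k : k != o -> sqint_le (scaled_DeltaK_diff o e e' k) (d ^+ 2).
  move=> ko; rewrite -[scaled_DeltaK_diff _ _ _ _]truncateT; apply: sqint_le_L2norm => //.
    by rewrite truncateT; exact: cmeas_scaled_DeltaK_diff hN (pi_gt0 R) b0 _ _ _ ko.
  exact: le_trans (DeltaK_le_spectral_distance Y Y' ko) dist_le.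
have cross_le k ko := cross_Delta_upper hN (pi_gt0 R) b0 ko Delta_le (DeltaK_le k ko).
have := stable e e' _ mean0 cross_le j.
rewrite mulrA -/B => diff_le; apply: L2norm_le; first by rewrite mulr_ge0// addr_ge0// sqrtr_ge0.
apply: (eq_sqint_le (f := potential_diff e e' j)); first by move=> x; rewrite /truncate mulrBr.
apply: le_sqint_le diff_le; rewrite exprMn; apply: ler_wpM2r; first exact: sqr_ge0.
by rewrite -[leLHS](sqr_sqrtr B0) ler_sqr ?nnegrE ?addr_ge0 ?sqrtr_ge0// lerDr.
Qed.

End SpectralDistance.

Theorem theorem4 (R : realType) (N : nat) (hN : (2 <= N)%N) (r : R) (hr : 0 < r) :
  exists2 A : R, 0 < A &
    forall (q qt : 'I_N -> R -> R[i])
           (Y : forall j, edge_solutions (q j)) (Yt : forall j, edge_solutions (qt j)),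
      is_potential q -> is_potential qt ->
      (forall j, omega q j = omega qt j) ->
      (potential_norm q < r%:E)%E -> (potential_norm qt < r%:E)%E ->
      (potential_norm (fun j x => (q j x - qt j x)%R)
         <= A%:E * spectral_distance (Ordinal (ltnW hN)) Y Yt)%E.
Proof.
have [A A0 stable] := potential_stability (Ordinal (ltnW hN)) hN hr.
exists A => // q qt Y Yt pq pqt omega_eq q_lt qt_lt.
have q_le j := le_trans (L2norm_le_potential_norm q j) (ltW q_lt).
have qt_le j := le_trans (L2norm_le_potential_norm qt j) (ltW qt_lt).
have dist0 := spectral_distance_ge0 (Ordinal (ltnW hN)) Y Yt.
have stable_at d := stable q qt Y Yt d pq pqt omega_eq q_le qt_le.
case: (spectral_distance _ _ _) dist0 stable_at => [d d0 stable_at| _ _|//].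
- rewrite -EFinM; apply/bigmax_leP; split; first by rewrite lee_fin mulr_ge0// ltW.
  by move=> j _; exact: stable_at.
- by rewrite gt0_muley ?leey ?lte_fin.
Qed.
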